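(* For every constant $\epsilon>0$ there is a randomized CONGEST algorithm that, given an undirected weighted $n$-vertex graph $G$ of (hop) diameter $D$ with edge weights in $\{0,\dots,W\}$, $W=\mathrm{poly}(n)$, computes with high probability a $(2+\epsilon)$-approximation of the minimum weight cycle weight of $G$ in $\tilde{O}\!\left(\min\!\left(n^{3/4}D^{1/4}+n^{1/4}D,\ n^{3/4}+n^{0.65}D^{2/5}+n^{1/4}D,\ n\right)\right)$ rounds.
   Context: CONGEST model: the communication network is the undirected graph $G=(V,E)$, $n=|V|$; each node has a unique identifier in $\{0,\dots,n-1\}$, knows its own and its neighbours' identifiers and the weights of its incident edges; computation proceeds in synchronous rounds in which each node may send a message of $O(\log n)$ bits to each neighbour; local computation is free. A $(2+\epsilon)$-approximation of the minimum weight cycle weight $g^*$ is a value $\tilde{g}$ (the weight of a cycle of $G$) with $g^*\le\tilde{g}\le(2+\epsilon)g^*$. $\tilde{O}$ hides polylogarithmic factors in $n$. *)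

(* Defs.v *)
From Stdlib Require Import Reals ClassicalEpsilon.
From mathcomp Require Import all_boot.

Set Implicit Arguments.
Unset Strict Implicit.
Unset Printing Implicit Defensive.

Definition simple_graph (n : nat) (e : rel 'I_n) : Prop :=
  (forall u v, e u v = e v u) /\ (forall u, ~~ e u u).

Definition sym_weights (n : nat) (e : rel 'I_n) (w : 'I_n -> 'I_n -> nat) : Prop :=
  forall u v, e u v -> w u v = w v u.

Definition weights_bounded (n : nat) (e : rel 'I_n) (w : 'I_n -> 'I_n -> nat)
  (W : nat) : Prop :=
  forall u v, e u v -> w u v <= W.

Definition hop_diameter (n : nat) (e : rel 'I_n) (D : nat) : Prop :=
  (forall u v : 'I_n, exists p : seq 'I_n,
       [/\ path e u p, last u p = v & size p <= D]) /\
  (exists u v : 'I_n, forall p : seq 'I_n,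
       path e u p -> last u p = v -> D <= size p).

Definition is_cycle (n : nat) (e : rel 'I_n) (c : seq 'I_n) : bool :=
  [&& 2 < size c, uniq c & cycle e c].

Definition cycle_weight (n : nat) (w : 'I_n -> 'I_n -> nat) (c : seq 'I_n) : nat :=
  match c with
  | [::] => 0
  | x :: p => sumn (pairmap w x (rcons p x))
  end.

(* The full local knowledge of a node (local computation is free, so a node
   may remember everything):
   (n, own id, [(neighbour id, weight of incident edge)] sorted by id,
    private random bits, history: for each past round the list of
    (sender id, message) received from its neighbours). *)
Definition knowledge : Type :=
  (nat * nat * seq (nat * nat) * seq bool * seq (seq (nat * seq bool)))%type.

Record congest_algo : Type := CongestAlgo {
  rnd_len : nat -> nat;
  bw_const : nat;
  send : knowledge -> nat -> seq bool; (* message to the neighbour with given id *)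
  decide : knowledge -> option nat     (* output (irrevocable at first Some) *)
}.

Definition bandwidth (A : congest_algo) (n : nat) : nat :=
  bw_const A * (trunc_log 2 n).+1.

Section Run.
Variables (A : congest_algo) (n : nat) (e : rel 'I_n) (w : 'I_n -> 'I_n -> nat)
  (rnd : 'I_n -> seq bool).

Definition nbrs (v : 'I_n) : seq (nat * nat) :=
  [seq (nat_of_ord u, w v u) | u <- enum 'I_n & e v u].

Definition know (v : 'I_n) (h : seq (seq (nat * seq bool))) : knowledge :=
  (n, nat_of_ord v, nbrs v, rnd v, h).

Fixpoint hist (t : nat) : 'I_n -> seq (seq (nat * seq bool)) :=
  match t with
  | 0 => fun _ => [::]
  | t'.+1 =>
      let h := hist t' in
      fun v => rcons (h v)
        [seq (nat_of_ord u, take (bandwidth A n) (send A (know u (h u)) v))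
        | u <- enum 'I_n & e u v]
  end.

Definition output_at (t : nat) (v : 'I_n) : option nat :=
  decide A (know v (hist t v)).

End Run.

Definition mwc_approx (eps : R) (n : nat) (e : rel 'I_n)
  (w : 'I_n -> 'I_n -> nat) (g : nat) : Prop :=
  (exists c, is_cycle e c /\ cycle_weight w c = g) /\
  (forall c, is_cycle e c -> Rle (INR g) (Rmult (Rplus 2 eps) (INR (cycle_weight w c)))).

Definition succeeds (A : congest_algo) (eps : R) (T : nat) (n : nat)
  (e : rel 'I_n) (w : 'I_n -> 'I_n -> nat)
  (r : {ffun 'I_n -> (rnd_len A n).-tuple bool}) : Prop :=
  forall v : 'I_n, exists t g,
    [/\ t <= T,
        output_at A e w (fun u => tval (r u)) t v = Some g,
        (forall s, s < t -> output_at A e w (fun u => tval (r u)) s v = None)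
      & mwc_approx eps e w g].

Definition pbool (P : Prop) : bool :=
  if excluded_middle_informative P then true else false.

(* With high probability: the fraction of random strings (uniform over all
   private random bits of all nodes) for which the run succeeds is >= 1 - 1/n. *)
Definition whp_succeeds (A : congest_algo) (eps : R) (T : nat) (n : nat)
  (e : rel 'I_n) (w : 'I_n -> 'I_n -> nat) : Prop :=
  (n - 1) * #|{ffun 'I_n -> (rnd_len A n).-tuple bool}|
    <= n * #|[set r : {ffun 'I_n -> (rnd_len A n).-tuple bool} |
               pbool (@succeeds A eps T n e w r)]|.

Definition round_bound (n D : nat) : R :=
  let nr := INR n in let Dr := INR D in
  (Rmin (Rpower nr (3/4) * Rpower Dr (1/4) + Rpower nr (1/4) * Dr)
    (Rmin (Rpower nr (3/4) + Rpower nr (65/100) * Rpower Dr (2/5)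
           + Rpower nr (1/4) * Dr) nr))%R.

(* Main.v *)
(* Replace [w] by the positive weights f = N1 w + 1 with N1 a large multiple of n,
   and let G be the minimal f-weight of a cycle C, k about n^(3/4) and S a random
   sample of about n^(1/4) vertices. If some vertex u of C has at least k vertices
   within distance about G / 2, then with high probability such a vertex is in S;
   as any k consecutive vertices of a fixed shortest path also meet S, distances
   from S are approximated by paths in a skeleton graph on S, whose edges are
   rounded distances over at most k edges. The approximate shortest path tree of s
   then has a non-tree edge (x, y) on C with d(s,x) + f(x,y) + d(s,y) at most about
   2 d(s,u) + G <= 2 G. Otherwise all the balls around vertices of C are small, and
   the rounded shortest path tree of a vertex of C is found by flooding from all
   vertices at once, each node forwarding nearest sources first.

   In all cases a candidate is a non-tree edge (x, y) of a tree given by parent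
   pointers along which a potential decreases by at least the edge weight. Its
   fundamental cycle may have about n edges; its exact weight is obtained by
   cutting the tree paths at a second random sample and minimising, over the
   common ancestors z of x and y, the lengths of the tree paths from x and y to z.

   Every communication step is a flood that takes O(n^(3/4) + D) rounds up to
   logarithmic factors, and n^(3/4) + D <= 2 round_bound n D. *)

Require Import Defs.
From Stdlib Require Import Reals ClassicalEpsilon Lra.
From mathcomp Require Import all_boot zify.

Set Implicit Arguments.
Unset Strict Implicit.
Unset Printing Implicit Defensive.

(** When a flood begins, all nodes know its length, so they run in step and never have to detect
    termination; only the hop bound has to be found first, by doubling. A flood delivers a key in
    time (distance + number of competing items), so distances must be small integers. A path of
    length F with at most k edges is measured in units of about F / (E k): its length becomes O(E
    k), and rounding adds at most F / E. As F is unknown, all scales are tried. Estimates are E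
    times the distance up to a factor 1 + 1/E, and the balls are enlarged by the same factor;
    together the ratio is (E + 1)(2 E + 1) / E^2 <= 2 + 4 / E. An estimate need not be the weight of
    any cycle, whereas the output must be one: hence the exact second phase. Its tree depends on the
    first sample, so the second sample must be independent of it. Node 0 alone draws and broadcasts
    both samples, which reduces the probability to counting the strings of one node. Positivity of f
    makes potentials strictly decreasing, hence parent pointers acyclic and tree paths unique. *)

Lemma pboolP (P : Prop) : reflect P (pbool P).
Proof. by rewrite /pbool; case: excluded_middle_informative => h; constructor. Qed.

Lemma ex_pbool (P : nat -> Prop) : (exists x, P x) -> exists x, pbool (P x).
Proof. by move=> [x px]; exists x; apply/pboolP. Qed.

(** * Messages, programs and their execution *)

(** Local computation is free and [send] and [decide] are arbitrary functions, so a node may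
    evaluate any predicate, even one decided only by excluded middle. *)
Definition least (P : nat -> Prop) : option nat :=
  match excluded_middle_informative (exists x, P x) with
  | left ex => Some (ex_minn (ex_pbool ex))
  | right _ => None
  end.

Lemma least_some (P : nat -> Prop) x :
  least P = Some x -> P x /\ forall y, P y -> x <= y.
Proof.
rewrite /least; case: excluded_middle_informative => // ex [<-].
case: ex_minnP => m /pboolP pm min; split=> // y py.
by apply: min; apply/pboolP.
Qed.

Lemma least_ex (P : nat -> Prop) x : P x -> exists2 y, least P = Some y & y <= x.
Proof.
move=> px; case h : (least P) => [y|].
  by exists y => //; have [_] := least_some h; apply.
move: h; rewrite /least; case: excluded_middle_informative => // h.
by case: h; exists x.
Qed.

Lemma least_eq (P : nat -> Prop) x :
  P x -> (forall y, P y -> x <= y) -> least P = Some x.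
Proof.
move=> px min; have [y hy lyx] := least_ex px.
have [py _] := least_some hy.
by rewrite hy; congr Some; apply/eqP; rewrite eqn_leq lyx min.
Qed.

Lemma least_ext (P P' : nat -> Prop) : (forall x, P x <-> P' x) -> least P = least P'.
Proof.
move=> h; case h' : (least P') => [x|].
  have [px min] := least_some h'; apply: least_eq; first exact/h.
  by move=> y /h; exact: min.
case h1 : (least P) => [x|] //; have [/h px _] := least_some h1.
by have [y] := least_ex px; rewrite h'.
Qed.

Fixpoint bits w x := if w is w'.+1 then odd x :: bits w' x./2 else [::].
Fixpoint unbits (s : seq bool) := if s is b :: s' then b + (unbits s').*2 else 0.

Lemma size_bits w x : size (bits w x) = w.
Proof. by elim: w x => //= w ih x; rewrite ih. Qed.

Lemma bitsK w x : x < 2 ^ w -> unbits (bits w x) = x.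
Proof.
elim: w x => [|w ih] x /=; first by case: x.
rewrite expnS => h; rewrite ih; first exact: odd_double_half.
lia.
Qed.

Lemma unbits_lt s : unbits s < 2 ^ size s.
Proof. by elim: s => //= b s ih; rewrite expnS; case: b; lia. Qed.

Notation log := (seq (nat * (nat * nat))).

(* [Flood src acc len k]: participate in a flood of [len.+1] rounds, injecting
   the items [src] (item, payload); a message of the neighbour [u] is accepted
   at distance cost [om] and payload increment [c] if [acc u = Some (om, c)]. *)
Inductive prog (A : Type) : Type :=
| Ret of A
| Flood of seq (nat * nat) & (nat -> option (nat * nat)) & nat & (log -> prog A).

Fixpoint bind A A' (P : prog A) (K : A -> prog A') : prog A' :=
  match P with
  | Ret x => K x
  | Flood src acc len k => Flood src acc len (fun lg => bind (k lg) K)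
  end.

Section LocalFlood.
Variables (B M : nat) (src : seq (nat * nat)) (acc : nat -> option (nat * nat)).

(* A key [d * B + m] stands for the item [m < B] at distance [d]; keys and
   payloads stay below [M], so that they fit into one message. *)
Inductive entry (lg : log) : nat -> nat -> option nat -> Prop :=
| EntSrc m p : (m, p) \in src -> m < M -> entry lg m (minn p M.-1) None
| EntRcv u x p om c : (u, (x, p)) \in lg -> acc u = Some (om, c) ->
    x + om * B < M -> entry lg (x + om * B) (minn (p + c) M.-1) (Some u).

(** Residues modulo [B] are items. An item is sent again only at a smaller distance; this happens
    when the shorter route turns out to be the slower one. *)
Definition fresh (snt : seq nat) x :=
  ~~ has (fun y => (y <= x) && (y == x %[mod B])) snt.

Definition next_msg (lg : log) (snt : seq nat) : option (nat * nat) :=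
  if least (fun x => (exists p o, entry lg x p o) /\ fresh snt x) is Some x then
    omap (pair x) (least (fun p => exists o, entry lg x p o))
  else None.

Lemma entry_lt lg x p o : 0 < M -> entry lg x p o -> x < M /\ p < M.
Proof. by move=> M0; case=> *; split=> //; rewrite gtn_min; apply/orP; right; lia. Qed.

Lemma entry_sub lg lg' x p o : {subset lg <= lg'} -> entry lg x p o -> entry lg' x p o.
Proof. by move=> sub; case=> *; [apply: EntSrc|apply: EntRcv; eauto]. Qed.

Lemma next_msgP lg snt x p : next_msg lg snt = Some (x, p) ->
  [/\ exists o, entry lg x p o, fresh snt x &
      forall y p' o, entry lg y p' o -> fresh snt y -> x <= y].
Proof.
rewrite /next_msg; case h : (least _) => [y|] //; case h' : (least _) => [p'|] //= [<- <-].
have [[_ hf] min] := least_some h; have [ho _] := least_some h'.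
by split=> // z p1 o1 hz hfz; apply: min; split=> //; exists p1, o1.
Qed.

Lemma next_msg_ex lg snt x p o : entry lg x p o -> fresh snt x ->
  exists y p', next_msg lg snt = Some (y, p').
Proof.
move=> hx hf; rewrite /next_msg.
have [y hy _] := @least_ex (fun x => (exists p o, entry lg x p o) /\ fresh snt x) x
  (conj (ex_intro _ p (ex_intro _ o hx)) hf).
rewrite hy; have [[[p' [o' hy']] _] _] := least_some hy.
have [p2 -> _] := @least_ex (fun p => exists o, entry lg y p o) p' (ex_intro _ o' hy').
by exists y, p2.
Qed.

End LocalFlood.

Section GlobalFlood.
Variables (B M n : nat) (e : rel 'I_n).

Fixpoint flood (src : 'I_n -> seq (nat * nat)) (acc : 'I_n -> nat -> option (nat * nat))
    (t : nat) : 'I_n -> log * seq nat :=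
  match t with
  | 0 => fun _ => ([::], [::])
  | t'.+1 => let s := flood src acc t' in
      let nx u := next_msg B M (src u) (acc u) (s u).1 (s u).2 in
      fun v =>
      ((s v).1 ++ pmap (fun u => omap (pair (nat_of_ord u)) (nx u))
                    [seq u <- enum 'I_n | e u v],
       (s v).2 ++ (if nx v is Some (x, _) then [:: x] else [::]))
  end.

(** An execution exists only if all nodes enter floods of one common length together; proving [runs]
    thus includes proving that the nodes stay synchronised. *)
Inductive runs A : ('I_n -> prog A) -> nat -> ('I_n -> A) -> Prop :=
| RunRet P r : (forall v, P v = Ret (r v)) -> runs P 0 r
| RunFlood P src acc len k T r :
    (forall v, P v = Flood (src v) (acc v) len (k v)) ->
    runs (fun v => k v (flood src acc len.+1 v).1) T r -> runs P (len.+1 + T) r.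

Lemma runs_ext A (P P' : 'I_n -> prog A) T r : P =1 P' -> runs P T r -> runs P' T r.
Proof.
move=> eqP h; case: h eqP => [Q r' hQ|Q src acc len k T' r' hQ hk] eqP.
  by apply: RunRet => v; rewrite -eqP.
by apply: RunFlood hk => v; rewrite -eqP.
Qed.

Lemma runs_flood A src acc len (k : 'I_n -> log -> prog A) T r :
  runs (fun v => k v (flood src acc len.+1 v).1) T r ->
  runs (fun v => Flood (src v) (acc v) len (k v)) (len.+1 + T) r.
Proof. exact: RunFlood. Qed.

Lemma runs_bind A A' (P : 'I_n -> prog A) (K : 'I_n -> A -> prog A') T T' r r' :
  runs P T r -> runs (fun v => K v (r v)) T' r' ->
  runs (fun v => bind (P v) (K v)) (T + T') r'.
Proof.
elim=> {P T r} [P r hP|P src acc len k T r hP _ ih] hK.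
  by apply: runs_ext hK => v; rewrite hP.
rewrite -addnA; apply: (@RunFlood _ _ src acc len (fun v lg => bind (k v lg) (K v))).
  by move=> v; rewrite hP.
exact: ih.
Qed.

End GlobalFlood.

(** * Compilation of programs into CONGEST algorithms *)

Section Machine.
Variables (beta : nat) (Bd : nat -> nat) (rl : nat -> nat).
Variable P0 : nat -> nat -> seq (nat * nat) -> seq bool -> prog nat.

Definition Wd n := beta * (trunc_log 2 n).+1.

(** The remaining program, the round within the current flood, and the log and the sent keys of that
    flood. The state is replayed from the history, which [knowledge] keeps in full. *)
Notation mstate := (prog nat * nat * log * seq nat)%type.

Definition mnext n (st : mstate) : option (nat * nat) :=
  let: (P, t, lg, snt) := st in
  if P is Flood src acc _ _ then next_msg (Bd n) (2 ^ Wd n) src acc lg snt else None.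

Definition encode w (o : option (nat * nat)) : seq bool :=
  if o is Some (x, p) then bits w x ++ bits w p else [::].

Definition decode w (s : seq bool) : option (nat * nat) :=
  if s is [::] then None else Some (unbits (take w s), unbits (drop w s)).

Definition mstep n (st : mstate) (inbox : seq (nat * seq bool)) : mstate :=
  let: (P, t, lg, snt) := st in
  match P with
  | Ret _ => st
  | Flood src acc len k =>
    let lg' := lg ++ pmap (fun m => omap (pair m.1) (decode (Wd n) m.2)) inbox in
    let snt' := snt ++ (if mnext n st is Some (x, _) then [:: x] else [::]) in
    if t == len then (k lg', 0, [::], [::]) else (P, t.+1, lg', snt')
  end.

Definition mstate_of (K : knowledge) : mstate :=
  let: (n, id, nb, rnd, h) := K in
  foldl (mstep n) (P0 n id nb rnd, 0, [::], [::]) h.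

Definition algo : congest_algo := {|
  rnd_len := rl;
  bw_const := 2 * beta;
  send := fun K _ => encode (Wd (K.1.1.1.1)) (mnext (K.1.1.1.1) (mstate_of K));
  decide := fun K => if (mstate_of K).1.1.1 is Ret g then Some g else None |}.

Hypothesis beta0 : 0 < beta.

Lemma mnext_lt n st x p : mnext n st = Some (x, p) -> x < 2 ^ Wd n /\ p < 2 ^ Wd n.
Proof.
case: st => [[[[//|src acc len k] t] lg] snt] /= /next_msgP [[o ho] _ _].
by apply: entry_lt ho; rewrite expn_gt0.
Qed.

(** A message is two words of [Wd n] bits, exactly the bandwidth, so [take] cuts nothing off.
    Silence is the empty message; as [beta] is positive, words are nonempty and the two are not
    confused. *)
Lemma encodeK n st :
  decode (Wd n) (take (bandwidth algo n) (encode (Wd n) (mnext n st))) = mnext n st.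
Proof.
case h : (mnext n st) => [[x p]|] //=.
have [lx lp] := mnext_lt h.
rewrite take_oversize; last first.
  by rewrite size_cat !size_bits /bandwidth /= /Wd; lia.
have : 0 < Wd n by rewrite /Wd muln_gt0 beta0.
have := size_bits (Wd n) x; case hb : (bits _ x) => [|b s] hs; first by move: hs => /= <-.
rewrite -hb => _; rewrite /decode; case hc: (_ ++ _) => [|b' s']; first by rewrite hb in hc.
by rewrite -hc take_size_cat ?size_bits // drop_size_cat ?size_bits // !bitsK.
Qed.

Section Exec.
Variables (n : nat) (e : rel 'I_n) (w : 'I_n -> 'I_n -> nat) (rnd : 'I_n -> seq bool).

Definition mst t v := mstate_of (know e w rnd v (hist algo e w rnd t v)).

Lemma mstS t v : mst t.+1 v = mstep n (mst t v)
  [seq (nat_of_ord u, take (bandwidth algo n) (encode (Wd n) (mnext n (mst t u))))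
     | u <- enum 'I_n & e u v].
Proof. by rewrite {1}/mst /mstate_of /know /= foldl_rcons. Qed.

Let flB := flood (Bd n) (2 ^ Wd n) e.

Lemma mst_flood src acc len k t0 :
  (forall v, mst t0 v = (Flood (src v) (acc v) len (k v), 0, [::], [::])) ->
  (forall j v, j <= len -> mst (t0 + j) v =
     (Flood (src v) (acc v) len (k v), j, (flB src acc j v).1, (flB src acc j v).2)) /\
  (forall v, mst (t0 + len.+1) v = (k v (flB src acc len.+1 v).1, 0, [::], [::])).
Proof.
move=> h0.
have inb j v : (forall v, mst (t0 + j) v =
     (Flood (src v) (acc v) len (k v), j, (flB src acc j v).1, (flB src acc j v).2)) ->
  (flB src acc j v).1 ++ pmap (fun m => omap (pair m.1) (decode (Wd n) m.2))
   [seq (nat_of_ord u, take (bandwidth algo n) (encode (Wd n) (mnext n (mst (t0 + j) u))))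
     | u <- enum 'I_n & e u v] = (flB src acc j.+1 v).1.
  move=> hj; congr (_ ++ _).
  elim: [seq u <- _ | _] => //= u s ih; rewrite encodeK hj /= ih //.
have H j v : j <= len -> mst (t0 + j) v =
     (Flood (src v) (acc v) len (k v), j, (flB src acc j v).1, (flB src acc j v).2).
  elim: j v => [|j ih] v lj; first by rewrite addn0 h0.
  rewrite addnS mstS {1}ih; last exact: ltnW.
  rewrite /mstep (ltn_eqF lj) inb; last by move=> u; apply: ih; exact: ltnW.
  by congr (_, _, _, _).
split=> // v.
rewrite addnS mstS {1}H // /mstep eqxx inb // => u.
exact: H.
Qed.

Lemma mst_runs P T r t0 : runs (Bd n) (2 ^ Wd n) e P T r ->
  (forall v, mst t0 v = (P v, 0, [::], [::])) ->
  (forall v, mst (t0 + T) v = (Ret (r v), 0, [::], [::])) /\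
  (forall s v, s < T -> decide algo (know e w rnd v (hist algo e w rnd (t0 + s) v)) = None).
Proof.
move=> h; elim: h t0 => {P T r} [P r hP|P src acc len k T r hP _ ih] t0 h0.
  by split=> // v; rewrite addn0 h0 hP.
have [|h1 h2] := @mst_flood src acc len k t0; first by move=> v; rewrite h0 hP.
have [h3 h4] := ih _ h2.
split=> [v|s v ls]; first by rewrite addnA h3.
have [lsl|lsl] := leqP s len.
  by change ((if (mst (t0 + s) v).1.1.1 is Ret g then Some g else None) = None); rewrite h1.
have -> : t0 + s = t0 + len.+1 + (s - len.+1) by lia.
by apply: h4; lia.
Qed.

Lemma algo_output T r :
  runs (Bd n) (2 ^ Wd n) e (fun v => P0 n v (nbrs e w v) (rnd v)) T r ->
  forall v, output_at algo e w rnd T v = Some (r v) /\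
    forall s, s < T -> output_at algo e w rnd s v = None.
Proof.
move=> h v; have [|h1 h2] := @mst_runs _ _ _ 0 h; first by [].
split; last by move=> s ls; rewrite /output_at; exact: h2.
change ((if (mst T v).1.1.1 is Ret g then Some g else None) = Some (r v)).
by rewrite -[T]add0n h1.
Qed.

End Exec.
End Machine.

(** * Flooding *)

Section FloodTheory.
Variables (B M n : nat) (e : rel 'I_n).
Variables (src : 'I_n -> seq (nat * nat)) (acc : 'I_n -> nat -> option (nat * nat)).

Notation st := (flood B M e src acc).
Notation ent t v := (entry B M (src v) (acc v) (st t v).1).

Lemma log_mono t t' v : t <= t' -> {subset (st t v).1 <= (st t' v).1}.
Proof.
move=> /subnK <-; elim: (t' - t) => // d ih x hx.
by rewrite addSn /= mem_cat ih.
Qed.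

Lemma sent_mono t t' v : t <= t' -> {subset (st t v).2 <= (st t' v).2}.
Proof.
move=> /subnK <-; elim: (t' - t) => // d ih x hx.
by rewrite addSn /= mem_cat ih.
Qed.

Lemma entry_mono t t' v x p o : t <= t' -> ent t v x p o -> ent t' v x p o.
Proof. by move=> lt; apply: entry_sub; exact: log_mono. Qed.

Lemma log_sound t v u' x p : (u', (x, p)) \in (st t v).1 ->
  exists (u : 'I_n) t' o, [/\ u' = u :> nat, e u v, t' < t & ent t' u x p o].
Proof.
elim: t => //= t ih; rewrite mem_cat => /orP[/ih [u [t' [o [h1 h2 h3 h4]]]]|].
  by exists u, t', o; split=> //; exact: ltnW.
rewrite mem_pmap => /mapP [u]; rewrite mem_filter => /andP [euv _].
case h : (next_msg _ _ _ _ _ _) => [[y q]|] //= [-> -> ->].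
by have [[o ho] _ _] := next_msgP h; exists u, t, o.
Qed.

Lemma flood_ind (Pr : 'I_n -> nat -> nat -> option nat -> Prop) :
  (forall v m p, (m, p) \in src v -> m < M -> Pr v m (minn p M.-1) None) ->
  (forall u v x p o om c, Pr u x p o -> e u v -> acc v u = Some (om, c) ->
     x + om * B < M -> Pr v (x + om * B) (minn (p + c) M.-1) (Some (nat_of_ord u))) ->
  forall t v x p o, ent t v x p o -> Pr v x p o.
Proof.
move=> hs hr; elim/ltn_ind => t ih v x p o; case=> [m p0 h1 h2|u' x0 p0 om c hl ha hm].
  exact: hs.
have [u [t' [o' [hu euv lt he]]]] := log_sound hl; subst u'.
exact: hr (ih _ lt _ _ _ _ he) euv ha hm.
Qed.

(** The keys that exist if queueing and suppression are ignored. Every entry is reachable;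
    [flood_class] conversely bounds the time by which a reachable key, or a smaller one of its
    class, is sent. *)
Inductive reach : 'I_n -> nat -> Prop :=
| ReachSrc v m p : (m, p) \in src v -> m < M -> reach v m
| ReachStep u v x om c : reach u x -> e u v -> acc v u = Some (om, c) ->
    x + om * B < M -> reach v (x + om * B).

Lemma entry_reach t v x p o : ent t v x p o -> reach v x.
Proof.
move: t v x p o; apply: flood_ind => [v m p|u v x p _ om c].
  exact: ReachSrc.
exact: ReachStep.
Qed.

Lemma sent_entry t v x : x \in (st t v).2 -> exists p o, ent t v x p o.
Proof.
elim: t => //= t ih; rewrite mem_cat => /orP[/ih [p [o h]]|].
  by exists p, o; apply: (@entry_mono t t.+1).
case h : (next_msg _ _ _ _ _ _) => [[y q]|] //; rewrite inE => /eqP ->.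
by have [[o ho] _ _] := next_msgP h; exists q, o; apply: (@entry_mono t t.+1).
Qed.

Lemma sent_log t u v x : x \in (st t u).2 -> e u v ->
  exists p, (nat_of_ord u, (x, p)) \in (st t v).1.
Proof.
move=> + euv; elim: t => //= t ih; rewrite mem_cat => /orP[/ih [p h]|].
  by exists p; rewrite mem_cat h.
case h : (next_msg _ _ _ _ _ _) => [[y q]|] //; rewrite inE => /eqP ->.
exists q; rewrite mem_cat mem_pmap; apply/orP; right; apply/mapP.
by exists u; rewrite ?h // mem_filter euv mem_enum.
Qed.

Lemma sent_step t u v x om c : x \in (st t u).2 -> e u v ->
  acc v u = Some (om, c) -> x + om * B < M ->
  exists p, ent t v (x + om * B) p (Some (nat_of_ord u)).
Proof.
move=> hx euv ha hm; have [p hp] := sent_log hx euv.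
by exists (minn (p + c) M.-1); apply: EntRcv hp ha hm.
Qed.

Lemma flood_step t v x p o : ent t v x p o ->
  exists y q, [/\ (exists q' o', ent t v y q' o'), fresh B (st t v).2 y,
    next_msg B M (src v) (acc v) (st t v).1 (st t v).2 = Some (y, q) & y <= x] \/
  exists2 y, y \in (st t v).2 & y <= x /\ y = x %[mod B].
Proof.
move=> hx; case hf : (fresh B (st t v).2 x); last first.
  move/negbFE/hasP: hf => [y hy /andP [l /eqP c]].
  by exists 0, 0; right; exists y.
have [y [q hn]] := next_msg_ex hx hf; exists y, q; left.
have [[o' ho'] hf' min] := next_msgP hn.
by split=> //; [exists q, o'|exact: min hx hf].
Qed.

Lemma next_msg_sent t v y q :
  next_msg B M (src v) (acc v) (st t v).1 (st t v).2 = Some (y, q) -> y \in (st t.+1 v).2.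
Proof. by move=> h; rewrite /= h mem_cat inE eqxx orbT. Qed.

Section Class.
Hypothesis B0 : 0 < B.
Hypothesis acc_pos : forall v u om c, acc v u = Some (om, c) -> 0 < om.

(* A key waits at [v] only for smaller keys of other classes, each of which is
   sent once; a minimal key thus leaves [v] by round (distance + rank). *)
Lemma flood_class t v x L : reach v x ->
  (forall y, reach v y -> y <= x -> y %% B \in L) ->
  x %/ B + size L <= t ->
  exists2 y, y \in (st t v).2 & y <= x /\ y = x %[mod B].
Proof.
elim: t v x L => [|t ih] v x L hx hL ht.
  by have := hL _ hx (leqnn _); move: ht; case: (L) => //= a l; rewrite addnS.
have [z hz lzx] := @least_ex (fun y => reach v y /\ y = x %[mod B]) x (conj hx erefl).
have [[rz cz] minz] := least_some hz.
(* Pass to the least reachable key of the class, so that any key of the class that turns up at or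
   below it is equal to it. *)
suff [y hy [ly cy]] : exists2 y, y \in (st t.+1 v).2 & y <= z /\ y = z %[mod B].
  by exists y => //; split; [exact: leq_trans ly lzx|rewrite cy].
have hLz y : reach v y -> y <= z -> y %% B \in L.
  by move=> hy ly; apply: hL => //; exact: leq_trans ly lzx.
have {}ht : z %/ B + size L <= t.+1.
  by apply: leq_trans ht; rewrite leq_add2r leq_div2r.
have {}minz y : reach v y -> y = z %[mod B] -> z <= y.
  by move=> hy cy; apply: minz; split=> //; rewrite cy.
move: z rz hLz ht minz {hz lzx cz hx hL x} => x hx hL ht min.
have sL : x %% B \in L by apply: hL.
(* The key has arrived by round [t]: its predecessor is nearer by [om > 0], so by induction it was
   sent by round [t], possibly as a smaller key of the class, which minimality excludes. *)
have [p [o hent]] : exists p o, ent t v x p o.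
  case: hx hL ht min sL => {v x} [v m p h1 h2|u v x om c ru euv ha hm] hL ht min sL.
    by exists (minn p M.-1), None; apply: EntSrc.
  have om0 := acc_pos ha.
  have [||y hy [ly cy]] := ih u x L ru.
  - move=> y ry ly; rewrite -(modnMDl om) addnC; apply: hL; last by rewrite leq_add2r.
    by apply: ReachStep ry euv ha _; apply: leq_ltn_trans hm; rewrite leq_add2r.
  - by move: ht; rewrite [x + _]addnC divnMDl //; lia.
  have ey : y = x.
    apply/eqP; rewrite eqn_leq ly /= -(leq_add2r (om * B)); apply: min.
      apply: ReachStep euv ha _; last by apply: leq_ltn_trans hm; rewrite leq_add2r.
      by have [p [o /entry_reach]] := sent_entry hy.
    by rewrite ![_ + om * B]addnC !modnMDl.
  by subst y; have [p hp] := sent_step hy euv ha hm; exists p, (Some (nat_of_ord u)).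
have [y [q [[hy fy hn ly]|[z hz [lz cz]]]]] := flood_step hent; last first.
  by exists z => //; apply: sent_mono hz.
have [q' [o' /entry_reach ry]] := hy.
move: ly; rewrite leq_eqVlt => /orP [/eqP ey|ly].
  by exists y; [exact: next_msg_sent hn|rewrite ey].
(* By minimality of [x], the key [y] ahead of it and all keys below [y] lie in other classes.
   Induction with the class of [x] removed from [L] says that the class of [y] has been served
   already, so [y] is not fresh. *)
have [||z hz [lz cz]] := ih v y [seq r <- L | r != x %% B] ry.
- move=> z rz lz; rewrite mem_filter hL //; last by lia.
  rewrite andbT; apply/eqP => cz; have := min _ rz cz; lia.
- have : y %/ B <= x %/ B by apply: leq_div2r; exact: ltnW.
  have : size [seq r <- L | r != x %% B] < size L.
    rewrite -(count_predC (pred1 (x %% B)) L) size_filter.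
    by rewrite -[X in X < _]add0n ltn_add2r -has_count has_pred1.
  lia.
by case/negP: fy; apply/hasP; exists z => //; rewrite lz; apply/eqP.
Qed.

End Class.

(** At cost 0 keys do not change on the way, so the globally least key precedes all others at every
    node and advances one hop per round. *)
Lemma flood_min x0 : (forall v u, acc v u = Some (0, 0)) ->
  (forall v m p, (m, p) \in src v -> x0 <= m) ->
  forall u p0 q, (x0, p0) \in src u -> x0 < M -> path e u q ->
  forall t, size q < t -> x0 \in (st t (last u q)).2.
Proof.
move=> ha hm u p0 q hu xM.
have rge v y : reach v y -> x0 <= y.
  by elim=> [v' m p /hm|u' v' x om c _ h _] //; lia.
have key t v : (exists p o, ent t v x0 p o) -> x0 \in (st t.+1 v).2.
  move=> [p [o hent]]; have [y [q' [[[p' [o' hy]] _ hn ly]|[z hz [lz _]]]]] := flood_step hent.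
    have -> : x0 = y by apply/eqP; rewrite eqn_leq ly (rge v) //; exact: entry_reach hy.
    exact: next_msg_sent hn.
  have [p' [o' /entry_reach /rge]] := sent_entry hz => lx.
  by apply: (@sent_mono t t.+1) => //; rewrite (_ : x0 = z) //; apply/eqP; rewrite eqn_leq lx.
elim/last_ind: q => [|q v ih]; move=> hp [|t] // lt.
  by apply: key; exists (minn p0 M.-1), None; apply: EntSrc.
move: hp lt; rewrite rcons_path size_rcons last_rcons => /andP [hp ev] lt.
have hs := ih hp t lt; have xM' : x0 + 0 * B < M by rewrite addn0.
apply: key; have [p hq] := sent_step hs ev (ha _ _) xM'.
by exists p, (Some (nat_of_ord (last u q))); move: hq; rewrite addn0.
Qed.

End FloodTheory.

(** * Broadcast of items to all nodes *)

Section Bcast.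
Variables (B M n : nat) (e : rel 'I_n).
Variable src : 'I_n -> seq (nat * nat).
Hypotheses (B0 : 0 < B).
Hypothesis src_lt : forall v m p, (m, p) \in src v -> m < B.

Notation acc1 := (fun (_ : 'I_n) (_ : nat) => Some (1, 0)).

Definition got B M (items : seq (nat * nat)) (lg : log) (m p : nat) : Prop :=
  exists x o, entry B M items (fun _ => Some (1, 0)) lg x p o /\ x %% B = m.

Lemma reach_path u m p q : (m, p) \in src u -> path e u q ->
  m + size q * B < M -> reach B M e src acc1 (last u q) (m + size q * B).
Proof.
move=> hu; elim/last_ind: q => [|q v ih].
  by rewrite mul0n addn0 => _; exact: ReachSrc hu.
rewrite rcons_path size_rcons last_rcons mulSn => /andP [hp ev] lt.
rewrite (_ : _ + _ = m + size q * B + 1 * B); last by lia.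
have hr : reach B M e src acc1 (last u q) (m + size q * B) by apply: ih => //; lia.
by apply: (ReachStep hr ev (erefl (Some (1, 0)))); lia.
Qed.

Lemma reach_src v x : reach B M e src acc1 v x ->
  exists u p q, [/\ (x %% B, p) \in src u, path e u q, last u q = v & size q = x %/ B].
Proof.
elim=> [{}v m p h lt|u v' {}x om c _ [u0 [p [q [h1 h2 h3 h4]]]] euv [<- _] _].
  by exists v, p, [::]; rewrite modn_small ?divn_small //; exact: src_lt h.
exists u0, p, (rcons q v'); rewrite addnC modnMDl divnMDl // rcons_path h2 h3 last_rcons.
by rewrite size_rcons h4 euv.
Qed.

Lemma got_sound t v m p :
  got B M (src v) (flood B M e src acc1 t v).1 m p ->
  exists u p0, (m, p0) \in src u /\ p = minn p0 M.-1.
Proof.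
move=> [x [o [h <-]]]; move: t v x p o h.
apply: flood_ind => [v m' p hm _|u v x p o om c [u0 [p0 [h ->]]] _ [<- <-] _].
  by exists v, p; rewrite modn_small //; exact: src_lt hm.
by exists u0, p0; rewrite addnC modnMDl addn0 -minnA minnn.
Qed.

Lemma got_complete t L u m p q : (m, p) \in src u -> path e u q ->
  (forall v y p, (y, p) \in src v -> y \in L) ->
  m + size q * B < M -> size q + size L <= t ->
  exists p', got B M (src (last u q)) (flood B M e src acc1 t (last u q)).1 m p'.
Proof.
move=> hu hq hL lt lt'.
have mB := src_lt hu.
have [|||y hy [ly cy]] := @flood_class B M n e src acc1 B0 _ t (last u q) _ L (reach_path hu hq lt).
- by move=> v' u' om c [<-].
- by move=> y /reach_src [u' [p' [q' [h1 _ _ _]]]] _; exact: hL h1.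
- by rewrite [m + _]addnC divnMDl // divn_small // addn0.
have [p' [o ho]] := sent_entry hy; exists p', y, o; split=> //.
by rewrite cy addnC modnMDl modn_small.
Qed.

(** As an item has one payload in the whole graph, it does not matter which copy arrives first;
    payloads below [M] are not clipped. *)
Lemma gotP t L Dm v m p :
  (forall u v : 'I_n, exists q, [/\ path e u q, last u q = v & size q <= Dm]) ->
  (forall v y p, (y, p) \in src v -> y \in L /\ p < M) ->
  (forall u v m p p', (m, p) \in src u -> (m, p') \in src v -> p = p') ->
  Dm.+1 * B <= M -> Dm + size L <= t ->
  got B M (src v) (flood B M e src acc1 t v).1 m p <-> exists u, (m, p) \in src u.
Proof.
move=> hD hL hf hM ht; split=> [/got_sound [u [p0 [h ->]]]|[u hu]].
  have [_ lt] := hL _ _ _ h; exists u.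
  by rewrite (_ : minn p0 M.-1 = p0) //; apply/minn_idPl; lia.
have [q [h1 h2 h3]] := hD u v; have mB := src_lt hu.
have hM' : m + size q * B < M.
  have : size q * B <= Dm * B by rewrite leq_mul2r h3 orbT.
  by move: hM; rewrite mulSn; lia.
have hL' v' y p' : (y, p') \in src v' -> y \in L by move=> /hL [].
have ht' : size q + size L <= t by lia.
have [p' hp'] := got_complete hu h1 hL' hM' ht'.
rewrite h2 in hp'; have [u' [p0 [h4 ep]]] := got_sound hp'.
move: hp'; rewrite ep (hf _ _ _ _ _ h4 hu).
by have [_ lt] := hL _ _ _ hu; rewrite (_ : minn p M.-1 = p) //; apply/minn_idPl; lia.
Qed.

End Bcast.

(** * Exchange of lists between neighbours *)

Section Exch.
Variables (B M n : nat) (e : rel 'I_n).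
Variable src : 'I_n -> seq (nat * nat).
Hypotheses (B0 : 0 < B) (BM : B <= M).
Hypothesis src_lt : forall v m p, (m, p) \in src v -> m < B /\ p < M.
Notation acc0 := (fun (_ : 'I_n) (_ : nat) => None).

Lemma exch_sound t v u' x p : (u', (x, p)) \in (flood B M e src acc0 t v).1 ->
  exists u : 'I_n, [/\ u' = u :> nat, e u v & (x, p) \in src u].
Proof.
move=> /log_sound [u [t' [o [h1 h2 _ h3]]]]; exists u; split=> //.
case: h3 => // m p0 h _; have [_ lt] := src_lt h.
by rewrite (_ : minn p0 M.-1 = p0) //; apply/minn_idPl; lia.
Qed.

(** No message is accepted, so nothing is relayed and all keys have distance 0; a node needs as many
    rounds as it has items. *)
Lemma exchP t v u x p :
  (forall u m p p', (m, p) \in src u -> (m, p') \in src u -> p = p') ->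
  (forall u, size (src u) <= t) -> e u v ->
  (nat_of_ord u, (x, p)) \in (flood B M e src acc0 t v).1 <-> (x, p) \in src u.
Proof.
move=> hf hs euv; split=> [/exch_sound [u' [/val_inj <- _]]|hx] //.
have [xB _] := src_lt hx.
have hr y : reach B M e src acc0 u y -> exists p, (y, p) \in src u.
  by case=> [v' m p' h _|//]; exists p'.
have [||||y hy [ly cy]] := @flood_class B M n e src acc0 B0 _ t u x [seq m.1 | m <- src u].
- by [].
- by apply: ReachSrc hx _; lia.
- move=> y /hr [p' hp'] _; have [yB _] := src_lt hp'.
  by rewrite modn_small //; apply/mapP; exists (y, p').
- by rewrite size_map divn_small // add0n hs.
have [p' hp'] := sent_log hy euv; have [u' [/val_inj eu _ h]] := exch_sound hp'; subst u'.
have [yB _] := src_lt h; move: cy; rewrite !modn_small // => ey; subst y.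
by rewrite (hf _ _ _ _ hx h).
Qed.

End Exch.

(** * Paths and cycles in weighted graphs *)

Section PathLength.
Variable (T : Type).
Implicit Types (h : T -> T -> nat) (u : T) (p q : seq T).

Definition path_len h u p := sumn (pairmap h u p).

Lemma path_len_cat h u p q : path_len h u (p ++ q) = path_len h u p + path_len h (last u p) q.
Proof. by rewrite /path_len pairmap_cat sumn_cat. Qed.

Lemma path_len_rcons h u p v : path_len h u (rcons p v) = path_len h u p + h (last u p) v.
Proof. by rewrite -cats1 path_len_cat /path_len /= addn0. Qed.

Lemma path_len_cons h u p v : path_len h u (v :: p) = h u v + path_len h v p.
Proof. by []. Qed.

Lemma path_len_size h u p : (forall a b, 0 < h a b) -> size p <= path_len h u p.
Proof.
move=> h0; elim: p u => //= v p ih u.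
by rewrite path_len_cons -add1n leq_add.
Qed.

Lemma path_len_bound h N u p : (forall a b, h a b <= N) -> path_len h u p <= size p * N.
Proof.
move=> hN; elim: p u => //= v p ih u.
by rewrite path_len_cons mulSn leq_add.
Qed.

(** The length in units of 2^i / E, rounded above. The increment also makes every cost positive, as
    [flood_class] requires. *)
Definition scaled_weight (E i : nat) h a b := E * h a b %/ 2 ^ i + 1.

Lemma scaled_weight_lower E i h u p : E * path_len h u p <= 2 ^ i * path_len (scaled_weight E i h) u p.
Proof.
elim: p u => [|v p ih] u; first by rewrite muln0.
rewrite !path_len_cons mulnDr [2 ^ i * (_ + path_len _ _ _)]mulnDr; apply: leq_add; last exact: ih.
by rewrite /scaled_weight [2 ^ i * _]mulnC addn1; apply: ltnW; apply: ltn_ceil; rewrite expn_gt0.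
Qed.

Lemma scaled_weight_upper E i h u p : 2 ^ i * path_len (scaled_weight E i h) u p <= E * path_len h u p + 2 ^ i * size p.
Proof.
elim: p u => [|v p ih] u; first by rewrite !muln0.
rewrite !path_len_cons /= mulnDr; apply: leq_trans (leq_add (leqnn _) (ih v)) _.
rewrite /scaled_weight mulnDr muln1 mulnS mulnDr.
have : 2 ^ i * (E * h u v %/ 2 ^ i) <= E * h u v by rewrite mulnC leq_divM.
lia.
Qed.

(** Except for F < k, the scale satisfies 2^i k <= F < 2^(i+1) k. The first inequality bounds the
    total rounding error by F, the second the number of units on the path. *)
Lemma scale_path E k h u p :
  (forall a b, 0 < h a b) -> 0 < k -> size p <= k ->
  let i := trunc_log 2 (path_len h u p %/ k) in
  2 ^ i * path_len (scaled_weight E i h) u p <= E.+1 * path_len h u p /\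
  path_len (scaled_weight E i h) u p <= (2 * E).+1 * k.
Proof.
move=> h0 k0 sp i; set F := path_len h u p.
have sF : size p <= F := path_len_size u p h0.
have up := scaled_weight_upper E i h u p.
have iF : 2 ^ i * size p <= F.
  (* If F < k, the scale is 0 because [trunc_log 2 0] is 0, and positivity of the weights already
     gives [size p <= F]. *)
  have [F0|F0] := posnP (F %/ k).
    by rewrite /i -/F F0 trunc_log0 expn0 mul1n.
  apply: leq_trans (_ : F %/ k * k <= _); last exact: leq_divM.
  by apply: leq_mul sp; exact: trunc_logP.
have Fi : F <= 2 * 2 ^ i * k.
  have [F0|F0] := posnP (F %/ k).
    by have := ltn_ceil F k0; rewrite F0 => ?; rewrite -[X in X <= _]muln1 mulnC leq_mul ?muln_gt0 ?expn_gt0 //; lia.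
  apply: ltnW; apply: leq_trans (ltn_ceil F k0) _; rewrite leq_mul2r.
  by rewrite -expnS trunc_log_ltn // orbT.
split; first by move: up; rewrite -/F mulSn; lia.
rewrite -(leq_pmul2l (m := 2 ^ i)) ?expn_gt0 //.
apply: leq_trans up _; rewrite -/F.
have : E * F <= E * (2 * 2 ^ i * k) by rewrite leq_mul2l Fi orbT.
have : 2 ^ i * size p <= 2 ^ i * k by rewrite leq_mul2l sp orbT.
lia.
Qed.

Lemma path_len_rev h u p (r : rel T) : (forall a b, r a b -> h a b = h b a) -> path r u p ->
  path_len h (last u p) (rev (belast u p)) = path_len h u p.
Proof.
move=> hs; elim: p u => //= v p ih u /andP [ruv hp].
rewrite rev_cons path_len_rcons ih // path_len_cons addnC; congr (_ + _).
by rewrite (hs _ _ ruv); case: p {ih hp} => //= a p; rewrite rev_cons last_rcons.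
Qed.

End PathLength.

Section Graph.
Variables (n : nat) (e : rel 'I_n).
Hypotheses (esym : forall u v, e u v = e v u) (eirr : forall u, ~~ e u u).
Implicit Types (u v a : 'I_n) (p q c : seq 'I_n) (h : 'I_n -> 'I_n -> nat).

Lemma path_rev u p : path e u p -> path e (last u p) (rev (belast u p)).
Proof. by move=> hp; rewrite rev_path -(@eq_path _ e). Qed.

Lemma last_rev_belast (T : Type) (x : T) s : last (last x s) (rev (belast x s)) = x.
Proof. by case: s => //= y s; rewrite rev_cons last_rcons. Qed.

Lemma cycle_weight_cons h x p : cycle_weight h (x :: p) = path_len h x (rcons p x).
Proof. by []. Qed.

Lemma cycle_weight_rot1 h c : cycle_weight h (rot 1 c) = cycle_weight h c.
Proof.
case: c => // x [|y p] //; rewrite rot1_cons !cycle_weight_cons.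
by rewrite path_len_rcons last_rcons rcons_cons path_len_cons path_len_rcons addnC -path_len_rcons.
Qed.

Lemma cycle_weight_rot h i c : cycle_weight h (rot i c) = cycle_weight h c.
Proof.
have [li|/rot_oversize -> //] := ltnP i (size c).
elim: i li => [|i ih] li; first by rewrite rot0.
by rewrite -add1n rotD ?add1n ?cycle_weight_rot1 ?ih // ltnW.
Qed.

Lemma is_cycle_rot i c : is_cycle e (rot i c) = is_cycle e c.
Proof. by rewrite /is_cycle size_rot rot_uniq rot_cycle. Qed.

Lemma is_cycle_rev c : is_cycle e (rev c) = is_cycle e c.
Proof.
rewrite /is_cycle size_rev rev_uniq rev_cycle; congr [&& _, _ & _].
by case: c => //= x p; apply: eq_path => y z; rewrite /= esym.
Qed.

Definition wsym h := forall u v, e u v -> h u v = h v u.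

Lemma cyc_rot c u : is_cycle e c -> u \in c ->
  exists p, [/\ is_cycle e (u :: p), u :: p =i c,
     forall h, cycle_weight h (u :: p) = cycle_weight h c & next c u = head u p].
Proof.
move=> hc uc; case/rot_to: (uc) => i p hr; exists p.
have hc' : is_cycle e (u :: p) by rewrite -hr is_cycle_rot.
split=> // [x|h|]; first by rewrite -hr mem_rot.
  by rewrite -hr cycle_weight_rot.
have/and3P [_ hu _] := hc; rewrite -(next_rot i hu) hr.
by case: (p) => /= [|y q]; rewrite eqxx.
Qed.

Lemma cycle_weight_rev h c : wsym h -> is_cycle e c -> cycle_weight h (rev c) = cycle_weight h c.
Proof.
move=> hs; case: c => // x p /and3P [_ _ hc].
have := path_len_rev hs hc; rewrite last_rcons cycle_weight_cons => <-.
rewrite belast_rcons rev_cons -[RHS]cycle_weight_cons -(cycle_weight_rot1 h (_ :: _)) rot1_cons //.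
Qed.

(** The two arcs do not depend on the weights: the same statement serves [f] near a sample and its
    rounding when the balls are small. *)
Definition splits c u a v := exists p q,
  [/\ path e v p, last v p = u, path e v q, last v q = a &
      forall h, wsym h -> path_len h v p + path_len h v q + h u a <= cycle_weight h c].

Lemma cyc_split_next c u v : is_cycle e c -> u \in c -> v \in c -> splits c u (next c u) v.
Proof.
move=> hc uc vc; have [p [hc' hm hw ->]] := cyc_rot hc uc.
case: p hc' hm hw => [|a p] hc' hm hw; first by case/and3P: hc'.
have /and3P [_ _ /= /andP [eua hp]] := hc'.
have : v \in a :: rcons p u by move: vc; rewrite -hm !inE mem_rcons inE; case: (v == u); rewrite ?orbT.
move eqr : (rcons p u) hp => r hp vr; case/splitPl: vr eqr hp => p1 p2 <- eqr.
rewrite cat_path => /andP [hp1 hp2].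
exists p2, (rev (belast a p1)); split=> //.
- by rewrite -last_cat -eqr last_rcons.
- exact: path_rev.
- exact: last_rev_belast.
move=> h hs; rewrite (path_len_rev hs hp1) -hw cycle_weight_cons rcons_cons path_len_cons eqr path_len_cat.
by rewrite addnC leq_add2l addnC.
Qed.

Lemma cyc_split_prev c u v : is_cycle e c -> u \in c -> v \in c -> splits c u (prev c u) v.
Proof.
move=> hc uc vc; have /and3P [_ hu _] := hc.
have := @cyc_split_next (rev c) u v; rewrite is_cycle_rev !mem_rev next_rev //.
case/(_ hc uc vc) => p [q [h1 h2 h3 h4 h5]]; exists p, q; split=> // h hs.
by rewrite -(cycle_weight_rev hs hc); exact: h5.
Qed.

Lemma cyc_half c v u h : is_cycle e c -> v \in c -> u \in c -> wsym h ->
  exists p, [/\ path e v p, last v p = u & 2 * path_len h v p <= cycle_weight h c].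
Proof.
move=> hc vc uc hs; have [p [hc' hm hw _]] := cyc_rot hc vc.
have /and3P [_ _ hp] := hc'.
have : u \in v :: rcons p v by move: uc; rewrite -hm !inE mem_rcons inE; case: (u == v).
rewrite -hw cycle_weight_cons.
move eqr : (rcons p v) hp => r hp ur; rewrite /cycle eqr in hp.
case/splitPl: ur eqr hp => p1 p2 h1 eqr.
rewrite cat_path => /andP [hp1 hp2]; rewrite path_len_cat.
have [l|l] := leqP (path_len h v p1) (path_len h (last v p1) p2).
  by exists p1; split=> //; lia.
have lv : last (last v p1) p2 = v by rewrite -last_cat -eqr last_rcons.
exists (rev (belast (last v p1) p2)); split.
- by rewrite -{1}lv; apply: path_rev.
- by rewrite -{1}lv last_rev_belast.
by rewrite -{1}lv (path_len_rev hs hp2); lia.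
Qed.

Lemma next_neq_prev c u : is_cycle e c -> u \in c -> next c u != prev c u.
Proof.
move=> /and3P [sz hu hc] uc; case/rot_to: (uc) => i p hr.
have sp : 1 < size p by rewrite -ltnS -[(size p).+1]/(size (u :: p)) -hr size_rot.
have up : uniq (u :: p) by rewrite -hr rot_uniq.
rewrite -(next_rot i hu) -(prev_rot i hu) hr.
have -> : prev (u :: p) u = last u p.
  rewrite /=; have /= /andP [nu _] := up.
  have: forall y, prev_at u u y p = last y p; last by move=> ->.
  elim: p nu {hr sp up} => [|z p ih] /= nu y; first by rewrite eqxx.
  by move: nu; rewrite inE negb_or => /andP [/negbTE -> /ih ->].
case: p sp up {hr} => [//|a [//|b p]] _ /=; rewrite eqxx.
move=> /andP [_ /andP [na _]]; apply: contra na => /eqP {1}->.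
by rewrite mem_last.
Qed.

(* Potentials decrease towards parents, so an edge from a vertex of maximal
   potential to a neighbour other than its parent is not a tree edge. *)
Lemma cyc_nontree c (phi : 'I_n -> nat) (par : 'I_n -> option 'I_n) : is_cycle e c ->
  exists u a, [/\ u \in c, a \in c, e u a, par u <> Some a & phi a <= phi u /\
     forall v, v \in c -> splits c u a v].
Proof.
move=> hc; have /and3P [sz hu hcy] := hc.
have [u uc mx] : exists2 u, u \in c & forall a, a \in c -> phi a <= phi u.
  case: c sz {hc hu hcy} => // x p _; elim: p x => [|y p ih] x.
    by exists x; rewrite ?inE // => a; rewrite inE => /eqP ->.
  have [u uc mx] := ih y; have [l|l] := leqP (phi u) (phi x).
    exists x; rewrite ?inE ?eqxx // => a; rewrite inE => /orP [/eqP -> //|/mx h].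
    exact: leq_trans h l.
  exists u; first by rewrite inE uc orbT.
  by move=> a; rewrite inE => /orP [/eqP ->|/mx //]; exact: ltnW.
have [h|h] := eqVneq (par u) (Some (next c u)).
  exists u, (prev c u); split=> //; first by rewrite mem_prev.
  - by rewrite esym; exact: prev_cycle.
  - by rewrite h => - [] /eqP; apply/negP; exact: next_neq_prev.
  by split=> [|v vc]; [rewrite mx // mem_prev|exact: cyc_split_prev].
exists u, (next c u); split=> //; first by rewrite mem_next.
- exact: next_cycle.
- exact/eqP.
by split=> [|v vc]; [rewrite mx // mem_next|exact: cyc_split_next].
Qed.

Section Dist.
Variable f : 'I_n -> 'I_n -> nat.
Hypothesis conn : forall u v, exists2 p, path e u p & last u p = v.

Definition dist u v :=
  odflt 0 (least (fun x => exists p, [/\ path e u p, last u p = v & path_len f u p = x])).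

Lemma dist_path u v : exists p, [/\ path e u p, last u p = v & path_len f u p = dist u v].
Proof.
rewrite /dist; have [p h1 h2] := conn u v.
have [|y hy _] := @least_ex (fun x => exists p, [/\ path e u p, last u p = v & path_len f u p = x]) (path_len f u p).
  by exists p.
by rewrite hy /=; have [] := least_some hy.
Qed.

Lemma dist_le u p : path e u p -> dist u (last u p) <= path_len f u p.
Proof.
move=> hp; rewrite /dist.
have [|y -> //] := @least_ex (fun x => exists q, [/\ path e u q, last u q = last u p & path_len f u q = x]) (path_len f u p).
by exists p.
Qed.

(** One path is fixed for each pair of vertices, so that the first sample has only n * n paths to
    hit. *)
Definition shortest_path u v := proj1_sig (constructive_indefinite_description _ (dist_path u v)).

Lemma shortest_pathP u v : [/\ path e u (shortest_path u v), last u (shortest_path u v) = v &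
  path_len f u (shortest_path u v) = dist u v].
Proof. exact: (proj2_sig (constructive_indefinite_description _ (dist_path u v))). Qed.

Hypothesis f0 : forall u v, 0 < f u v.

Lemma shortest_uniq u p : path e u p -> path_len f u p <= dist u (last u p) -> uniq (u :: p).
Proof.
elim: p u => // v p ih u hvp hd.
have /andP [euv hp] : e u v && path e v p := hvp.
have upv : uniq (v :: p).
  apply: ih => //; have [q [h1 h2 h3]] := dist_path v (last v p).
  have := @dist_le u (v :: q); rewrite /= euv h1 h2 path_len_cons => /(_ isT).
  by move: hd; rewrite path_len_cons /=; lia.
rewrite cons_uniq upv andbT; apply/negP => uin.
case/splitPl: uin hvp hd => p1 p2 h1; rewrite -cat_cons cat_path => /andP [hp1 hp2] hd.
have := dist_le hp2; move: hd; rewrite path_len_cat path_len_cons last_cat /= h1.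
have := f0 u v; lia.
Qed.

End Dist.
End Graph.

(** * Forests with a decreasing potential *)

Section Forest.
Variables (n : nat) (e : rel 'I_n).
Hypotheses (esym : forall u v, e u v = e v u) (eirr : forall u, ~~ e u u).
Variable f : 'I_n -> 'I_n -> nat.
Hypotheses (f0 : forall u v, 0 < f u v) (fsym : wsym e f).
Variables (E : nat) (phi : 'I_n -> option nat) (par : 'I_n -> option 'I_n) (rt : 'I_n).
Hypothesis E0 : 0 < E.
Hypothesis Hpar : forall v p, par v = Some p -> e p v /\
  exists x y, [/\ phi v = Some x, phi p = Some y & y + E * f v p <= x].
Hypothesis Hroot : forall v x, phi v = Some x -> par v = None -> v = rt.

Definition chain v p := path (fun a b => par a == Some b) v p.

Lemma chain_path v p : chain v p -> path e v p.
Proof.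
apply: sub_path => a b /eqP h; rewrite esym.
by have [] := Hpar h.
Qed.

Lemma chain_phi v p x : chain v p -> phi v = Some x ->
  exists2 y, phi (last v p) = Some y & y + E * path_len f v p <= x.
Proof.
elim: p v x => [|a p ih] v x /=; first by exists x => //; rewrite muln0 addn0.
move=> /andP [/eqP hva hp] hx; have [_ [x' [y [h1 h2 h3]]]] := Hpar hva.
have [z hz lz] := ih _ _ hp h2; exists z => //.
rewrite path_len_cons mulnDr; move: h1; rewrite hx => -[->]; lia.
Qed.

Lemma chain_loop v p : chain v p -> last v p = v -> p = [::].
Proof.
case: p => // a p hp hl; have /andP [/eqP hva _] : (par v == Some a) && chain a p := hp.
have [_ [x [y [h1 _ _]]]] := Hpar hva.
have [z] := chain_phi hp h1; rewrite hl h1 => -[<-].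
have := f0 v a; rewrite path_len_cons mulnDr => h.
have : 0 < E * f v a by rewrite muln_gt0 E0.
lia.
Qed.

(** Since a tree path is determined by its ends, all lengths collected in the second phase for one
    pair of nodes agree. *)
Lemma chain_inj v p q : chain v p -> chain v q -> last v p = last v q -> p = q.
Proof.
elim: p v q => [|a p ih] v [|b q] //= hp hq hl.
- by have := @chain_loop v (b :: q) hq (Logic.eq_sym hl).
- by have := @chain_loop v (a :: p) hp hl.
move: hp hq => /andP [/eqP ha hp] /andP [/eqP hb hq].
by move: hb; rewrite ha => -[?]; subst b; rewrite (ih _ _ hp hq hl).
Qed.

Lemma chain_cat v p q : chain v (p ++ q) = chain v p && chain (last v p) q.
Proof. exact: cat_path. Qed.

Lemma chain_uniq v p : chain v p -> uniq (v :: p).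
Proof.
elim: p v => // a p ih v hp; have /andP [_ hp'] : (par v == Some a) && chain a p := hp.
rewrite cons_uniq ih // andbT; apply/negP => hin.
case/splitPr: hin hp => p1 p2; rewrite -cat_rcons chain_cat => /andP [h _].
by have := chain_loop h (last_rcons _ _ _); case: (p1).
Qed.

Lemma chain_root v x : phi v = Some x -> exists2 p, chain v p & last v p = rt.
Proof.
elim/ltn_ind: x v => x ih v hx; case hp : (par v) => [a|]; last first.
  by exists [::] => //; exact: Hroot hx hp.
have [_ [x' [y [h1 h2 h3]]]] := Hpar hp; move: h1; rewrite hx => -[?]; subst x'.
have : 0 < E * f v a by rewrite muln_gt0 E0 f0.
move=> h; have [|p hc hl] := ih y _ a h2; first by lia.
by exists (a :: p); rewrite //= hp eqxx.
Qed.

(** Both chains continue to [rt], so common ancestors exist. Minimality over pairs of chains is part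
    of the statement because this minimum is what the nodes compute. *)
Lemma lca_cycle x y a b : phi x = Some a -> phi y = Some b -> e x y ->
  par x <> Some y -> par y <> Some x ->
  exists c px py, [/\ is_cycle e c, chain x px, chain y py, last x px = last y py &
    cycle_weight f c = path_len f x px + path_len f y py + f x y /\
    forall p q, chain x p -> chain y q -> last x p = last y q ->
      path_len f x px + path_len f y py <= path_len f x p + path_len f y q].
Proof.
move=> ha hb exy nxy nyx.
have [p0 hp0 lp0] := chain_root ha; have [q0 hq0 lq0] := chain_root hb.
pose P s := exists p q, [/\ chain x p, chain y q, last x p = last y q & path_len f x p + path_len f y q = s].
have [|s hs _] := @least_ex P (path_len f x p0 + path_len f y q0).
  by exists p0, q0; split=> //; rewrite lp0 lq0.
have [[px [py [hpx hpy hl hs']]] mn] := least_some hs.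
have {hs}mn p q : chain x p -> chain y q -> last x p = last y q ->
    path_len f x px + path_len f y py <= path_len f x p + path_len f y q.
  by move=> h1 h2 h3; rewrite hs'; apply: mn; exists p, q.
have upx := chain_uniq hpx; have upy := chain_uniq hpy.
(* By minimality of the total length, the chains meet at their common end only. *)
have disj t : t \in x :: px -> t \in y :: py -> t = last y py.
  move=> h1 h2; case/splitPl: h1 hpx hl mn upx {hs'} => p1 p2 h1; case/splitPl: h2 hpy upy => q1 q2 h2.
  rewrite !chain_cat => /andP [hq1 hq2] _ /andP [hp1 hp2] hl mn _.
  have := mn _ _ hp1 hq1; rewrite h1 h2 !path_len_cat h1 h2 => /(_ erefl) h.
  have : path_len f t p2 + path_len f t q2 = 0 by lia.
  have := path_len_size t q2 f0; rewrite last_cat h2; case: (q2) => // z q' /=; lia.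
pose c := (x :: px) ++ rev (belast y py).
exists c, px, py; split=> //; last first.
  split=> //; rewrite /c cat_cons cycle_weight_cons rcons_cat path_len_cat path_len_rcons -addnA.
  congr (_ + _); rewrite hl last_rev_belast; congr (_ + _); last by apply: fsym; rewrite esym.
  by apply: (@path_len_rev _ f y py e) => //; exact: chain_path.
apply/and3P; split.
(* With fewer than three vertices, the edge would be a loop or a tree edge. *)
- rewrite /c size_cat size_rev size_belast /=.
  case: (px) (py) hpx hpy hl {upx upy disj mn hs' c} => [|a1 [|a2 pp]] [|b1 [|b2 qq]] //=.
  + by move=> _ _ h; move: (eirr x); rewrite {2}h exy.
  + by rewrite andbT => _ /eqP h1 h2; rewrite h2 in nyx.
  + by rewrite andbT => /eqP h1 _ h2; rewrite h2 in h1.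
- rewrite /c cat_uniq upx rev_uniq.
  move: (upy); rewrite lastI rcons_uniq => /andP [nl ub]; rewrite ub andbT /=.
  apply/hasPn => t; rewrite mem_rev => ht; apply/negP => htx.
  have /(disj _ htx) et : t \in y :: py by rewrite lastI mem_rcons inE ht orbT.
  by rewrite et (negbTE nl) in ht.
rewrite /c cat_cons /= rcons_cat cat_path chain_path //= hl rcons_path path_rev ?chain_path //=.
by rewrite last_rev_belast esym.
Qed.

End Forest.

(** * The algorithm *)

Inductive kreach (K : nat -> nat -> nat -> Prop) (s : nat) : nat -> nat -> Prop :=
| KRefl : kreach K s s 0
| KStep t u x y : kreach K s t x -> K t u y -> kreach K s u (x + y).

Lemma kreach_trans K s t u x y : kreach K s t x -> kreach K t u y -> kreach K s u (x + y).
Proof.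
move=> h; elim=> [|a c z z' _ ih hK]; first by rewrite addn0.
by rewrite addnA; apply: KStep ih hK.
Qed.

Lemma kreach_ext K K' s t x : (forall t u y, K t u y -> K' t u y) ->
  kreach K s t x -> kreach K' s t x.
Proof. by move=> h; elim=> [|a c z z' _ ih /h hK]; [exact: KRefl|apply: KStep ih hK]. Qed.

(* Distance estimate: a path in the skeleton graph [K] on the samples, followed
   by one segment of few edges. *)
Definition two_step K (es : nat -> nat -> Prop) s x :=
  exists t y z, [/\ kreach K s t y, es t z & x = y + z].

(** Values not below [M] are dropped because a flood would clip them to wrong ones. *)
Definition tab (M : nat) (l : seq nat) (g : nat -> option nat) (key : nat -> nat) :=
  pmap (fun t => if g t is Some x then (if x < M then Some (key t, x) else None) else None) l.

Lemma tabP M l g key m x :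
  reflect (exists t, [/\ t \in l, g t = Some x, x < M & m = key t]) ((m, x) \in tab M l g key).
Proof.
rewrite /tab mem_pmap; apply: (iffP mapP) => [[t tl]|[t [tl gt xM ->]]]; last first.
  by exists t => //; rewrite gt xM.
by case h : (g t) => [y|] //; case: ifP => // yM [-> ->]; exists t.
Qed.

Lemma size_tab M l g key : size (tab M l g key) <= size l.
Proof. by rewrite /tab size_pmap; exact: count_size. Qed.

Section Program.
Variables (B M b N k qs I E n : nat).
Variables (id : nat) (nbl : seq nat) (wf : nat -> nat).

Definition bcast items len : prog (nat -> nat -> Prop) :=
  Flood items (fun _ => Some (1, 0)) len (fun lg => Ret (got B M items lg)).

Definition exch items len : prog log :=
  Flood items (fun _ => None) len (fun lg => Ret lg).

Definition minfl (items : seq nat) len : prog nat :=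
  let src := [seq (m, 0) | m <- items] in
  Flood src (fun _ => Some (0, 0)) len (fun lg =>
    Ret (odflt 0 (least (fun x => exists p o, entry B M src (fun _ => Some (0, 0)) lg x p o)))).

(* Doubling search for a radius [2 ^ i] around node 0 that covers the graph: an
   unreached node complains within distance [2 * 2 ^ i + 1]. *)
Fixpoint find_radius (fuel i : nat) : prog nat :=
  if fuel is fuel'.+1 then
    let s1 := if id == 0 then [:: (0, 0)] else [::] in
    Flood s1 (fun _ => Some (1, 0)) (2 ^ i) (fun lg =>
      let reached := pbool (exists x p o,
        entry B M s1 (fun _ => Some (1, 0)) lg x p o /\ x <= 2 ^ i * B) in
      let s2 := if reached then [::] else [:: (0, 0)] in
      Flood s2 (fun _ => Some (1, 0)) (2 * 2 ^ i + 1) (fun lg2 =>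
        if pbool (exists x p o, entry B M s2 (fun _ => Some (1, 0)) lg2 x p o)
        then find_radius fuel' i.+1 else Ret i))
  else Ret i.

Definition acc_scale i (u : nat) := Some (E * wf u %/ 2 ^ i + 1, 0).

Fixpoint scales (src : seq (nat * nat)) (len j : nat) : prog (nat -> log) :=
  if j is j'.+1 then
    bind (scales src len j') (fun r => Flood src (acc_scale j') len (fun lg =>
      Ret (fun i => if i == j' then lg else r i)))
  else Ret (fun _ => [::]).

(** The bound of [scale_path] on the rounded length of a path with at most [k] edges. Floods on
    rounded weights last this long plus the number of sources that may compete. *)
Definition capd := (2 * E).+1 * k.

Definition self_src (c : bool) : seq (nat * nat) := if c then [:: (id, 0)] else [::].

Definition ent_scale (c : bool) (lb : nat -> log) i x p o :=
  entry B M (self_src c) (acc_scale i) (lb i) x p o.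

Definition seg c lb t z := exists i x p o,
  [/\ i < I, ent_scale c lb i x p o, x %% B = t & z = 2 ^ i * (x %/ B)].

Definition krel (kk : nat -> nat -> Prop) t u y := u < N /\ kk (t * N + u) y.

Definition phiA la i s :=
  least (fun z => exists x p o, [/\ ent_scale true la i x p o, x %% B = s & z = 2 ^ i * (x %/ B)]).

Definition parA la i s := least (fun u => exists x p,
  [/\ ent_scale true la i x p (Some u), x %% B = s & phiA la i s = Some (2 ^ i * (x %/ B))]).

Definition nbA la i s u z := exists x p,
  [/\ (u, (x, p)) \in (la i : log), x %% B = s & z = 2 ^ i * (x %/ B)].

Definition phiS c lb kk s := least (two_step (krel kk) (seg c lb) s).

Definition parS c lb kk s := least (fun u => exists t y i x p,
  [/\ kreach (krel kk) s t y, i < I, ent_scale c lb i x p (Some u), x %% B = t &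
      phiS c lb kk s = Some (y + 2 ^ i * (x %/ B))]).

Definition dig j m := m %/ b ^ j %% b.

(** The estimate becomes the leading digit, so the least code has the least estimate; the other
    digits tell all nodes the tree, the edge and its weight. *)
Definition enc6 d5 d4 d3 d2 d1 d0 := ((((d5 * b + d4) * b + d3) * b + d2) * b + d1) * b + d0.

Definition phi_of (S : seq nat) c la lb kk (i s : nat) : option nat :=
  if i == I then (if s \in S then phiS c lb kk s else None) else phiA la i s.

Definition par_of (S : seq nat) c la lb kk (i s : nat) : option nat :=
  if i == I then (if s \in S then parS c lb kk s else None) else parA la i s.

Definition nb_of (la : nat -> log) (lx : log) (i s u z : nat) : Prop :=
  if i == I then is_true ((u, (s, z)) \in lx) else nbA la i s u z.

(* The labels [(i, s)] with [i < I] are the rounded shortest path trees of all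
   vertices, [(I, s)] is the approximate shortest path tree of the sample [s]. *)
Definition cand_at (phi par : nat -> nat -> option nat) (nbv : nat -> nat -> nat -> nat -> Prop) m :=
  exists i s u x z, [/\ [/\ i <= I, s < n, u \in nbl & phi i s = Some x],
    nbv i s u z, z <= x, par i s <> Some u &
    x + z + E * wf u < b /\ m = enc6 (x + z + E * wf u) i s id u (wf u)].

Definition phaseA (S : seq nat) (dd : nat) : prog (nat * option nat) :=
  let c := id \in S in
  bind (scales (self_src true) (capd + k) I) (fun la =>
  bind (scales (self_src c) (capd + qs) I) (fun lb =>
  bind (bcast (if c then tab M S (fun t => least (seg c lb t)) (fun t => t * N + id) else [::])
          (qs * qs + dd)) (fun kk =>
  bind (exch (tab M S (phiS c lb kk) (fun s => s)) qs) (fun lx =>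
  bind (minfl (if least (cand_at (phi_of S c la lb kk) (par_of S c la lb kk) (nb_of la lx)) is Some m
               then [:: m] else [::]) dd) (fun m =>
  Ret (m, par_of S c la lb kk (dig 4 m) (dig 3 m))))))).

(** Nodes announce their parents and then accept messages from children only: the flood climbs the
    tree, counting hops in the key and adding weights in the payload. A node with estimates from
    both [x] and [y] is a common ancestor. *)
Definition phaseB (S : seq nat) (dd m : nat) (par : option nat) : prog nat :=
  let x := dig 2 m in
  let y := dig 1 m in
  bind (exch (if par is Some u then [:: (u, 0)] else [::]) 1) (fun lc =>
  let acc u := if pbool (exists p, (u, (id, p)) \in (lc : log)) then Some (1, wf u) else None in
  let src := self_src (id \in x :: y :: S) in
  Flood src acc (k + qs.+2) (fun lu =>
  let eu t z := exists x o, entry B M src acc lu x z o /\ x %% B = t in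
  bind (bcast (if id \in S then tab M (x :: y :: S) (fun t => least (eu t)) (fun t => t * N + id)
          else [::]) (qs.+2 * qs + dd)) (fun kk =>
  minfl (if least (two_step (krel kk) eu x) is Some p then
           if least (two_step (krel kk) eu y) is Some q then [:: p + q + dig 0 m] else [::]
         else [::]) dd))).

(** The offset [N] separates the second sample from the first in one broadcast. All nodes are within
    2^j hops of node 0, so [dd] bounds the hops between any two. *)
Definition whole (N1 : nat) (sm1 sm2 : seq nat) (fuel : nat) : prog nat :=
  bind (find_radius fuel 0) (fun j =>
  let dd := 2 * 2 ^ j in
  bind (bcast (if id == 0 then [seq (s, 0) | s <- sm1] ++ [seq (N + s, 0) | s <- sm2] else [::])
         (2 * qs + dd)) (fun kk =>
  bind (phaseA [seq s <- iota 0 n | pbool (kk s 0)] dd) (fun r =>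
  bind (phaseB [seq s <- iota 0 n | pbool (kk (N + s) 0)] dd r.1 r.2) (fun g =>
  Ret (g %/ N1))))).

End Program.

Lemma dig_enc6 b d5 d4 d3 d2 d1 d0 : 0 < b ->
  d4 < b -> d3 < b -> d2 < b -> d1 < b -> d0 < b ->
  let m := enc6 b d5 d4 d3 d2 d1 d0 in
  [/\ dig b 4 m = d4, dig b 3 m = d3, dig b 2 m = d2, dig b 1 m = d1 & dig b 0 m = d0].
Proof.
move=> b0 h4 h3 h2 h1 h0 m.
have st x y : y < b -> (x * b + y) %/ b = x by move=> h; rewrite divnMDl // divn_small // addn0.
rewrite /dig /m /enc6 expn0 divn1 !expnS expn0 muln1 !divnMA.
by rewrite !st // !modnMDl !modn_small.
Qed.

Lemma enc6_lt b d5 d4 d3 d2 d1 d0 :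
  d5 < b -> d4 < b -> d3 < b -> d2 < b -> d1 < b -> d0 < b -> enc6 b d5 d4 d3 d2 d1 d0 < b ^ 6.
Proof.
move=> h5 h4 h3 h2 h1 h0.
have st x y z : x < z -> y < b -> x * b + y < z * b.
  move=> lx ly; have : x.+1 * b <= z * b by rewrite leq_mul2r lx orbT.
  by rewrite mulSn; lia.
rewrite (_ : b ^ 6 = b * b * b * b * b * b); last by rewrite !expnS expn0 muln1 !mulnA.
by rewrite /enc6; do 5 (apply: (st) => //).
Qed.

Lemma enc6_le b d5 d4 d3 d2 d1 d0 e5 e4 e3 e2 e1 e0 :
  d4 < b -> d3 < b -> d2 < b -> d1 < b -> d0 < b ->
  enc6 b e5 e4 e3 e2 e1 e0 <= enc6 b d5 d4 d3 d2 d1 d0 -> e5 <= d5.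
Proof.
move=> h4 h3 h2 h1 h0.
have st x y z t : y < b -> z * b + t <= x * b + y -> z <= x.
  move=> ly h; rewrite leqNgt; apply/negP => lt.
  have : x.+1 * b <= z * b by rewrite leq_mul2r lt orbT.
  by rewrite mulSn; lia.
by rewrite /enc6 => /st - /(_ h0) /st - /(_ h1) /st - /(_ h2) /st - /(_ h3) /st - /(_ h4).
Qed.

Lemma divmodN N t u : u < N -> (t * N + u) %/ N = t /\ (t * N + u) %% N = u.
Proof.
move=> h; have N0 : 0 < N by exact: leq_trans h.
by rewrite divnMDl // divn_small // addn0 modnMDl modn_small.
Qed.

(** A simple path has at most n - 1 edges; the summand [N'] leaves room for one more, such as the
    edge closing a cycle. *)
Lemma path_len_uniq n (h : 'I_n -> 'I_n -> nat) N' u p : (forall a c, h a c <= N') -> uniq (u :: p) ->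
  path_len h u p + N' <= n * N'.
Proof.
move=> hN up; have := card_uniqP up; have := max_card (mem (u :: p)); rewrite card_ord => + sz.
rewrite sz /= => lt; apply: leq_trans (_ : (size p).+1 * N' <= _); last by rewrite leq_mul2r lt orbT.
by rewrite mulSn addnC leq_add2l path_len_bound.
Qed.

(** * Executions of the communication primitives *)

Section Primitives.
Variables (B M n : nat) (e : rel 'I_n).

Lemma runs_bcast its len :
  runs B M e (fun v => bcast B M (its v) len) len.+1
    (fun v => got B M (its v) (flood B M e its (fun _ _ => Some (1, 0)) len.+1 v).1).
Proof. by rewrite -[X in runs _ _ _ _ X]addn0; apply: runs_flood; apply: RunRet. Qed.

Lemma runs_exch its len :
  runs B M e (fun v => exch (its v) len) len.+1
    (fun v => (flood B M e its (fun _ _ => None) len.+1 v).1).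
Proof. by rewrite -[X in runs _ _ _ _ X]addn0; apply: runs_flood; apply: RunRet. Qed.

Lemma runs_minfl its dd u x0 :
  (forall u v : 'I_n, exists q, [/\ path e u q, last u q = v & size q <= dd]) ->
  x0 \in its u -> (forall v m, m \in its v -> x0 <= m) -> x0 < M ->
  runs B M e (fun v => minfl B M (its v) dd) dd.+1 (fun _ => x0).
Proof.
move=> hD hu hm xM; rewrite -[X in runs _ _ _ _ X]addn0; apply: runs_flood.
apply: RunRet => v; congr Ret.
pose src v := [seq (m, 0) | m <- its v].
have hs w m p : (m, p) \in src w -> x0 <= m by move=> /mapP [m' /hm h [-> _]].
have [q [h1 h2 h3]] := hD u v.
have xu : (x0, 0) \in src u by apply/mapP; exists x0.
have := @flood_min B M n e src (fun _ _ => Some (0, 0)) x0 (fun _ _ => erefl) hs u 0 q xu xM h1 dd.+1 h3.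
move=> /sent_entry; rewrite h2 => hx.
rewrite (least_eq hx) // => y [p [o /entry_reach hy]].
by elim: hy => [v' m p' /hs|u' v' x om c _ h _ _ _] //; lia.
Qed.

Lemma runs_scales E (wf : 'I_n -> nat -> nat) src len J :
  exists2 r, runs B M e (fun v => scales E (wf v) (src v) len J) (J * len.+1) r &
    forall v i, i < J -> r v i = (flood B M e src (fun v => acc_scale E (wf v) i) len.+1 v).1.
Proof.
elim: J => [|J [r hr hi]]; first by exists (fun _ _ => [::]) => //; exact: RunRet.
exists (fun v i => if i == J then (flood B M e src (fun v => acc_scale E (wf v) J) len.+1 v).1 else r v i).
  rewrite mulSn addnC; apply: (runs_bind hr); rewrite -[X in runs _ _ _ _ X]addn0.
  by apply: runs_flood; apply: RunRet => v.
move=> v i; rewrite ltnS leq_eqVlt; case: eqVneq => [->|_] //= /hi -> //.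
Qed.

End Primitives.

(** * From a candidate edge to the weight of its cycle *)

Section PhaseB.
Variables (B M b N k qs n : nat) (e : rel 'I_n).
Hypotheses (esym : forall u v, e u v = e v u) (eirr : forall u, ~~ e u u).
Variable f : 'I_n -> 'I_n -> nat.
Hypotheses (f0 : forall u v, 0 < f u v) (fsym : wsym e f).
Variables (E : nat) (phi : 'I_n -> option nat) (par : 'I_n -> option 'I_n) (rt : 'I_n).
Hypothesis E0 : 0 < E.
Hypothesis Hpar : forall v p, par v = Some p -> e p v /\
  exists x y, [/\ phi v = Some x, phi p = Some y & y + E * f v p <= x].
Hypothesis Hroot : forall v x, phi v = Some x -> par v = None -> v = rt.
Variable wfl : 'I_n -> nat -> nat.
Hypothesis hw : forall u v : 'I_n, e u v -> wfl v u = f v u.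
Variables (S : seq nat) (dd m : nat) (x y : 'I_n) (ax ay fm : nat).
Hypotheses (phx : phi x = Some ax) (phy : phi y = Some ay) (exy : e x y).
Hypotheses (nxy : par x <> Some y) (nyx : par y <> Some x).
Hypotheses (digx : dig b 2 m = x) (digy : dig b 1 m = y) (digf : dig b 0 m = f x y).
Hypotheses (nN : n <= N) (NB : N * N <= B) (kM : k.+1 * B <= M) (dM : dd.+1 * B <= M).
Hypotheses (ffm : forall u v, f u v <= fm) (fmM : 3 * (n * fm) < M).
Hypothesis hop : forall u v : 'I_n, exists q, [/\ path e u q, last u q = v & size q <= dd].
Hypotheses (szS : size S <= qs) (k0 : 0 < k).
Hypothesis hits : forall v p, chain par v p -> size p = k -> exists t : 'I_n, (t : nat) \in S /\ t \in p.

Local Notation ch := (chain par).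

Let n0 : 0 < n. Proof. exact: leq_ltn_trans (ltn_ord x). Qed.
Let N0 : 0 < N. Proof. exact: leq_trans nN. Qed.
Let NB' : N <= B. Proof. by apply: leq_trans NB; rewrite leq_pmulr. Qed.
Let B0 : 0 < B. Proof. exact: leq_trans NB'. Qed.
Let BM : B <= M. Proof. by move: dM; rewrite mulSn; lia. Qed.
Let ordN (u : 'I_n) : u < N. Proof. exact: leq_trans nN. Qed.
Let ordB (u : 'I_n) : u < B. Proof. exact: leq_trans NB'. Qed.

Lemma chain_lt v p : ch v p -> path_len f v p + fm <= n * fm.
Proof. by move=> hp; apply: path_len_uniq => //; apply: chain_uniq Hpar _ _ hp. Qed.

Let its0 (v : 'I_n) : seq (nat * nat) :=
  if omap (@nat_of_ord n) (par v) is Some u then [:: (u, 0)] else [::].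
Let lcv v := (flood B M e its0 (fun _ _ => None) 2 v).1.

Lemma announcedP u v : e u v -> (exists p, (nat_of_ord u, (nat_of_ord v, p)) \in lcv v) <-> par u = Some v.
Proof.
move=> euv.
have key q : (nat_of_ord u, (nat_of_ord v, q)) \in lcv v <-> (nat_of_ord v, q) \in its0 u.
  apply: exchP => //.
  - move=> w a p; rewrite /its0; case: (par w) => //= z; rewrite inE => /eqP [-> ->].
    by rewrite ordB; split=> //; lia.
  - move=> w a p p'; rewrite /its0; case: (par w) => //= z.
    by rewrite !inE => /eqP [_ ->] /eqP [_ ->].
  - by move=> w; rewrite /its0; case: (par w).
split=> [[p /key]|h].
  by rewrite /its0; case: (par u) => //= z; rewrite inE => /eqP [/val_inj ->].
by exists 0; apply/key; rewrite /its0 h inE eqxx.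
Qed.

Let accv (v : 'I_n) (u : nat) :=
  if pbool (exists p, (u, (nat_of_ord v, p)) \in lcv v) then Some (1, wfl v u) else None.
Let src (v : 'I_n) := self_src v ((v : nat) \in [:: nat_of_ord x, nat_of_ord y & S]).
Let LU v := (flood B M e src accv (k + qs.+2).+1 v).1.
Let eu (v : 'I_n) t z := exists a o, entry B M (src v) (accv v) (LU v) a z o /\ a %% B = t.

Lemma accvP u v : e u v -> par u = Some v -> accv v u = Some (1, f u v).
Proof.
move=> euv hp; rewrite /accv; case: pboolP => [_|]; last by case; apply/announcedP.
by rewrite hw // fsym // esym.
Qed.

Lemma eu_sound v t z : eu v t z -> exists (s : 'I_n) q,
  [/\ t = s :> nat, t \in [:: nat_of_ord x, nat_of_ord y & S], ch s q, last s q = v & z = path_len f s q].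
Proof.
move=> [a [o [h <-]]]; move: v a z o h.
suff H v a z o : entry B M (src v) (accv v) (LU v) a z o -> exists (s : 'I_n) q,
  [/\ a = s + size q * B, (s : nat) \in [:: nat_of_ord x, nat_of_ord y & S], ch s q, last s q = v & z = path_len f s q].
  move=> v a z o /H [s [q [-> h1 h2 h3 h4]]]; exists s, q.
  by rewrite addnC modnMDl modn_small // ordB.
move: v a z o; apply: flood_ind => [v a p|u v a p o om c [s [q [-> h1 h2 h3 ->]]] euv].
  rewrite /src /self_src; case: ifP => // hS; rewrite inE => /eqP [-> ->] _.
  by exists v, [::]; rewrite mul0n addn0 min0n.
rewrite /accv; case: pboolP => // /(announcedP euv) hp [<- <-] _.
exists s, (rcons q v); have hc : ch s (rcons q v) by rewrite /chain rcons_path -/(ch s q) h2 h3 hp eqxx.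
split=> //; rewrite ?last_rcons ?size_rcons ?mulSn ?mul1n //; first by lia.
rewrite hw // -(fsym euv) path_len_rcons h3; apply/minn_idPl.
by have := chain_lt hc; rewrite path_len_rcons h3; lia.
Qed.

Lemma eu_uniq v t z z' : eu v t z -> eu v t z' -> z = z'.
Proof.
move=> /eu_sound [s [q [h1 _ h2 h3 ->]]] /eu_sound [s' [q' [h4 _ h5 h6 ->]]].
have es : s = s' by apply: val_inj; rewrite /= -h1.
subst s'; rewrite (chain_inj f0 E0 Hpar h2 h5) //.
by rewrite h3.
Qed.

(** [flood_class] yields some key of source [s], a priori with fewer hops and an unknown payload; as
    chains are unique, it belongs to [q]. Only [x], [y] and the samples compete, whence the length
    [k + qs.+2]. *)
Lemma eu_complete (s : 'I_n) q : (s : nat) \in [:: nat_of_ord x, nat_of_ord y & S] ->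
  ch s q -> size q <= k -> eu (last s q) s (path_len f s q).
Proof.
move=> hs hq lq.
have hr : reach B M e src accv (last s q) (s + size q * B).
  elim/last_ind: q hq lq => [|q v ih].
    move=> _ _; rewrite mul0n addn0; apply: (@ReachSrc _ _ _ _ _ _ _ _ 0); last by have := ordB s; lia.
    by rewrite /src /self_src hs inE eqxx.
  rewrite /chain rcons_path last_rcons size_rcons => /andP [hq /eqP hv] lq.
  have euv : e (last s q) v by rewrite esym; case: (Hpar hv).
  rewrite (_ : s + _ = s + size q * B + 1 * B); last by rewrite mulSn; lia.
  apply: ReachStep euv (accvP euv hv) _; first by apply: ih => //; exact: ltnW.
  have : (size q).+1 * B <= k * B by rewrite leq_mul2r lq orbT.
  by move: kM; rewrite !mulSn; have := ordB s; lia.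
have [|||a ha [la ca]] := @flood_class B M n e src accv B0 _ (k + qs.+2).+1 _ _
    [:: nat_of_ord x, nat_of_ord y & S] hr.
- by move=> v u om c; rewrite /accv; case: pboolP => // _ [<-].
- move=> a ra _.
  have : exists s' : 'I_n, (s' : nat) \in [:: nat_of_ord x, nat_of_ord y & S] /\ nat_of_ord s' = a %% B.
    elim: ra => [v m' p + _|u v a' om c _ [s' [h1 h2]] _ _ _].
      rewrite /src /self_src; case: ifP => // hv; rewrite inE => /eqP [-> _].
      by exists v; rewrite modn_small.
    by exists s'; rewrite addnC modnMDl.
  by case=> s' [h <-].
- by rewrite [s + _]addnC divnMDl // divn_small // addn0 /=; lia.
have [z [o hz]] := sent_entry ha.
have hs' : a %% B = s by rewrite ca addnC modnMDl modn_small.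
have heu : eu (last s q) s z by exists a, o.
have [s' [q' [h1 _ h2 h3 h4]]] := eu_sound heu.
have es : s = s' by apply: val_inj.
by subst s'; rewrite {2}(chain_inj f0 E0 Hpar hq h2 (Logic.eq_sym h3)) -h4.
Qed.

Let its1 (v : 'I_n) := if (v : nat) \in S then
  tab M [:: nat_of_ord x, nat_of_ord y & S] (fun t => least (eu v t)) (fun t => t * N + v) else [::].
Let kkv v := got B M (its1 v) (flood B M e its1 (fun _ _ => Some (1, 0)) (qs.+2 * qs + dd).+1 v).1.

Lemma its1P (v : 'I_n) a p : reflect (exists t, [/\ (v : nat) \in S, t \in [:: nat_of_ord x, nat_of_ord y & S],
   eu v t p & a = t * N + v]) ((a, p) \in its1 v).
Proof.
rewrite /its1; case: ifP => hv; last by constructor; case=> t [].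
apply: (iffP (tabP _ _ _ _ _ _)) => [[t [h1 /least_some [h2 _] _ h3]]|[t [_ h1 h2 h3]]].
  by exists t.
exists t; split=> //; first by apply: least_eq => // z /(eu_uniq h2) ->.
by have [s [q [_ _ h _ ->]]] := eu_sound h2; have := chain_lt h; lia.
Qed.

Lemma sample_ord t : t \in [:: nat_of_ord x, nat_of_ord y & S] -> forall v p, eu v t p -> t < n.
Proof. by move=> _ v p /eu_sound [s [q [-> _ _ _ _]]]. Qed.

Lemma sample_relP v t u p : krel N (kkv v) t u p <-> exists u0 : 'I_n, [/\ u = u0, u \in S,
  t \in [:: nat_of_ord x, nat_of_ord y & S] & eu u0 t p].
Proof.
have H a q : kkv v a q <-> exists u0, (a, q) \in its1 u0.
  apply: (@gotP B M n e its1 B0 _ _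
    [seq t * N + u | t <- [:: nat_of_ord x, nat_of_ord y & S], u <- S] dd) => //.
  - move=> w c p' /its1P [t' [h1 h2 h3 ->]]; have h4 := sample_ord h2 h3.
    apply: leq_trans NB; apply: leq_trans (_ : t'.+1 * N <= _).
      by rewrite mulSn addnC ltn_add2r.
    by rewrite leq_mul2r (leq_trans h4 nN) orbT.
  - move=> w c p' /its1P [t' [h1 h2 h3 ->]]; split; first exact: allpairs_f.
    by have [s [q' [_ _ h _ ->]]] := eu_sound h3; have := chain_lt h; lia.
  - move=> u1 u2 c p1 p2 /its1P [t1 [h1 h2 h3 ->]] /its1P [t2 [h4 h5 h6 ec]].
    have [e1 e2] := divmodN t1 (ordN u1); have [e3 e4] := divmodN t2 (ordN u2).
    have et : t1 = t2 by rewrite -e1 ec e3.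
    have euu : u1 = u2 by apply: val_inj; rewrite /= -e2 ec e4.
    by subst; exact: eu_uniq h3 h6.
  - by rewrite size_allpairs /= addnC ltnW // ltnS leq_add2r leq_mul.
rewrite /krel; split=> [[uN /H [u0 /its1P [t' [h1 h2 h3 ec]]]]|[u0 [-> h1 h2 h3]]].
  have [e1 e2] := divmodN t uN; have [e3 e4] := divmodN t' (ordN u0).
  have et : t = t' by rewrite -e1 ec e3.
  have euu : u = u0 by rewrite -e2 ec e4.
  by exists u0; subst t' u.
by split; [exact: ordN|apply/H; exists u0; apply/its1P; exists t].
Qed.

Lemma two_sound v (s : 'I_n) p : two_step (krel N (kkv v)) (eu v) s p ->
  exists q, [/\ ch s q, last s q = v & p = path_len f s q].
Proof.
move=> [t [p1 [p2 [hk /eu_sound [t0 [q2 [et _ h1 h2 ->]]] ->]]]].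
have [q1 [h3 h4 ->]] : exists q, [/\ ch s q, nat_of_ord (last s q) = t & p1 = path_len f s q].
  elim: hk => [|t' u a c _ [q [g1 g2 ->]] /sample_relP [u0 [-> _ _ /eu_sound [s' [q' [g3 _ g4 g5 ->]]]]]].
    by exists [::].
  have es : last s q = s' by apply: val_inj; rewrite /= g2.
  exists (q ++ q'); rewrite chain_cat g1 last_cat es g4 g5.
  by split=> //; rewrite path_len_cat es.
have es : last s q1 = t0 by apply: val_inj; rewrite /= h4.
exists (q1 ++ q2); rewrite chain_cat h3 last_cat es h1 h2.
by split=> //; rewrite path_len_cat es.
Qed.

(** Induction on the chain: if it has more than [k] edges, a sample lies among its next [k]
    vertices, and the part up to that sample is one skeleton step. *)
Lemma two_complete (s : 'I_n) q : (s : nat) \in [:: nat_of_ord x, nat_of_ord y & S] -> ch s q ->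
  two_step (krel N (kkv (last s q))) (eu (last s q)) s (path_len f s q).
Proof.
have [l lq] := ubnP (size q); elim: l s q lq => // l ih s q lq hs hq.
have [sq|sq] := leqP (size q) k.
  by exists s, 0, (path_len f s q); split=> //; [exact: KRefl|exact: eu_complete].
have [||t [tS tq]] := hits (v := s) (p := take k q); last 1 first.
- have hq' : ch s (take k q) by move: hq; rewrite -{1}(cat_take_drop k q) chain_cat => /andP [].
  have st : size (take k q) = k by rewrite size_takel // ltnW.
  case/splitPr: tq {hq'} st (cat_take_drop k q) => r1 r2 st.
  rewrite -cat_rcons -catA => eq.
  move: hq lq; rewrite -eq chain_cat last_rcons last_cat last_rcons path_len_cat last_rcons => /andP [h1 h2] lq.
  have [||a [c [d [g1 g2 ->]]]] := ih t (r2 ++ drop k q) _ _ h2.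
  - by move: lq; rewrite !size_cat size_rcons; lia.
  - by rewrite !inE tS !orbT.
  exists a, (path_len f s (rcons r1 t) + c), d; split=> //; last by rewrite addnA.
  apply: kreach_trans g1; rewrite -[path_len _ _ _]add0n; apply: KStep (KRefl _ _) _.
  apply/sample_relP; exists t; split=> //.
  have := @eu_complete s (rcons r1 t) hs h1; rewrite last_rcons; apply.
  by move: st; rewrite size_cat size_rcons /=; lia.
- by move: hq; rewrite -{1}(cat_take_drop k q) chain_cat => /andP [].
by rewrite size_takel // ltnW.
Qed.

Theorem phaseB_runs : exists c, [/\ is_cycle e c, E * cycle_weight f c <= ax + ay + E * f x y &
  runs B M e (fun v : 'I_n => phaseB B M b N k qs v (wfl v) S dd m (omap (@nat_of_ord n) (par v)))
    (2 + ((k + qs.+2).+1 + ((qs.+2 * qs + dd).+1 + dd.+1))) (fun _ => cycle_weight f c)].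
Proof.
have [c [px [py [hc hpx hpy hl [hcw mn]]]]] :=
  lca_cycle esym eirr f0 fsym E0 Hpar Hroot phx phy exy nxy nyx.
exists c; split=> //.
  have [z _] := chain_phi E0 Hpar hpx phx; have [z' _] := chain_phi E0 Hpar hpy phy.
  by rewrite hcw !mulnDr; lia.
rewrite /phaseB digx digy digf.
apply: runs_bind; first exact: runs_exch.
apply: runs_flood; apply: runs_bind; first exact: runs_bcast.
pose it v := if least (two_step (krel N (kkv v)) (eu v) x) is Some p then
  if least (two_step (krel N (kkv v)) (eu v) y) is Some q then [:: p + q + f x y] else [::] else [::].
apply: (@runs_minfl B M n e it dd (last x px)) => //.
(* The node where the minimal chains meet submits their total. Every other submission also comes
   from a common ancestor, so it is not smaller. *)
- have hx := two_complete (s := x) (q := px); have hy := two_complete (s := y) (q := py).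
  rewrite /it hl (@least_eq _ (path_len f x px)); last 2 first.
  + by rewrite -hl; apply: hx => //; rewrite inE eqxx.
  + move=> p /two_sound [q [g1 g2 ->]].
    by rewrite (chain_inj f0 E0 Hpar hpx g1) // hl g2.
  rewrite (@least_eq _ (path_len f y py)); last 2 first.
  + by apply: hy => //; rewrite !inE eqxx orbT.
  + move=> p /two_sound [q [g1 g2 ->]].
    by rewrite (chain_inj f0 E0 Hpar hpy g1).
  by rewrite inE hcw.
- move=> v a; rewrite /it; case h1 : (least _) => [p|] //; case h2 : (least _) => [q|] //.
  rewrite inE => /eqP ->.
  have [/two_sound [p1 [g1 g2 ->]] _] := least_some h1.
  have [/two_sound [q1 [g3 g4 ->]] _] := least_some h2.
  by rewrite hcw leq_add2r; apply: mn => //; rewrite g2.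
rewrite hcw; have := chain_lt hpx; have := chain_lt hpy; have := ffm x y; lia.
Qed.

End PhaseB.

(** * Finding a good candidate edge *)

Section ScaledFlood.
Variables (B M n : nat) (e : rel 'I_n).
Variable f : 'I_n -> 'I_n -> nat.
Hypotheses (fsym : wsym e f).
Variable wfl : 'I_n -> nat -> nat.
Hypothesis hw : forall u v : 'I_n, e u v -> wfl v u = f v u.
Variables (E i : nat) (SP : 'I_n -> bool).
Hypotheses (B0 : 0 < B) (ordB : forall u : 'I_n, u < B).

Let src (v : 'I_n) := self_src v (SP v).
Let acc (v : 'I_n) := acc_scale E (wfl v) i.
Local Notation h := (scaled_weight E i f).
Local Notation ent t v := (entry B M (src v) (acc v) (flood B M e src acc t v).1).

Lemma divmodB (s : 'I_n) d : (s + d * B) %% B = s /\ (s + d * B) %/ B = d.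
Proof. by rewrite addnC modnMDl divnMDl // modn_small // divn_small // addn0. Qed.

Lemma acc_edge u v : e u v -> acc v u = Some (h u v, 0).
Proof. by move=> euv; rewrite /acc /acc_scale hw // -(fsym euv). Qed.

Lemma scaled_reach_sound v x : reach B M e src acc v x -> exists (s : 'I_n) q,
  [/\ SP s, path e s q, last s q = v & x = s + path_len h s q * B].
Proof.
elim=> [{}v m p|u {}v {}x om c _ [s [q [h1 h2 h3 ->]]] euv].
  by rewrite /src /self_src; case: ifP => // hv; rewrite inE => /eqP [-> _] _; exists v, [::]; rewrite addn0.
rewrite acc_edge // => -[<- _] _; exists s, (rcons q v).
by rewrite rcons_path h2 h3 euv last_rcons path_len_rcons h3 mulnDl addnA.
Qed.

Lemma scaled_reach_path (s : 'I_n) q : SP s -> path e s q -> s + path_len h s q * B < M ->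
  reach B M e src acc (last s q) (s + path_len h s q * B).
Proof.
move=> hs; elim/last_ind: q => [|q v ih].
  rewrite addn0 => _ lt; apply: (@ReachSrc _ _ _ _ _ _ _ _ 0) lt.
  by rewrite /src /self_src hs inE.
rewrite rcons_path last_rcons path_len_rcons mulnDl addnA => /andP [hq euv] lt.
by apply: (ReachStep _ euv (acc_edge euv) lt); apply: ih => //; apply: leq_ltn_trans lt; exact: leq_addr.
Qed.

(** [L] need only list the sources no farther from the node than [s]; farther ones cannot delay it.
    When all vertices are sources, the size of a ball thus bounds the time. *)
Lemma scaled_flood_complete (s : 'I_n) q L t : SP s -> path e s q -> s + path_len h s q * B < M ->
  (forall (s' : 'I_n) q', SP s' -> path e s' q' -> last s' q' = last s q ->
     path_len h s' q' <= path_len h s q -> (s' : nat) \in L) ->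
  path_len h s q + size L <= t ->
  exists2 y, y \in (flood B M e src acc t (last s q)).2 &
    y <= s + path_len h s q * B /\ y = s + path_len h s q * B %[mod B].
Proof.
move=> hs hq lt hL ht; apply: (@flood_class _ _ _ _ _ _ B0 _ _ _ _ L).
- by move=> v u om c [<- _]; rewrite addn1.
- exact: scaled_reach_path.
- move=> y /scaled_reach_sound [s' [q' [h1 h2 h3 ->]]] le; have [-> _] := divmodB s' (path_len h s' q').
  apply: hL h1 h2 h3 _.
  by have := leq_div2r B le; rewrite !(proj2 (divmodB _ _)).
by rewrite (proj2 (divmodB _ _)).
Qed.

Lemma scaled_entry_pred t v x p u : ent t v x p (Some u) -> exists (u0 : 'I_n) x' p' o',
  [/\ u = u0, e u0 v, ent t u0 x' p' o', x' %% B = x %% B & x %/ B = x' %/ B + h u0 v].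
Proof.
move eo : (Some u) => o hent; case: hent eo => [//|u' x' p' om c hl ha lt] [eu]; subst u'.
have [u0 [t' [o' [hu euv lt' he]]]] := log_sound hl.
subst u; exists u0, x', p', o'; split=> //.
- by apply: entry_mono he; exact: ltnW.
- by rewrite [in RHS]addnC modnMDl.
by move: ha; rewrite acc_edge // => -[<- _]; rewrite addnC divnMDl // addnC.
Qed.

Lemma scaled_entry_root t v x p : ent t v x p None -> SP v /\ x = v.
Proof.
move eo : None => o hent; case: hent eo => // m p' + _ _; rewrite /src /self_src; by case: ifP => // _; rewrite inE => /eqP [-> _].
Qed.

End ScaledFlood.

Section PhaseA.
Variables (B M b N k qs I n : nat) (e : rel 'I_n).
Hypothesis esym : forall u v, e u v = e v u.
Variable f : 'I_n -> 'I_n -> nat.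
Hypotheses (f0 : forall u v, 0 < f u v) (fsym : wsym e f).
Variables (E fm dd : nat).
Variable wfl : 'I_n -> nat -> nat.
Hypothesis hw : forall u v : 'I_n, e u v -> wfl v u = f v u.
Variable nbl : 'I_n -> seq nat.
Hypothesis hnb : forall v u, u \in nbl v <-> exists2 u0 : 'I_n, u = u0 & e u0 v.
Variable S : seq nat.
Hypotheses (Sn : forall s, s \in S -> s < n) (szS : size S <= qs).
Hypotheses (E0 : 0 < E) (k0 : 0 < k) (nN : n <= N) (NB : N * N <= B) (Bb : B = b ^ 6).
Hypotheses (capM : (capd k E).+2 * B <= M) (dM : dd.+1 * B <= M) (IB : 2 ^ I <= B).
Hypotheses (ffm : forall u v, f u v <= fm) (FI : trunc_log 2 (n * fm) < I).
Hypotheses (estb : E.+1 * (2 * E).+1 * (n * fm) < b) (Ib : I < b) (Nb : N <= b) (fb : fm < b).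
Hypothesis hop : forall u v : 'I_n, exists q, [/\ path e u q, last u q = v & size q <= dd].
Let conn u v : exists2 p, path e u p & last u p = v.
Proof. by have [q [h1 h2 _]] := hop u v; exists q. Qed.
Local Notation dst := (dist e f).
Local Notation cp := (shortest_path f conn).
Hypothesis hitP : forall s v : 'I_n, k < size (cp s v) ->
  exists t : 'I_n, (t : nat) \in S /\ t \in take k (cp s v).
Variable c0 : seq 'I_n.
Hypothesis hc0 : is_cycle e c0.
Let G := cycle_weight f c0.
(** The radius is G / 2 enlarged by 1 + 1/E, so that the ball contains every source whose rounded
    distance is at most half of the rounded cycle. *)
Let Ball u := [set v | 2 * E * dst v u <= E.+1 * G].
Hypothesis hitB : forall u : 'I_n, k <= #|Ball u| -> exists t : 'I_n, (t : nat) \in S /\ t \in Ball u.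

Let n0 : 0 < n.
Proof. by case: (c0) hc0 => // x p _; exact: leq_ltn_trans (ltn_ord x). Qed.
Let N0 : 0 < N. Proof. exact: leq_trans nN. Qed.
Let NB' : N <= B. Proof. by apply: leq_trans NB; rewrite leq_pmulr. Qed.
Let B0 : 0 < B. Proof. exact: leq_trans NB'. Qed.
Let BM : B <= M. Proof. by move: dM; rewrite mulSn; lia. Qed.
Let ordN (u : 'I_n) : u < N. Proof. exact: leq_trans nN. Qed.
Let ordB (u : 'I_n) : u < B. Proof. exact: leq_trans NB'. Qed.
Let b0 : 0 < b. Proof. exact: leq_ltn_trans Ib. Qed.
Local Notation cap := (capd k E).

Variables (la lb : 'I_n -> nat -> log).
Hypothesis rla : runs B M e (fun v : 'I_n => scales E (wfl v) (self_src v true) (cap + k) I)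
  (I * (cap + k).+1) la.
Hypothesis rlb : runs B M e (fun v : 'I_n => scales E (wfl v) (self_src v ((v : nat) \in S)) (cap + qs) I)
  (I * (cap + qs).+1) lb.
Hypothesis hla : forall v i, i < I -> la v i = (flood B M e (fun v : 'I_n => self_src v true)
  (fun v => acc_scale E (wfl v) i) (cap + k).+1 v).1.
Hypothesis hlb : forall v i, i < I -> lb v i = (flood B M e (fun v : 'I_n => self_src v ((v : nat) \in S))
  (fun v => acc_scale E (wfl v) i) (cap + qs).+1 v).1.

Let segv (v : 'I_n) := seg B M I E v (wfl v) ((v : nat) \in S) (lb v).

Lemma path_len_cap (s : 'I_n) (h : nat) : h <= cap -> s + h * B < M.
Proof.
move=> le; have : h * B <= cap * B by rewrite leq_mul2r le orbT.
by move: capM; rewrite !mulSn; have := ordB s; lia.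
Qed.

Lemma seg_complete (s : 'I_n) q : (s : nat) \in S -> path e s q -> size q <= k ->
  path_len f s q <= n * fm -> exists2 z, segv (last s q) s z & z <= E.+1 * path_len f s q.
Proof.
move=> hs hq sq lF; have [h1 h2] := scale_path E s f0 k0 sq.
set i := trunc_log 2 _ in h1 h2.
have iI : i < I.
  by apply: leq_ltn_trans FI; apply: leq_trunc_log; apply: leq_trans lF; exact: leq_div.
have [|||y hy [ly cy]] := @scaled_flood_complete B M n e f fsym wfl hw E i
   (fun v : 'I_n => (v : nat) \in S) B0 ordB s q S (cap + qs).+1 hs hq.
- exact: path_len_cap.
- by [].
- by rewrite -addnS leq_add //; exact: leqW.
have [p [o ho]] := sent_entry hy.
exists (2 ^ i * (y %/ B)).
  exists i, y, p, o; split=> //; last by rewrite cy (proj1 (divmodB B0 ordB _ _)).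
  by rewrite /ent_scale hlb.
apply: leq_trans h1; rewrite leq_mul2l.
by have := leq_div2r B ly; rewrite (proj2 (divmodB B0 ordB _ _)) => ->; rewrite orbT.
Qed.

Lemma least_none (P : nat -> Prop) z : least P = None -> ~ P z.
Proof. by move=> h hz; have [y] := least_ex hz; rewrite h. Qed.

Lemma scaled_weight_edge i a c : E * f a c <= 2 ^ i * scaled_weight E i f a c.
Proof. by have := scaled_weight_lower E i f a [:: c]; rewrite /path_len /= !addn0. Qed.

Lemma scale_le i : i < I -> 2 ^ i <= B.
Proof. by move=> iI; apply: leq_trans IB; rewrite leq_exp2l // ltnW. Qed.

Lemma seg_lt v t z : segv v t z -> z < M.
Proof.
move=> [i [x [p [o [iI h _ ->]]]]].
have [xM _] : x < M /\ p < M by apply: entry_lt h; exact: leq_trans BM.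
apply: leq_ltn_trans xM; apply: leq_trans (leq_divM x B).
by rewrite mulnC leq_mul2l scale_le // orbT.
Qed.

Let its (v : 'I_n) := if (v : nat) \in S then
  tab M S (fun t => least (segv v t)) (fun t => t * N + v) else [::].
Let kk v := got B M (its v) (flood B M e its (fun _ _ => Some (1, 0)) (qs * qs + dd).+1 v).1.
Let K (t u y : nat) := exists u0 : 'I_n, [/\ u = u0, u \in S, t \in S & least (segv u0 t) = Some y].

Lemma itsP (v : 'I_n) a p : reflect (exists t, [/\ (v : nat) \in S, t \in S,
   least (segv v t) = Some p & a = t * N + v]) ((a, p) \in its v).
Proof.
rewrite /its; case: ifP => hv; last by constructor; case=> t [].
apply: (iffP (tabP _ _ _ _ _ _)) => [[t [h1 h2 _ h3]]|[t [_ h1 h2 h3]]]; first by exists t.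
by exists t; split=> //; have [h _] := least_some h2; exact: seg_lt h.
Qed.

Lemma skeleton_relP v t u p : krel N (kk v) t u p <-> K t u p.
Proof.
have H a q : kk v a q <-> exists u0, (a, q) \in its u0.
  apply: (@gotP B M n e its B0 _ _ [seq t * N + u | t <- S, u <- S] dd) => //.
  - move=> w c p' /itsP [t' [h1 h2 h3 ->]]; have h4 := Sn h2.
    apply: leq_trans NB; apply: leq_trans (_ : t'.+1 * N <= _).
      by rewrite mulSn addnC ltn_add2r.
    by rewrite leq_mul2r (leq_trans h4 nN) orbT.
  - move=> w c p' /itsP [t' [h1 h2 h3 ->]]; split; first exact: allpairs_f.
    by have [h _] := least_some h3; exact: seg_lt h.
  - move=> u1 u2 c p1 p2 /itsP [t1 [h1 h2 h3 ->]] /itsP [t2 [h4 h5 h6 ec]].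
    have [e1 e2] := divmodN t1 (ordN u1); have [e3 e4] := divmodN t2 (ordN u2).
    have et : t1 = t2 by rewrite -e1 ec e3.
    have euu : u1 = u2 by apply: val_inj; rewrite /= -e2 ec e4.
    by subst; move: h6; rewrite h3 => -[].
  - by rewrite size_allpairs /= addnC ltnW // ltnS leq_add2r leq_mul.
rewrite /krel; split=> [[uN /H [u0 /itsP [t' [h1 h2 h3 ec]]]]|[u0 [-> h1 h2 h3]]].
  have [e1 e2] := divmodN t uN; have [e3 e4] := divmodN t' (ordN u0).
  have et : t = t' by rewrite -e1 ec e3.
  have euu : u = u0 by rewrite -e2 ec e4.
  by exists u0; subst t' u.
by split; [exact: ordN|apply/H; exists u0; apply/itsP; exists t].
Qed.

Let pS (v : 'I_n) s := phiS B M N I E v (wfl v) ((v : nat) \in S) (lb v) (kk v) s.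

Lemma phiS_two_step v s : pS v s = least (two_step K (segv v) s).
Proof.
apply: least_ext => z; split=> -[t [y1 [y2 [h1 h2 h3]]]]; exists t, y1, y2; split=> //;
  apply: kreach_ext h1 => a c d; by rewrite skeleton_relP.
Qed.

Let its2 v := tab M S (pS v) (fun s => s).
Let lx v := (flood B M e its2 (fun _ _ => None) qs.+1 v).1.

Lemma lxP u v s z : e u v ->
  (nat_of_ord u, (s, z)) \in lx v <-> [/\ s \in S, pS u s = Some z & z < M].
Proof.
move=> euv; have -> : (nat_of_ord u, (s, z)) \in lx v <-> (s, z) \in its2 u.
  apply: exchP => //.
  - move=> w a p /tabP [t [h1 _ h2 ->]]; split=> //.
    by apply: leq_trans (Sn h1) _; exact: leq_trans NB'.
  - by move=> w a p p' /tabP [t [_ h1 _ ->]] /tabP [t' [_ h2 _ h3]]; subst t'; move: h2; rewrite h1 => -[].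
  - by move=> w; apply: leq_trans (size_tab _ _ _ _) _; exact: leqW.
by split=> [/tabP [t [h1 h2 h3 ->]]|[h1 h2 h3]] //; apply/tabP; exists s.
Qed.

Let phi (v : 'I_n) := phi_of B M N I E v (wfl v) S ((v : nat) \in S) (la v) (lb v) (kk v).
Let par (v : 'I_n) := par_of B M N I E v (wfl v) S ((v : nat) \in S) (la v) (lb v) (kk v).
Let nb v := nb_of B I (la v) (lx v).

(** The neighbour that delivered the last edge holds the same decomposition without this edge. Its
    value is smaller by 2^j times the rounded weight, hence by at least E f, and the neighbour's
    least value is no larger. *)
Lemma par_sound v i s u : i <= I -> par v i s = Some u -> exists u0 : 'I_n,
  [/\ u = u0, e u0 v & exists x y, [/\ phi v i s = Some x, phi u0 i s = Some y & y + E * f v u0 <= x]].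
Proof.
rewrite leq_eqVlt /par /par_of /phi /phi_of; case: eqVneq => [_ _|_ /= iI].
  case: ifP => // sS /least_some [[t [y [j [x [p [h1 jI h2 h3 h4]]]]]] _].
  move: h2; rewrite /ent_scale hlb // => h2.
  have [u0 [x' [p' [o' [h5 h6 h7 h8 h9]]]]] := scaled_entry_pred fsym hw B0 h2.
  exists u0; split=> //; exists (y + 2 ^ j * (x %/ B)).
  have [|z hz lz] := @least_ex (two_step K (segv u0) s) (y + 2 ^ j * (x' %/ B)).
    exists t, y, (2 ^ j * (x' %/ B)); split=> //.
      by apply: kreach_ext h1 => a c d; rewrite skeleton_relP.
    exists j, x', p', o'; split=> //; last by rewrite h8.
    by rewrite /ent_scale hlb.
  exists z; split=> //; first by rewrite -/(pS u0 s) phiS_two_step.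
  have := scaled_weight_edge j u0 v; rewrite -(fsym h6) h9 mulnDr; lia.
move=> /least_some [[x [p [h2 h3 h4]]] _].
move: h2; rewrite /ent_scale hla // => h2.
have [u0 [x' [p' [o' [h5 h6 h7 h8 h9]]]]] := scaled_entry_pred fsym hw B0 h2.
exists u0; split=> //; exists (2 ^ i * (x %/ B)).
have [|z hz lz] := @least_ex (fun z => exists x p o, [/\ ent_scale B M E u0 (wfl u0) true (la u0) i x p o, x %% B = s & z = 2 ^ i * (x %/ B)]) (2 ^ i * (x' %/ B)).
  by exists x', p', o'; rewrite /ent_scale hla // h8.
exists z; split=> //.
have := scaled_weight_edge i u0 v; rewrite -(fsym h6) h9 mulnDr; lia.
Qed.

(** The best decomposition at a sample [v] may end in an empty segment, which provides no parent.
    But then the last skeleton step was measured at [v] itself; taking it as the last segment keeps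
    the value. Repeating this yields a delivering neighbour or leads back to [s]. *)
Lemma par_root v i s x : i <= I -> phi v i s = Some x -> par v i s = None -> v = s :> nat.
Proof.
rewrite leq_eqVlt /par /par_of /phi /phi_of; case: eqVneq => [_ _|_ /= iI]; last first.
  move=> hx hp; have [[a [p [o [h1 h2 h3]]]] _] := least_some hx.
  case: o h1 => [u|] h1; last first.
    by move: h1; rewrite /ent_scale hla // => /scaled_entry_root [_ ea]; rewrite -h2 ea modn_small.
  by case: (least_none (z := u) hp); exists a, p; rewrite -h3.
case: ifP => // sS hx hp.
have noS t y i' a p u : kreach K s t y -> i' < I ->
    ent_scale B M E v (wfl v) ((v : nat) \in S) (lb v) i' a p (Some u) -> a %% B = t ->
    x = y + 2 ^ i' * (a %/ B) -> False.
  move=> h1 h2 h3 h4 h5; apply: (least_none (z := u) hp); exists t, y, i', a, p; split=> //.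
    by apply: kreach_ext h1 => a' c d; rewrite skeleton_relP.
  by rewrite -h5.
have hK t y : kreach K s t y -> t = v -> y = x -> v = s :> nat.
  elim=> [->|t' u y1 y2 h1 ih [u0 [-> h2 h3 /least_some [[i' [a [p [o [h4 h5 h6 h7]]]]] _]]]] //.
  move=> /val_inj eu; subst u0; case: o h5 => [u'|] h5 h8.
    by case: (noS _ _ _ _ _ _ h1 h4 h5 h6); rewrite -h7.
  move: h5; rewrite /ent_scale hlb // => /scaled_entry_root [_ ea].
  by apply: ih; [rewrite -h6 ea modn_small|rewrite -h8 h7 ea divn_small // muln0 addn0].
move: (hx); rewrite -/(pS v s) phiS_two_step => /least_some [[t [y [z [h1 [i' [a [p [o [h2 h3 h4 h5]]]]] h6]]]] _].
case: o h3 => [u|] h3.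
  by case: (noS _ _ _ _ _ _ h1 h2 h3 h4); rewrite h6 h5.
move: h3; rewrite /ent_scale hlb // => /scaled_entry_root [_ ea].
apply: hK h1 _ _; first by rewrite -h4 ea modn_small.
by rewrite h6 h5 ea divn_small // muln0 addn0.
Qed.


Lemma shortest_path_bound s v : path_len f s (cp s v) + fm <= n * fm.
Proof.
have [h1 h2 h3] := shortest_pathP f conn s v; apply: path_len_uniq => //.
by apply: (shortest_uniq conn f0 h1); rewrite h2 h3.
Qed.

Lemma dist_bound s v : dst s v + fm <= n * fm.
Proof. by have [_ _ <-] := shortest_pathP f conn s v; exact: shortest_path_bound. Qed.

Lemma dist_triangle s v p : path e v p -> dst s (last v p) <= dst s v + path_len f v p.
Proof.
move=> hp; have [q [h1 h2 <-]] := dist_path f conn s v.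
have h : path e s (q ++ p) by rewrite cat_path h1 h2.
by have := dist_le f h; rewrite last_cat path_len_cat h2.
Qed.

Lemma G_bound : G <= n * fm.
Proof.
rewrite /G; case: (c0) hc0 => // x p /and3P [_ up _].
rewrite cycle_weight_cons path_len_rcons; apply: leq_trans (path_len_uniq ffm up).
by rewrite leq_add2l.
Qed.

(** The fixed shortest path is cut at samples at most [k] edges apart. Each piece is rounded at its
    own scale, so errors are proportional to the pieces and add up to the factor 1 + 1/E once. *)
Lemma two_step_le_dist (s v : 'I_n) : (s : nat) \in S ->
  exists2 z, two_step K (segv v) s z & z <= E.+1 * dst s v.
Proof.
have [l ls] := ubnP (dst s v); elim: l s ls => // l ih s ls sS.
have [h1 h2 h3] := shortest_pathP f conn s v; have hb := shortest_path_bound s v.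
have [sq|sq] := leqP (size (cp s v)) k.
  have [|z hz lz] := seg_complete sS h1 sq; first by lia.
  rewrite h2 in hz; exists z; last by rewrite -h3.
  by exists s, 0, z; split=> //; exact: KRefl.
have [t [tS tq]] := hitP sq.
have st : size (take k (cp s v)) = k by rewrite size_takel // ltnW.
case/splitPr: tq st (cat_take_drop k (cp s v)) => r1 r2 st.
rewrite -cat_rcons -catA => eq.
move: h1 h2 h3 hb; rewrite -eq cat_path last_rcons last_cat last_rcons path_len_cat last_rcons.
move=> /andP [h1 h4] h2 h3 hb.
have [||z1 hz1 lz1] := seg_complete sS h1.
- by move: st; rewrite size_cat size_rcons /=; lia.
- by lia.
rewrite last_rcons in hz1; have [z1' hz1' lz1'] := least_ex hz1.
have d2 := dist_le f h4; rewrite h2 in d2.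
have d1 := path_len_size s (rcons r1 t) f0; rewrite size_rcons in d1.
have [|z2 [t' [y1 [y2 [g1 g2 g3]]]] lz2] := ih t _ tS; first by lia.
exists (z1' + z2).
  exists t', (z1' + y1), y2; split=> //; last by rewrite g3 addnA.
  apply: kreach_trans g1; rewrite -[z1']add0n; apply: KStep (KRefl _ _) _.
  by exists t.
apply: leq_trans (leq_add lz1' (leqnn _)) _; apply: leq_trans (leq_add lz1 lz2) _.
rewrite -mulnDr leq_mul2l /= -h3.
exact: leq_add.
Qed.

Let candv (v : 'I_n) := cand_at b I E n v (nbl v) (wfl v) (phi v) (par v) (nb v).

Let good_cand := exists (v : 'I_n) est i s y fy, [/\ candv v (enc6 b est i s v y fy),
  [/\ i < b, s < b, y < b & fy < b] & E * est <= E.+1 * (2 * E).+1 * G].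

Lemma est_lt est : E * est <= E.+1 * (2 * E).+1 * G -> est < b.
Proof.
move=> h; apply: leq_ltn_trans estb.
have : est <= E * est by rewrite leq_pmull.
move=> /leq_trans -/(_ _ h) /leq_trans; apply.
by rewrite leq_mul2l G_bound orbT.
Qed.

Let parO i s (v : 'I_n) : option 'I_n := obind insub (par v i s).

Lemma parOE i s v : i <= I -> omap (@nat_of_ord n) (parO i s v) = par v i s.
Proof.
move=> iI; rewrite /parO; case h : (par v i s) => [u|] //=.
by have [u0 [-> _ _]] := par_sound iI h; rewrite valK.
Qed.

Lemma mk_cand i s (u a : 'I_n) x z : i <= I -> s < n -> e u a -> phi u i s = Some x ->
  nb u i s a z -> z <= x -> parO i s u <> Some a ->
  E * (x + z + E * f u a) <= E.+1 * (2 * E).+1 * G -> good_cand.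
Proof.
move=> iI sn eua hx hz lz hp hest.
have eau : e a u by rewrite esym.
exists u, (x + z + E * f u a), i, s, (a : nat), (f u a); split=> //.
  exists i, s, (a : nat), x, z; rewrite hw //; split=> //.
  - by split=> //; apply/hnb; exists a.
  - by move=> h; apply: hp; rewrite /parO h /= valK.
  - by split=> //; exact: est_lt.
split; first exact: leq_ltn_trans Ib.
- by apply: leq_trans Nb; exact: leq_trans nN.
- by apply: leq_trans Nb.
by apply: leq_ltn_trans fb.
Qed.

Lemma cand_near_sample (s v0 : 'I_n) : (s : nat) \in S -> v0 \in c0 -> s \in Ball v0 -> good_cand.
Proof.
move=> sS hv; rewrite inE => hd.
have tot u : exists2 x, phi u I s = Some x & x <= E.+1 * dst s u.
  have [z hz lz] := two_step_le_dist u sS; have [x hx lex] := least_ex hz.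
  by exists x; [rewrite /phi /phi_of eqxx sS -/(pS u s) phiS_two_step|exact: leq_trans lex lz].
have [u [a [uc ac eua hp [mx sp]]]] :=
  cyc_nontree esym (fun u => odflt 0 (phi u I s)) (parO I s) hc0.
have [p [q [p1 p2 q1 q2 hh]]] := sp v0 hv; have {hh}hG := hh f fsym.
have [x hx lex] := tot u; have [z hz lz] := tot a; rewrite hx hz /= in mx.
have d1 := dist_triangle s p1; have d2 := dist_triangle s q1; rewrite p2 q2 in d1 d2.
apply: (@mk_cand I s u a x z) => //.
- have eau : e a u by rewrite esym.
  rewrite /nb /nb_of eqxx; apply/(lxP _ _ eau); split=> //.
    by move: hz; rewrite /phi /phi_of eqxx sS.
  have zb : z < b.
    apply: leq_ltn_trans estb; apply: leq_trans lz _; rewrite -mulnA leq_mul2l /=.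
    apply: leq_trans (leq_pmull _ _) => //; have := dist_bound s a; lia.
  apply: leq_trans zb _; apply: leq_trans BM; rewrite Bb.
  by rewrite -[X in X <= _]expn1 leq_exp2l // ; lia.
(* Both ends are reached from [s] through [v0] and along one arc each. The ball condition on [v0]
   then turns E (2 d + G) into (2 E + 1) G. *)
have h1 : x + z + E * f u a <= E.+1 * (2 * dst s v0 + G).
  apply: leq_trans (_ : E.+1 * (dst s u) + E.+1 * dst s a + E.+1 * f u a <= _).
    by rewrite !leq_add // leq_mul2r leqnSn orbT.
  by rewrite -!mulnDr leq_mul2l /=; move: hG; rewrite -/G; lia.
apply: leq_trans (_ : E * (E.+1 * (2 * dst s v0 + G)) <= _); first by rewrite leq_mul2l h1 orbT.
rewrite mulnCA -[X in _ <= X]mulnA leq_mul2l /= mulnDr mulnA [E * 2]mulnC mulSn.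
by move: hd; rewrite mulSn; lia.
Qed.


(** The whole cycle lies in [Ball v0], so it has at most [k] edges and a single scale fits it.
    Within half of the rounded cycle only members of [Ball u] compete at [u], so the keys of [v0]
    are sent in time. *)
Lemma cand_small_balls : (forall v0, v0 \in c0 -> #|Ball v0| < k) -> good_cand.
Proof.
move=> small.
have [v0 hv0] : exists v0, v0 \in c0.
  by case: (c0) hc0 => // x p _; exists x; rewrite inE eqxx.
have sub : {subset c0 <= Ball v0}.
  move=> u uc; rewrite inE; have [p [h1 h2 h3]] := cyc_half esym hc0 uc hv0 fsym.
  have := dist_le f h1; rewrite h2 => h4.
  apply: leq_trans (_ : E * G <= _); last by rewrite leq_mul2r leqnSn orbT.
  by rewrite mulnAC mulnC leq_mul2l; apply/orP; right; rewrite -/G in h3; lia.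
have sc : size c0 <= k.
  have /and3P [_ uc _] := hc0; rewrite -(card_uniqP uc).
  by apply: leq_trans (ltnW (small v0 hv0)); apply/subset_leq_card/subsetP.
pose i := trunc_log 2 (G %/ k).
have iI : i < I.
  by apply: leq_ltn_trans FI; apply: leq_trunc_log; apply: leq_trans G_bound; exact: leq_div.
pose h := scaled_weight E i f; pose Gs := cycle_weight h c0.
have [g1 g2] : 2 ^ i * Gs <= E.+1 * G /\ Gs <= cap.
  rewrite /Gs /h /i /G; case: (c0) hc0 sc => // x p _ sp; rewrite !cycle_weight_cons.
  have sp' : size (rcons p x) <= k by rewrite size_rcons.
  have [g1 g2] := @scale_path _ E k f x (rcons p x) f0 k0 sp'; split; [exact: g1|exact: g2].
have hs : wsym e h by move=> u v euv; rewrite /h /scaled_weight (fsym euv).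
pose snt u := (flood B M e (fun v : 'I_n => self_src v true) (fun v => acc_scale E (wfl v) i)
                 (cap + k).+1 u).2.
have A1 u p : u \in c0 -> path e v0 p -> last v0 p = u -> 2 * path_len h v0 p <= Gs ->
    exists2 y, y \in snt u & y %/ B <= path_len h v0 p /\ y %% B = v0.
  move=> uc hp hl hG; have hcap : path_len h v0 p <= cap by lia.
  have [|||y hy [ly cy]] := @scaled_flood_complete B M n e f fsym wfl hw E i (fun _ => true) B0 ordB v0 p
    [seq nat_of_ord v | v <- enum (Ball u)] (cap + k).+1 isT hp.
  - exact: path_len_cap.
  - move=> s' q' _ hq' hl' le; apply/mapP; exists s' => //; rewrite mem_enum inE.
    have d1 := dist_le f hq'; rewrite hl' hl in d1.
    have d2 := scaled_weight_lower E i f s' q'.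
    apply: leq_trans g1; apply: leq_trans (_ : 2 * (2 ^ i * path_len h s' q') <= _).
      by rewrite -mulnA leq_mul2l /=; apply: leq_trans d2; rewrite leq_mul2l d1 orbT.
    by rewrite mulnCA leq_mul2l; apply/orP; right; apply: leq_trans hG; rewrite leq_mul2l.
  - by rewrite size_map -cardE; have := small u uc; rewrite -/h; lia.
  - rewrite hl in hy; exists y => //.
    have := leq_div2r B ly; rewrite (proj2 (divmodB B0 ordB _ _)) => ->.
    by rewrite cy (proj1 (divmodB B0 ordB _ _)).
have ent_snt u y : y \in snt u -> exists p o, ent_scale B M E u (wfl u) true (la u) i y p o.
  by move=> /sent_entry [p [o ho]]; exists p, o; rewrite /ent_scale hla.
have phiE u : phi u i v0 = phiA B M E u (wfl u) (la u) i v0.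
  by rewrite /phi /phi_of (ltn_eqF iI).
have A2 u : u \in c0 -> exists x, [/\ phi u i v0 = Some x,
    forall p, path e v0 p -> last v0 p = u -> x <= 2 ^ i * path_len h v0 p &
    forall w, e u w -> nb w i v0 u x].
  move=> uc; have [p0 [p01 p02 p03]] := cyc_half esym hc0 hv0 uc hs.
  have ex y : y \in snt u -> y %% B = v0 -> exists2 x, phi u i v0 = Some x & x <= 2 ^ i * (y %/ B).
    move=> /ent_snt [p [o hy]] cy; rewrite phiE.
    have [|x hx lex] := @least_ex (fun z => exists x p o, [/\ ent_scale B M E u (wfl u) true (la u) i x p o,
      x %% B = v0 & z = 2 ^ i * (x %/ B)]) (2 ^ i * (y %/ B)); first by exists y, p, o.
    by exists x.
  have [y0 hy0 [ly0 cy0]] := A1 u p0 uc p01 p02 p03.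
  have [x hx lex] := ex y0 hy0 cy0; exists x.
  (* A path longer than half of the rounded cycle is beaten by the shorter arc, whose key did get
     through. *)
  have le p : path e v0 p -> last v0 p = u -> x <= 2 ^ i * path_len h v0 p.
    move=> hp hl; have [l|l] := leqP (2 * path_len h v0 p) Gs.
      have [y hy [ly cy]] := A1 u p uc hp hl l; have [x'] := ex y hy cy.
      by rewrite hx => -[<-] lx'; apply: leq_trans lx' _; rewrite leq_mul2l ly orbT.
    apply: leq_trans lex _; rewrite leq_mul2l; apply/orP; right.
    by apply: leq_trans ly0 _; rewrite -/Gs in p03; lia.
  split=> // w euw; rewrite /nb /nb_of (ltn_eqF iI) /nbA.
  move: (hx); rewrite phiE => /least_some [[xk [pk [ok [hk ck ek]]]] _].
  move: hk; rewrite /ent_scale hla // => /entry_reach /(scaled_reach_sound fsym hw) [s [q [_ hq lq eq]]].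
  have es : s = v0 by apply: val_inj; rewrite /= -ck eq (proj1 (divmodB B0 ordB _ _)).
  subst s; have exk : xk %/ B = path_len h v0 q by rewrite eq (proj2 (divmodB B0 ordB _ _)).
  (* The path that realises [x] is no longer than half of the cycle, so its key was sent too:
     neighbours learn [x] itself and not just an earlier, larger value. *)
  have hqG : 2 * path_len h v0 q <= Gs.
    have := leq_trans lex (leq_mul (leqnn (2 ^ i)) ly0).
    by rewrite ek exk leq_mul2l expn_eq0 /= => ?; rewrite -/Gs in p03; lia.
  have [y hy [ly cy]] := A1 u q uc hq lq hqG; have [x'] := ex y hy cy.
  rewrite hx => -[<-] lxy; have [p hp] := sent_log hy euw.
  exists y, p; rewrite hla //; split=> //; apply/eqP; rewrite eqn_leq lxy /=.
  by rewrite ek exk leq_mul2l ly orbT.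
have [u [a [uc ac eua hp [mx sp]]]] :=
  cyc_nontree esym (fun u => odflt 0 (phi u i v0)) (parO i v0) hc0.
have [p [q [p1 p2 q1 q2 hh]]] := sp v0 hv0; have {hh}hG := hh h hs.
have [x [hx lex _]] := A2 u uc; have [z [hz lez nz]] := A2 a ac; rewrite hx hz /= in mx.
have eau : e a u by rewrite esym.
apply: (@mk_cand i v0 u a x z) => //; first exact: ltnW.
  exact: nz.
have h1 := lex p p1 p2; have h2 := lez q q1 q2; have h3 := scaled_weight_edge i u a.
have h4 : x + z + E * f u a <= E.+1 * G.
  apply: leq_trans g1; apply: leq_trans (_ : 2 ^ i * (path_len h v0 p + path_len h v0 q + h u a) <= _).
    by rewrite 2!mulnDr; apply: leq_add => //; exact: leq_add.
  by rewrite leq_mul2l hG orbT.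
apply: leq_trans (_ : E * (E.+1 * G) <= _); first by rewrite leq_mul2l h4 orbT.
by rewrite mulnA leq_mul2r mulnC leq_mul2l /=; apply/orP; right; lia.
Qed.

Lemma good_cand_ex : good_cand.
Proof.
have [/existsP [v0 /andP [hv hb]]|] := boolP [exists v0, (v0 \in c0) && (k <= #|Ball v0|)].
  by have [t [tS tB]] := hitB hb; exact: cand_near_sample tS hv tB.
rewrite negb_exists => /forallP h; apply: cand_small_balls => v0 hv.
by have := h v0; rewrite hv /= -ltnNge.
Qed.

Let itm v := if least (candv v) is Some m then [:: m] else [::].

(** Candidates of inaccurate or incomplete trees compete as well. They are harmless: soundness of
    potentials and parents needs no completeness, and the least code has an estimate at most that of
    [good_cand]. *)
Lemma winner : exists m (phi' : 'I_n -> option nat) (par' : 'I_n -> option 'I_n) rt (x y : 'I_n) ax ay u,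
  [/\ (forall v p, par' v = Some p -> e p v /\
          exists x y, [/\ phi' v = Some x, phi' p = Some y & y + E * f v p <= x]),
      (forall v x, phi' v = Some x -> par' v = None -> v = rt),
      [/\ phi' x = Some ax, phi' y = Some ay, e x y, par' x <> Some y & par' y <> Some x],
      [/\ dig b 2 m = x, dig b 1 m = y & dig b 0 m = f x y] &
      [/\ E * (ax + ay + E * f x y) <= E.+1 * (2 * E).+1 * G, m \in itm u,
          (forall v m', m' \in itm v -> m <= m'), m < M &
          forall v, par v (dig b 4 m) (dig b 3 m) = omap (@nat_of_ord n) (par' v)]].
Proof.
have [v1 [est1 [i1 [s1 [y1 [fy1 [hc1 [b1 b2 b3 b4] he1]]]]]]] := good_cand_ex.
have v1b : v1 < b by apply: leq_trans Nb.
have [m hm lm] := @least_ex (fun m => exists v, candv v m) _ (ex_intro _ v1 hc1).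
have [[u hu] mn] := least_some hm.
have [i [s [y' [x [z [[iI sn /hnb [y ey eyu] hx] hz lzx hpar [estu em]]]]]]] := hu.
rewrite ey hw ?(esym u) // in em estu hpar hz.
have ib : i < b by exact: leq_ltn_trans Ib.
have sb : s < b by apply: leq_trans Nb; exact: leq_trans nN.
have ordb (w : 'I_n) : w < b by apply: leq_trans Nb.
have fub : f u y < b by exact: leq_ltn_trans fb.
have [d4 d3 d2 d1 d0] := @dig_enc6 b (x + z + E * f u y) i s u y (f u y) b0 ib sb (ordb u) (ordb y) fub.
rewrite -em in d4 d3 d2 d1 d0.
(* What [u] heard from [y] may be outdated and is only an upper bound on the potential of [y]. *)
have [ay hay lay] : exists2 ay, phi y i s = Some ay & ay <= z.
  move: hz; rewrite /nb /nb_of /phi /phi_of; case: eqVneq => [ei|ni].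
    by move=> /(lxP _ _ eyu) [sS hpS _]; rewrite sS -/(pS y s) hpS; exists z.
  move=> [xk [p [hl ck ->]]]; apply: least_ex.
  have iI' : i < I by rewrite ltn_neqAle ni.
  move: hl; rewrite hla // => /log_sound [y0 [t' [o [/val_inj ey0 _ lt h]]]]; subst y0.
  exists xk, p, o; split=> //; rewrite /ent_scale hla //.
  by apply: entry_mono h; exact: ltnW.
exists m, (fun v => phi v i s), (parO i s), (Ordinal sn), u, y, x, ay, u; split.
- move=> v p hp; have hp' : par v i s = Some (p : nat) by rewrite -(parOE s v iI) hp.
  by have [p0 [/val_inj <- h1 h2]] := par_sound iI hp'.
- move=> v a ha hp; apply: val_inj => /=; apply: (par_root iI ha).
  by rewrite -(parOE s v iI) hp.
- split=> //; first by rewrite esym.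
  + by move=> hp; apply: hpar; rewrite -/(par u i s) -(parOE s u iI) hp.
  (* Here the test [z <= x] is used: a child of [u] has potential above [x], whereas that of [y] is
     at most [z]. *)
  move=> hp; have hp' : par y i s = Some (u : nat) by rewrite -(parOE s y iI) hp.
  have [p0 [/val_inj e0 _ [a1 [a2 [g1 g2 g3]]]]] := par_sound iI hp'; subst p0.
  move: g1 g2; rewrite hay hx => -[?] [?]; subst a1 a2.
  have : 0 < E * f y u by rewrite muln_gt0 E0 f0.
  lia.
- by [].
split.
- apply: leq_trans he1; rewrite leq_mul2l; apply/orP; right.
  apply: leq_trans (_ : x + z + E * f u y <= _); first by rewrite leq_add2r leq_add2l.
  by apply: (@enc6_le b _ i1 s1 v1 y1 fy1 _ i s u y (f u y)); rewrite -?em.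
- rewrite /itm (@least_eq _ m) ?inE // => m' hm'; apply: mn; by exists u.
- move=> v m'; rewrite /itm; case h: (least _) => [a|] //; rewrite inE => /eqP ->.
  by have [ha _] := least_some h; apply: mn; exists v.
- apply: leq_trans BM; rewrite Bb em; exact: enc6_lt.
by move=> v; rewrite d4 d3 parOE.
Qed.

Theorem phaseA_runs : exists m (phi' : 'I_n -> option nat) (par' : 'I_n -> option 'I_n) rt (x y : 'I_n) ax ay,
  [/\ (forall v p, par' v = Some p -> e p v /\
          exists x y, [/\ phi' v = Some x, phi' p = Some y & y + E * f v p <= x]),
      (forall v x, phi' v = Some x -> par' v = None -> v = rt),
      [/\ phi' x = Some ax, phi' y = Some ay, e x y, par' x <> Some y & par' y <> Some x],
      [/\ dig b 2 m = x, dig b 1 m = y & dig b 0 m = f x y] &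
      E * (ax + ay + E * f x y) <= E.+1 * (2 * E).+1 * G /\
      runs B M e (fun v : 'I_n => phaseA B M b N k qs I E n v (nbl v) (wfl v) S dd)
        (I * (cap + k).+1 + (I * (cap + qs).+1 + ((qs * qs + dd).+1 + (qs.+1 + (dd.+1 + 0)))))
        (fun v => (m, omap (@nat_of_ord n) (par' v)))].
Proof.
have [m [phi' [par' [rt [x [y [ax [ay [u [h1 h2 h3 h4 [h5 h6 h7 h8 h9]]]]]]]]]]] := winner.
exists m, phi', par', rt, x, y, ax, ay; split=> //; split=> //.
apply: (runs_bind rla); apply: (runs_bind rlb).
apply: runs_bind; first exact: runs_bcast.
apply: runs_bind; first exact: runs_exch.
apply: runs_bind; first by apply: (@runs_minfl B M n e itm dd u m).
by apply: RunRet => v; rewrite -h9.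
Qed.

End PhaseA.

(** * The radius of the graph *)

Section Radius.
Variables (B M n D : nat) (e : rel 'I_n) (v0 : 'I_n).
Hypotheses (esym : forall u v, e u v = e v u) (v00 : v0 = 0 :> nat).
Hypothesis hopD : forall u v : 'I_n, exists q, [/\ path e u q, last u q = v & size q <= D].
Hypotheses (B0 : 0 < B) (MD : (4 * D + 4) * B <= M).

Let acc1 (_ : 'I_n) (_ : nat) := Some (1, 0).

Section Step.
Variable i : nat.
Hypothesis iD : 2 ^ i <= 2 * D.

Let s1 (v : 'I_n) := if nat_of_ord v == 0 then [:: (0, 0)] else [::].
Let lg1 v := (flood B M e s1 acc1 (2 ^ i).+1 v).1.
Let reached v := exists x p o, entry B M (s1 v) (acc1 v) (lg1 v) x p o /\ x <= 2 ^ i * B.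

Lemma size_lt q : q <= 2 * 2 ^ i + 1 -> 0 + q * B < M.
Proof.
move=> lq; rewrite add0n; apply: leq_trans MD; rewrite ltn_mul2r B0 /=; lia.
Qed.

Lemma reachedP v : reached v <-> exists q, [/\ path e v0 q, last v0 q = v & size q <= 2 ^ i].
Proof.
have s1lt u m p : (m, p) \in s1 u -> m < B by rewrite /s1; case: ifP => // _; rewrite inE => /eqP [->].
split=> [[x [p [o [/entry_reach h lx]]]]|[q [h1 h2 h3]]].
  have [u [p' [q [g1 g2 g3 g4]]]] := reach_src B0 s1lt h.
  have u0 : u = v0 by apply: val_inj; move: g1; rewrite /s1 /= v00; case: eqP.
  subst u; exists q; split=> //; rewrite g4.
  by apply: leq_trans (leq_div2r B lx) _; rewrite mulnK.
have hs : (0, 0) \in s1 v0 by rewrite /s1 v00 inE.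
have lt : 0 + size q * B < M by apply: size_lt; lia.
have hr : reach B M e s1 acc1 (last v0 q) (0 + size q * B) := reach_path B0 hs h1 lt.
have [|||y hy [ly _]] := @flood_class B M n e s1 acc1 B0 _ (2 ^ i).+1 _ _ [:: 0] hr.
- by move=> w u om c [<-].
- move=> y /(reach_src B0 s1lt) [u [p [q' [g _ _ _]]]] _; move: g; rewrite /s1.
  by case: ifP => // _; rewrite inE => /eqP [->].
- by rewrite add0n mulnK //= addn1.
have [p [o ho]] := sent_entry hy; exists y, p, o; rewrite -h2; split=> //.
by apply: leq_trans ly _; rewrite add0n leq_mul2r h3 orbT.
Qed.

Let s2 (v : 'I_n) := if pbool (reached v) then [::] else [:: (0, 0)].
Let lg2 v := (flood B M e s2 acc1 (2 * 2 ^ i + 1).+1 v).1.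
Let bad v := exists x p o, entry B M (s2 v) (acc1 v) (lg2 v) x p o.

Lemma s2lt u m p : (m, p) \in s2 u -> m < B.
Proof. by rewrite /s2; case: ifP => // _; rewrite inE => /eqP [->]. Qed.

Lemma boundary y u r : ~ reached y -> reached u -> path e u r -> last u r = y ->
  exists a c, [/\ reached a, ~ reached c & e a c].
Proof.
move=> hy; elim: r u => [|c r ih] u hu; first by move=> _ /= eu; subst.
move=> /= /andP [huc hr] hl; case: (pboolP (reached c)) => hc; first exact: ih hc hr hl.
by exists u, c.
Qed.

Lemma bad_everywhere y : ~ reached y -> forall v, bad v.
Proof.
move=> hy v.
(* A path from a reached to an unreached vertex leaves the ball along an edge to some unreached [c].
   From [c] it is one hop back into the ball and 2^i + 2^i hops via node 0 to [v]. *)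
have [c [r [hc hr hl hs]]] : exists c r, [/\ ~ reached c, path e c r, last c r = v & size r <= 2 * 2 ^ i + 1].
  case: (pboolP (reached v)) => hv; last by exists v, [::].
  have [r [h1 h2 _]] := hopD v y.
  have [a [c [/reachedP [qa [a1 a2 a3]] h4 eac]]] := boundary hy hv h1 h2.
  have /reachedP [qv [b1 b2 b3]] := hv.
  exists c, (a :: rev (belast v0 qa) ++ qv); split=> //.
  - rewrite /= esym eac cat_path -{1}a2 path_rev //= -{1}a2 last_rev_belast //.
  - by rewrite /= last_cat -{1}a2 last_rev_belast.
  - by rewrite /= size_cat size_rev size_belast; lia.
have hsrc : (0, 0) \in s2 c by rewrite /s2; case: pboolP => // _; rewrite inE.
have lt : 0 + size r * B < M by exact: size_lt.
have hre : reach B M e s2 acc1 (last c r) (0 + size r * B) := reach_path B0 hsrc hr lt.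
have [|||z hz _] := @flood_class B M n e s2 acc1 B0 _ (2 * 2 ^ i + 1).+1 _ _ [:: 0] hre.
- by move=> w u om c' [<-].
- move=> z /(reach_src B0 s2lt) [u [p [q' [g _ _ _]]]] _; move: g; rewrite /s2.
  by case: ifP => // _; rewrite inE => /eqP [->].
- by rewrite add0n mulnK //= addn1.
by have [p [o ho]] := sent_entry hz; exists z, p, o; rewrite -hl.
Qed.

Lemma bad_none : (forall y, reached y) -> forall v, ~ bad v.
Proof.
move=> h v [x [p [o /entry_reach /(reach_src B0 s2lt) [u [p' [q [g _ _ _]]]]]]].
by move: g; rewrite /s2; case: pboolP.
Qed.

Lemma find_radius_step fuel T r :
  (if [exists y, ~~ pbool (reached y)] then
     runs B M e (fun v : 'I_n => find_radius B M v fuel i.+1) T r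
   else T = 0 /\ r = (fun _ => i)) ->
  runs B M e (fun v : 'I_n => find_radius B M v fuel.+1 i)
    ((2 ^ i).+1 + ((2 * 2 ^ i + 1).+1 + T)) r.
Proof.
move=> h; apply: (@runs_flood B M n e nat s1 acc1); apply: (@runs_flood B M n e nat s2 acc1).
case: ifP h => [/existsP [y /pboolP hy] h|/negbT hn [-> ->]].
  by apply: runs_ext h => v; case: pboolP => // [[]]; exact: (bad_everywhere hy v).
apply: RunRet => v; case: pboolP => // hb; case: (bad_none _ hb) => y.
apply/pboolP; move: hn; rewrite negb_exists => /forallP /(_ y); by rewrite negbK.
Qed.

Lemma find_radius_case fuel :
  (exists y, (forall q, path e v0 q -> last v0 q = y -> 2 ^ i < size q) /\
    forall T r, runs B M e (fun v : 'I_n => find_radius B M v fuel i.+1) T r ->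
    runs B M e (fun v : 'I_n => find_radius B M v fuel.+1 i)
      ((2 ^ i).+1 + ((2 * 2 ^ i + 1).+1 + T)) r) \/
  (forall y, exists q, [/\ path e v0 q, last v0 q = y & size q <= 2 ^ i]) /\
  runs B M e (fun v : 'I_n => find_radius B M v fuel.+1 i)
    ((2 ^ i).+1 + ((2 * 2 ^ i + 1).+1 + 0)) (fun _ => i).
Proof.
have st := @find_radius_step fuel.
case: (boolP [exists y, ~~ pbool (reached y)]) => hb; rewrite ?hb ?(negbTE hb) in st.
  have /existsP [y /pboolP hy] := hb; left; exists y; split=> // q h1 h2.
  by rewrite ltnNge; apply/negP => le; apply: hy; apply/reachedP; exists q.
right; split; last exact: st.
move: hb; rewrite negb_exists => /forallP hb y; apply/reachedP; apply/pboolP.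
by rewrite -[pbool _]negbK.
Qed.

End Step.

(** An iteration costs 3 * 2^i + 3 rounds. The summand 3 * 2^i on the left makes the induction
    close, since its doubling pays for the iteration; an unreached vertex gives 2^i < D. *)
Lemma find_radius_runs fuel i : 0 < D -> 2 ^ i <= 2 * D -> D <= 2 ^ (i + fuel) ->
  exists T j, [/\ runs B M e (fun v : 'I_n => find_radius B M v fuel i) T (fun _ => j),
    2 ^ j <= 2 * D, T + 3 * 2 ^ i <= 12 * D + 3 * fuel &
    forall u v : 'I_n, exists q, [/\ path e u q, last u q = v & size q <= 2 * 2 ^ j]].
Proof.
move=> D0; elim: fuel i => [|fuel ih] i iD Di.
  exists 0, i; split=> //; first exact: RunRet.
    by lia.
  move=> u v; have [q [h1 h2 h3]] := hopD u v; exists q; split=> //.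
  by move: Di; rewrite addn0; lia.
have [[y [hy st]]|[hr st]] := find_radius_case iD fuel.
  have lt : 2 ^ i < D.
    by have [q [h1 h2 h3]] := hopD v0 y; apply: leq_trans h3; exact: hy.
  have [||T [j [h1 h2 h3 h4]]] := ih i.+1.
  - by rewrite expnS leq_mul2l ltnW.
  - by rewrite addSnnS.
  exists ((2 ^ i).+1 + ((2 * 2 ^ i + 1).+1 + T)), j; split=> //; first exact: st.
  by move: h3; rewrite expnS; lia.
exists ((2 ^ i).+1 + ((2 * 2 ^ i + 1).+1 + 0)), i; split=> //; first by lia.
move=> u v; have [q1 [a1 a2 a3]] := hr u; have [q2 [b1 b2 b3]] := hr v.
have hu : path e u (rev (belast v0 q1)) by rewrite -{1}a2; exact: path_rev.
have lu : last u (rev (belast v0 q1)) = v0 by rewrite -{1}a2 last_rev_belast.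
exists (rev (belast v0 q1) ++ q2); rewrite cat_path last_cat lu hu.
by split=> //; rewrite size_cat size_rev size_belast; lia.
Qed.

End Radius.

(** * Running all phases *)

Definition hitsl n (s : seq nat) (A : {set 'I_n}) := [exists t in A, (t : nat) \in s].

Lemma hitslP n (s : seq nat) (A : {set 'I_n}) :
  reflect (exists t : 'I_n, (t : nat) \in s /\ t \in A) (hitsl s A).
Proof.
apply: (iffP existsP) => [[t /andP [h1 h2]]|[t [h1 h2]]]; exists t => //.
by apply/andP.
Qed.

(** A chain is determined by its start and its length, so the second sample has only [n] sets to
    hit. *)
Fixpoint up_list n (par : 'I_n -> option 'I_n) l v :=
  if l is l'.+1 then (if par v is Some u then u :: up_list par l' u else [::]) else [::].

Lemma chain_up n (par : 'I_n -> option 'I_n) v p : chain par v p -> p = up_list par (size p) v.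
Proof.
elim: p v => //= u p ih v /andP [/eqP -> hp].
by rewrite -ih.
Qed.

Section Whole.
Variables (B M b N k qs I n D fuel N1 : nat) (e : rel 'I_n) (v0 : 'I_n).
Hypotheses (esym : forall u v, e u v = e v u) (eirr : forall u, ~~ e u u) (v00 : v0 = 0 :> nat).
Variable f : 'I_n -> 'I_n -> nat.
Hypotheses (f0 : forall u v, 0 < f u v) (fsym : wsym e f).
Variables (E fm : nat).
Variable wfl : 'I_n -> nat -> nat.
Hypothesis hw : forall u v : 'I_n, e u v -> wfl v u = f v u.
Variable nbl : 'I_n -> seq nat.
Hypothesis hnb : forall v u, u \in nbl v <-> exists2 u0 : 'I_n, u = u0 & e u0 v.
Hypotheses (E0 : 0 < E) (k0 : 0 < k) (nN : n <= N) (N2 : 1 < N) (NB : N * N <= B) (Bb : B = b ^ 6).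
Hypotheses (capM : (capd k E).+2 * B <= M) (MD : (4 * D + 4) * B <= M) (IB : 2 ^ I <= B).
Hypotheses (ffm : forall u v, f u v <= fm) (FI : trunc_log 2 (n * fm) < I).
Hypotheses (estb : E.+1 * (2 * E).+1 * (n * fm) < b) (Ib : I < b) (Nb : N <= b) (fb : fm < b).
Hypotheses (D0 : 0 < D) (Dfuel : D <= 2 ^ fuel).
Hypothesis hopD : forall u v : 'I_n, exists q, [/\ path e u q, last u q = v & size q <= D].
Variable c0 : seq 'I_n.
Hypothesis hc0 : is_cycle e c0.

Let conn u v : exists2 p, path e u p & last u p = v.
Proof. by have [q [h1 h2 _]] := hopD u v; exists q. Qed.

Definition round_total dd :=
  12 * D + 3 * fuel + ((2 * qs + dd).+1 +
  ((I * (capd k E + k).+1 + (I * (capd k E + qs).+1 + ((qs * qs + dd).+1 + (qs.+1 + (dd.+1 + 0))))) +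
  (2 + ((k + qs.+2).+1 + ((qs.+2 * qs + dd).+1 + dd.+1))))).

Let Bal u := [set v | 2 * E * dist e f v u <= E.+1 * cycle_weight f c0].

Let pathset (p : 'I_n * 'I_n) := [set t in take k (shortest_path f conn p.1 p.2)].

Definition hit_sets1 : seq {set 'I_n} :=
  [seq A : {set 'I_n} <- [seq pathset p | p <- enum {: 'I_n * 'I_n}] ++ [seq Bal u | u <- enum 'I_n] | k <= #|A|].

Definition hit_sets2 (par : 'I_n -> option 'I_n) : seq {set 'I_n} :=
  [seq A : {set 'I_n} <- [seq [set t in up_list par k v] | v <- enum 'I_n] | k <= #|A|].

Lemma size_hit_sets1 : size hit_sets1 <= n * n + n.
Proof.
rewrite size_filter; apply: leq_trans (count_size _ _) _.
by rewrite size_cat (size_map pathset) (size_map Bal) -!cardT card_prod !card_ord.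
Qed.

Lemma size_hit_sets2 par : size (hit_sets2 par) <= n.
Proof.
rewrite size_filter; apply: leq_trans (count_size _ _) _.
by rewrite (size_map (fun v => [set t in up_list par k v])) -cardT card_ord.
Qed.

(** A block of random bits may encode a number that is no vertex; such draws are ignored. *)
Let flt (s : seq nat) := [seq x <- iota 0 n | x \in s].

Lemma size_flt s : size (flt s) <= size s.
Proof.
apply: uniq_leq_size; first by rewrite filter_uniq // iota_uniq.
by move=> x; rewrite mem_filter => /andP [].
Qed.

Lemma mem_flt s (t : 'I_n) : ((t : nat) \in flt s) = ((t : nat) \in s).
Proof. by rewrite mem_filter mem_iota /= add0n ltn_ord andbT. Qed.

(** The quantifiers express that the tree depends on the first sample only. [sm1] and [sm2] are
    constrained at [v0] alone, because only node 0 injects samples. *)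
Theorem whole_runs s1 : size s1 <= qs -> all (fun x => x < N) s1 -> all (hitsl s1) hit_sets1 ->
  exists par, forall s2, size s2 <= qs -> all (hitsl s2) (hit_sets2 par) ->
  exists T c, [/\ is_cycle e c, E * (E * cycle_weight f c) <= E.+1 * (2 * E).+1 * cycle_weight f c0,
    T <= round_total (4 * D) &
    forall sm1 sm2 : 'I_n -> seq nat, sm1 v0 = s1 -> sm2 v0 = s2 -> all (fun x => x < N) s2 ->
    runs B M e (fun v : 'I_n => whole B M b N k qs I E n v (nbl v) (wfl v) N1 (sm1 v) (sm2 v) fuel) T
      (fun _ => cycle_weight f c %/ N1)].
Proof.
move=> z1 N1s h1.
have n0 : 0 < n by exact: leq_ltn_trans (ltn_ord v0).
have N0 : 0 < N by exact: leq_trans nN.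
have B0 : 0 < B by apply: leq_trans NB; rewrite muln_gt0 N0.
have [|T0 [j [r0 j1 t0 hop]]] := @find_radius_runs B M n D e v0 esym v00 hopD B0 MD fuel 0 D0 _ Dfuel.
  by rewrite expn0; lia.
set dd := 2 * 2 ^ j in hop.
have dM : dd.+1 * B <= M by apply: leq_trans MD; rewrite leq_mul2r; apply/orP; right; rewrite /dd; lia.
have kM : k.+1 * B <= M.
  apply: leq_trans capM; rewrite leq_mul2r; apply/orP; right.
  by rewrite ltnS /capd; apply: leqW; rewrite leq_pmull.
have BM : B <= M by apply: leq_trans dM; rewrite leq_pmull.
have bM : b <= M.
  apply: leq_trans BM; rewrite Bb -[X in X <= _]expn1.
  by apply: leq_pexp2l => //; exact: leq_ltn_trans Ib.
have fmM : 3 * (n * fm) < M.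
  apply: leq_trans bM; apply: leq_ltn_trans estb; rewrite leq_mul2r; apply/orP; right.
  by apply: leq_trans (_ : 2 * 3 <= _) => //; apply: leq_mul => //; lia.
pose S1 := flt s1.
have [la' rla hla] := @runs_scales B M n e E wfl (fun v : 'I_n => self_src v true) (capd k E + k) I.
have [lb' rlb hlb] := @runs_scales B M n e E wfl (fun v : 'I_n => self_src v ((v : nat) \in S1)) (capd k E + qs) I.
have Sn s : s \in S1 -> s < n by rewrite mem_filter mem_iota => /andP [_ /andP []].
have szS1 : size S1 <= qs by apply: leq_trans (size_flt s1) z1.
have hitP (conn' : forall u v, exists2 p, path e u p & last u p = v) s v : k < size (shortest_path f conn' s v) ->
    exists t : 'I_n, (t : nat) \in S1 /\ t \in take k (shortest_path f conn' s v).
  (* [shortest_path] has a connectivity proof as argument. The sets to be hit use the one from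
     [hopD], independent of the radius found, whereas the first phase uses [hop]. *)
  have -> : conn' = conn by exact: Classical_Prop.proof_irrelevance.
  move=> sk; have up : uniq (take k (shortest_path f conn s v)).
    apply: take_uniq; have [g1 g2 g3] := shortest_pathP f conn s v.
    by have /andP [] : uniq (s :: shortest_path f conn s v) by apply: (shortest_uniq conn f0 g1); rewrite g2 g3.
  have /hitslP [t [tS]] : hitsl s1 (pathset (s, v)).
    apply: (allP h1); rewrite mem_filter cardsE (card_uniqP up) size_takel ?leqnn; last exact: ltnW.
    by rewrite mem_cat; apply/orP; left; apply/mapP; exists (s, v); rewrite // mem_enum.
  by rewrite inE => ht; exists t; rewrite mem_flt.
have hitB (u : 'I_n) : k <= #|Bal u| -> exists t : 'I_n, (t : nat) \in S1 /\ t \in Bal u.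
  move=> hk; have /hitslP [t [tS tB]] : hitsl s1 (Bal u).
    apply: (allP h1); rewrite mem_filter hk mem_cat; apply/orP; right.
    by apply/mapP; exists u; rewrite // mem_enum.
  by exists t; rewrite mem_flt.
have [m [phi [par [rt [x [y [ax [ay [A1 A2 [A3 A4 A5 A6 A7] [A8 A9 A10] [A11 A12]]]]]]]]]] :=
  @phaseA_runs B M b N k qs I n e esym f f0 fsym E fm dd wfl hw nbl hnb S1 Sn szS1 E0 k0 nN NB Bb
    capM dM IB ffm FI estb Ib Nb fb hop (hitP _) c0 hc0 hitB la' lb' rla rlb hla hlb.
exists par => s2 z2 h2; pose S2 := flt s2.
have szS2 : size S2 <= qs by apply: leq_trans (size_flt s2) z2.
have hits2 v p : chain par v p -> size p = k -> exists t : 'I_n, (t : nat) \in S2 /\ t \in p.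
  move=> hp sp; have /andP [_ up] := chain_uniq f0 E0 A1 hp.
  have /hitslP [t [tS]] : hitsl s2 [set t in up_list par k v].
    apply: (allP h2); rewrite mem_filter; apply/andP; split; last by apply/mapP; exists v; rewrite // mem_enum.
    by rewrite -sp -(chain_up hp) cardsE (card_uniqP up).
  by rewrite -sp -(chain_up hp) inE => ht; exists t; rewrite mem_flt.
have [c [hc hcE rB]] := @phaseB_runs B M b N k qs n e esym eirr f f0 fsym E phi par rt E0 A1 A2 wfl hw S2 dd m
  x y ax ay fm A3 A4 A5 A6 A7 A8 A9 A10 nN NB kM dM ffm fmM hop szS2 k0 hits2.
exists (T0 + ((2 * qs + dd).+1 +
  ((I * (capd k E + k).+1 + (I * (capd k E + qs).+1 + ((qs * qs + dd).+1 + (qs.+1 + (dd.+1 + 0))))) +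
  ((2 + ((k + qs.+2).+1 + ((qs.+2 * qs + dd).+1 + dd.+1))) + 0)))), c; split=> //.
- by apply: leq_trans A11; rewrite leq_mul2l hcE orbT.
- have ddD : dd <= 4 * D by rewrite /dd; lia.
  rewrite /round_total; move: t0 ddD; rewrite expn0; move: (capd _ _) (qs * qs) (qs.+2 * qs) => *; lia.
move=> sm1 sm2 e1 e2 N2s; rewrite /whole.
apply: (runs_bind r0); rewrite -/dd.
pose its (v : 'I_n) : seq (nat * nat) := if (v : nat) == 0 then
   [seq (s, 0) | s <- sm1 v] ++ [seq (N + s, 0) | s <- sm2 v] else [::].
have itsP v a p : (a, p) \in its v -> [/\ v = v0, p = 0, a \in s1 ++ [seq N + s | s <- s2] & a < B].
  rewrite /its; case: eqP => // hv; have ev : v = v0 by apply: val_inj; rewrite /= hv v00.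
  subst v; rewrite e1 e2 mem_cat => /orP [|] /mapP [s hs [-> ->]]; rewrite mem_cat; split=> //.
  - by rewrite hs.
  - by apply: leq_trans (allP N1s _ hs) _; apply: leq_trans NB; rewrite leq_pmulr.
  - by rewrite map_f ?orbT.
  - by have := allP N2s _ hs; move: NB; have : 2 * N <= N * N by [rewrite leq_mul2r N2 orbT]; lia.
pose kk v := got B M (its v) (flood B M e its (fun _ _ => Some (1, 0)) (2 * qs + dd).+1 v).1.
have kkP v a p : kk v a p <-> exists u, (a, p) \in its u.
  apply: (@gotP B M n e its B0 _ _ (s1 ++ [seq N + s | s <- s2]) dd) => //.
  - by move=> u a' p' /itsP [].
  - by move=> u a' p' /itsP [_ -> h _]; split=> //; exact: leq_trans BM.
  - by move=> u w a' p1 p2 /itsP [_ -> _ _] /itsP [_ -> _ _].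
  - by rewrite size_cat size_map addnC; apply: leqW; rewrite leq_add2r mul2n -addnn leq_add.
have eS1 v : [seq s <- iota 0 n | pbool (kk v s 0)] = S1.
  apply: eq_in_filter => s; rewrite mem_iota add0n => /andP [_ sn].
  apply/pboolP/idP => [/kkP [u /itsP [_ _ + _]]|hs].
    rewrite mem_cat => /orP [//|/mapP [s' _ es]]; lia.
  by apply/kkP; exists v0; rewrite /its v00 /= e1 mem_cat map_f.
have eS2 v : [seq s <- iota 0 n | pbool (kk v (N + s) 0)] = S2.
  apply: eq_in_filter => s; rewrite mem_iota add0n => /andP [_ sn].
  apply/pboolP/idP => [/kkP [u /itsP [_ _ + _]]|hs].
    rewrite mem_cat => /orP [/(allP N1s) /= h|/mapP [s' hs' /addnI -> //]]; lia.
  by apply/kkP; exists v0; rewrite /its v00 /= e2 mem_cat (map_f (fun s => (N + s, 0)) hs) orbT.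
apply: runs_bind; first exact: (@runs_bcast B M n e its).
apply: (@runs_ext _ _ _ _ _ (fun v : 'I_n => bind (phaseA B M b N k qs I E n v (nbl v) (wfl v) S1 dd)
  (fun r => bind (phaseB B M b N k qs v (wfl v) S2 dd r.1 r.2) (fun g => Ret (g %/ N1))))).
  by move=> v; rewrite -(eS1 v) -(eS2 v).
apply: (runs_bind A12); apply: (runs_bind rB).
exact: RunRet.
Qed.

End Whole.

(** * Counting random strings *)

Fixpoint blocks (L q : nat) (s : seq bool) : seq nat :=
  if q is q'.+1 then unbits (take L s) :: blocks L q' (drop L s) else [::].

Lemma size_blocks L q s : size (blocks L q s) = q.
Proof. by elim: q s => //= q ih s; rewrite ih. Qed.

Lemma blocks_lt L q s : all (fun x => x < 2 ^ L) (blocks L q s).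
Proof.
elim: q s => //= q ih s; rewrite ih andbT; apply: leq_trans (unbits_lt _) _.
by rewrite leq_exp2l // size_take; case: ltnP.
Qed.

Lemma bernoulli y k m : y ^ m + m * k * y ^ m.-1 <= (y + k) ^ m.
Proof.
elim: m => // m ih; rewrite !expnS; apply: leq_trans (_ : (y + k) * (y ^ m + m * k * y ^ m.-1) <= _); last first.
  by rewrite leq_mul2l ih orbT.
case: m {ih} => [|m]; first by rewrite !expn0 /=; lia.
rewrite !succnK expnS; move: (y ^ m) => z; nia.
Qed.

(** By Bernoulli with y = x - k, x^q >= y^q + q k y^(q-1) >= 2 y^q: a set of density k / x is missed
    by q >= x / k draws at most half of the time. *)
Lemma half_pow x k q : 0 < q -> x <= k * q -> 2 * (x - k) ^ q <= x ^ q.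
Proof.
move=> q0 h; have [l|l] := leqP x k.
  by rewrite (eqP (_ : x - k == 0)) ?subn_eq0 // exp0n // muln0.
have ex : x = (x - k) + k by lia.
rewrite [X in _ <= X ^ _]ex.
apply: leq_trans (bernoulli _ _ _); rewrite mul2n -addnn leq_add2l.
case: q q0 h => // q _ h; rewrite expnS leq_mul2r; apply/orP; right.
by rewrite mulnC; lia.
Qed.

Lemma leq_card_pairs (T1 T2 : finType) (Q : T1 -> T2 -> bool) c :
  (forall t1, #|[set t2 | Q t1 t2]| <= c) ->
  #|[set p : T1 * T2 | Q p.1 p.2]| <= #|T1| * c.
Proof.
move=> h; rewrite -sum1dep_card -(pair_big_dep xpredT Q (fun _ _ => 1)) /=.
rewrite -sum_nat_const; apply: leq_sum => t1 _.
by rewrite sum1dep_card.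
Qed.

Section Count.
Variables (n L : nat).
Hypothesis nL : n <= 2 ^ L.

Lemma card_hit_block (A : {set 'I_n}) :
  #|[set t : L.-tuple bool | ~~ [exists a in A, (a : nat) == unbits t]]| <= 2 ^ L - #|A|.
Proof.
set X := [set t | _]; have cT : #|{: L.-tuple bool}| = 2 ^ L by rewrite card_tuple card_bool.
have hA : #|A| <= #|~: X|.
  pose g (a : 'I_n) : L.-tuple bool := Tuple (introT eqP (size_bits L a)).
  have gi : injective g.
    move=> a a' /(congr1 val) /= h; apply: val_inj => /=.
    rewrite -(@bitsK L a) ?h ?bitsK //; apply: leq_trans nL; exact: ltn_ord.
  rewrite -(card_imset _ gi); apply: subset_leq_card; apply/subsetP => t /imsetP [a aA ->].
  rewrite !inE negbK; apply/existsP; exists a; rewrite aA /=.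
  by rewrite bitsK //; apply: leq_trans nL; exact: ltn_ord.
have := cardsC X; rewrite cT; move: (#|X|) (#|~: X|) (#|A|) hA => *; lia.
Qed.

Lemma card_miss q (A : {set 'I_n}) :
  #|[set t : (q * L).-tuple bool | ~~ hitsl (blocks L q t) A]| <= (2 ^ L - #|A|) ^ q.
Proof.
elim: q => [|q ih]; first by apply: leq_trans (max_card _) _; rewrite card_tuple mul0n.
set X := [set t : L.-tuple bool | ~~ [exists a in A, (a : nat) == unbits t]].
set Y := [set t : (q * L).-tuple bool | ~~ hitsl (blocks L q t) A] in ih.
pose g (p : L.-tuple bool * (q * L).-tuple bool) : (q.+1 * L).-tuple bool := [tuple of p.1 ++ p.2].
apply: leq_trans (_ : #|g @: setX X Y| <= _); last first.
  apply: leq_trans (leq_imset_card _ _) _.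
  by rewrite cardsX expnS leq_mul //; exact: card_hit_block.
apply: subset_leq_card; apply/subsetP => t; rewrite inE => ht.
have sx : size (take L t) == L by rewrite size_takel // size_tuple leq_addr.
have sy : size (drop L t) == q * L by rewrite size_drop size_tuple mulSn addKn.
apply/imsetP; exists (Tuple sx, Tuple sy); last first.
  by apply: val_inj; rewrite /= cat_take_drop.
rewrite inE !inE /=; apply/andP; split; apply: contra ht.
  move=> /existsP [a /andP [aA /eqP h]]; apply/existsP; exists a.
  by rewrite aA /= inE h eqxx.
move=> /existsP [a /andP [aA h]]; apply/existsP; exists a.
by rewrite aA /= inE h orbT.
Qed.

Lemma card_miss_family q k (F : seq {set 'I_n}) : (forall A, A \in F -> k <= #|A|) ->
  #|[set t : (q * L).-tuple bool | ~~ all (hitsl (blocks L q t)) F]| <= size F * (2 ^ L - k) ^ q.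
Proof.
elim: F => [|A F ih] hF.
  by rewrite (_ : [set _ | _] = set0) ?cards0 //; apply/setP => t; rewrite !inE.
apply: leq_trans (_ : #|[set t : (q * L).-tuple bool | ~~ hitsl (blocks L q t) A] :|:
   [set t : (q * L).-tuple bool | ~~ all (hitsl (blocks L q t)) F]| <= _).
  by apply: subset_leq_card; apply/subsetP => t; rewrite !inE /= negb_and.
apply: leq_trans (leq_card_setU _ _) _; rewrite /= mulSn; apply: leq_add.
  apply: leq_trans (card_miss _ _) _; by case: (q) => // q'; rewrite leq_exp2r // leq_sub2l // hF // inE eqxx.
by apply: ih => A' hA; apply: hF; rewrite inE hA orbT.
Qed.

(* The second family may depend on the first sample: the trees to be decomposed do. *)
Lemma two_samples q k (good : seq bool -> seq bool -> bool) (F1 : seq {set 'I_n}) :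
  size F1 <= n * n + n -> (forall A, A \in F1 -> k <= #|A|) ->
  (forall t1 : (q * L).-tuple bool, all (hitsl (blocks L q t1)) F1 ->
     exists F2 : seq {set 'I_n}, [/\ size F2 <= n, forall A, A \in F2 -> k <= #|A| &
       forall t2 : (q * L).-tuple bool, all (hitsl (blocks L q t2)) F2 -> good t1 t2]) ->
  #|[set t : (q * L + q * L).-tuple bool | ~~ good (take (q * L) t) (drop (q * L) t)]| <=
    2 ^ (q * L) * ((n * n + 2 * n) * (2 ^ L - k) ^ q).
Proof.
move=> sF hF h; set m := q * L in h *; set y := (2 ^ L - k) ^ q.
pose g (p : m.-tuple bool * m.-tuple bool) : (m + m).-tuple bool := [tuple of p.1 ++ p.2].
have cT : #|{: m.-tuple bool}| = 2 ^ m by rewrite card_tuple card_bool.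
pose X1 := [set t : m.-tuple bool | ~~ all (hitsl (blocks L q t)) F1].
pose Y2 := [set p : m.-tuple bool * m.-tuple bool |
  all (hitsl (blocks L q p.1)) F1 && ~~ good p.1 p.2].
apply: leq_trans (_ : #|g @: (setX X1 setT :|: Y2)| <= _).
  apply: subset_leq_card; apply/subsetP => t; rewrite inE => ht.
  have sx : size (take m t) == m by rewrite size_takel // size_tuple leq_addr.
  have sy : size (drop m t) == m by rewrite size_drop size_tuple addKn.
  apply/imsetP; exists (Tuple sx, Tuple sy); last first.
    by apply: val_inj; rewrite /= cat_take_drop.
  by rewrite !inE /= ht andbT; case: all.
apply: leq_trans (leq_imset_card _ _) _; apply: leq_trans (leq_card_setU _ _) _.
apply: leq_trans (_ : (n * n + n) * y * 2 ^ m + 2 ^ m * (n * y) <= _); last by nia.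
apply: leq_add.
  rewrite cardsX cardsT cT leq_mul2r; apply/orP; right.
  by apply: leq_trans (card_miss_family q hF) _; rewrite leq_mul2r sF orbT.
rewrite -cT; apply: (@leq_card_pairs _ _ (fun t1 t2 : m.-tuple bool =>
  all (hitsl (blocks L q t1)) F1 && ~~ good t1 t2)) => t1.
case: (boolP (all _ F1)) => h1; last first.
  by rewrite (_ : [set _ | _] = set0) ?cards0 //; apply/setP => t; rewrite !inE.
have [F2 [sF2 hF2 hg]] := h t1 h1.
apply: leq_trans (_ : size F2 * y <= _); last by rewrite leq_mul2r sF2 orbT.
apply: leq_trans (card_miss_family q hF2); apply: subset_leq_card; apply/subsetP => t2.
by rewrite !inE /=; apply: contra; exact: hg.
Qed.

End Count.

(** Each group of [q0] draws misses with probability at most 1/2, so all 5 L groups miss with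
    probability at most 2^(-5L). This pays for n * n + 2 * n sets and for the required failure rate
    1 / n. *)
Lemma sample_bound n L k q0 : 0 < L -> 0 < q0 -> n <= 2 ^ L -> 2 ^ L <= k * q0 ->
  n * ((n * n + 2 * n) * (2 ^ L - k) ^ (q0 * (5 * L))) <= 2 ^ (q0 * (5 * L) * L).
Proof.
move=> L0 q00 nL kq.
apply: leq_trans (_ : 2 ^ (5 * L) * (2 ^ L - k) ^ (q0 * (5 * L)) <= _).
  rewrite mulnA leq_mul2r; apply/orP; right.
  rewrite (_ : 5 * L = L + L + L + L + L) ?expnD; last by lia.
  have : 2 <= 2 ^ L by rewrite -[X in X <= _]expn1 leq_exp2l.
  move: (2 ^ L) nL => x nx x2.
  apply: leq_trans (_ : (x * x + 2 * x) * x <= _).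
    by rewrite mulnC; apply: leq_mul => //; apply: leq_add; rewrite ?leq_mul.
  nia.
have h := half_pow q00 kq.
have : (2 * (2 ^ L - k) ^ q0) ^ (5 * L) <= ((2 ^ L) ^ q0) ^ (5 * L) by rewrite leq_exp2r // muln_gt0.
by rewrite expnMn -!expnM [L * (q0 * _)]mulnC.
Qed.

(** An event about the string of [v0] has the same density among all assignments of strings:
    exchanging [r v0] with a spare string is injective. *)
Lemma ffun_fraction (n : nat) (T : finType) (v0 : 'I_n) (X : {set T}) :
  #|[set r : {ffun 'I_n -> T} | r v0 \in X]| * #|T| <= #|X| * #|{ffun 'I_n -> T}|.
Proof.
pose g (p : {ffun 'I_n -> T} * T) : T * {ffun 'I_n -> T} :=
  (p.1 v0, [ffun v => if v == v0 then p.2 else p.1 v]).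
have gi : injective g.
  move=> [r t] [r' t'] [h1 /ffunP h2]; have := h2 v0; rewrite !ffunE eqxx => ->.
  congr (_, _); apply/ffunP => v; have := h2 v; rewrite !ffunE.
  by case: eqP => [->|].
rewrite -(cardsT T) -cardsX -(card_imset _ gi) -(cardsT {ffun _ -> _}) -cardsX.
apply: subset_leq_card; apply/subsetP => p /imsetP [[r t]]; rewrite !inE /= andbT => hr ->.
by rewrite /= hr.
Qed.

(** * Parameters and round complexity *)

(* [cq0] is about n^(1/4) and [ck] about n^(3/4); [cqs] samples hit a set of
   [ck] vertices except with polynomially small probability. Keys are [cB]-ary
   pairs (distance, item), an item packs six digits in base [cb]. *)
Section Constants.
Variables (E a n : nat).

Definition cL := (trunc_log 2 n).+1.
Definition cN := 2 ^ cL.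
(** The exponent is rounded up, so that [ck * cq0], which is cq0^4, is at least [cN], the number of
    values of one draw. *)
Definition cq0 := 2 ^ ((cL + 3) %/ 4).
Definition ck := cq0 ^ 3.
Definition cqs := cq0 * (5 * cL).
Definition cN1 := (2 * E + 4) * cN.
Definition cfm := cN1 * n ^ a + 1.
(** Chosen for n * cfm <= N^cX: 1 for the factor n, 2 E + 5 for the constant in [cN1] and the
    increment, a + 1 for N n^a. The exponent [cg] also absorbs (E + 1)(2 E + 1), so that estimates
    fit into one digit. *)
Definition cX := 2 * E + a + 7.
Definition cI := (cX * cL).+1.
Definition cg := cX + 3 * E + 4.
Definition cb := cN ^ cg.
Definition cB := cb ^ 6.
Definition cM := 2 ^ Wd (9 * cg) n.

Lemma cnN : n < cN.
Proof. exact: trunc_log_ltn. Qed.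

Lemma cN2 : 1 < cN.
Proof. by rewrite /cN -[1]/(2 ^ 0) ltn_exp2l. Qed.

Lemma cME : cM = cb ^ 9.
Proof. by rewrite /cM /cb /cN /Wd -/cL -!expnM; congr (2 ^ _); lia. Qed.

Lemma le_cN c : c <= cN ^ c.
Proof. by apply: ltnW; apply: leq_trans (ltn_expl c (ltnSn 1)) _; case: c => // c; rewrite leq_exp2r //; exact: cN2. Qed.

Lemma pow_cN x y : x <= y -> cN ^ x <= cN ^ y.
Proof. by move=> h; rewrite leq_exp2l // cN2. Qed.

Lemma cfm_le : n * cfm <= cN ^ cX.
Proof.
have h1 : n ^ a <= cN ^ a by case: (a) => // a'; rewrite leq_exp2r // ltnW // cnN.
have N0 : 0 < cN by apply: ltnW cN2.
apply: leq_trans (_ : cN * ((2 * E + 5) * cN ^ a.+1) <= _).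
  apply: leq_mul; first exact: ltnW cnN.
  rewrite /cfm /cN1 (_ : 2 * E + 5 = (2 * E + 4) + 1); last by lia.
  rewrite [X in _ <= X]mulnDl mul1n; apply: leq_add; last by rewrite expn_gt0 N0.
  by rewrite -mulnA leq_mul2l expnS leq_mul2l h1 !orbT.
apply: leq_trans (_ : cN * (cN ^ (2 * E + 5) * cN ^ a.+1) <= _).
  by rewrite leq_mul2l leq_mul2r le_cN !orbT.
by rewrite -expnD -expnS; apply: pow_cN; rewrite /cX; lia.
Qed.

Lemma cq0_pow : cN <= cq0 ^ 4 /\ cq0 ^ 4 <= 2 ^ (cL + 3).
Proof.
by rewrite /cq0 /cN -expnM !leq_exp2l //; split; have := divn_eq (cL + 3) 4; have := ltn_pmod (cL + 3) (ltn0Sn 3); lia.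
Qed.

Lemma cq0_gt0 : 0 < cq0.
Proof. by rewrite expn_gt0. Qed.

Lemma ck_gt0 : 0 < ck.
Proof. by rewrite expn_gt0 cq0_gt0. Qed.

Lemma ck_q0 : cN <= ck * cq0.
Proof. by rewrite /ck -expnSr; exact: (proj1 cq0_pow). Qed.

Lemma ck_le : ck <= cN ^ 4.
Proof.
apply: leq_trans (_ : cq0 ^ 4 <= _); first by rewrite /ck leq_pexp2l // cq0_gt0.
apply: leq_trans (proj2 cq0_pow) _; rewrite /cN -expnM leq_exp2l //.
by have : 0 < cL by []; lia.
Qed.

Lemma pow_cb x : x <= cg -> cN ^ x <= cb.
Proof. exact: pow_cN. Qed.

Lemma cNb : cN <= cb.
Proof. by rewrite -[X in X <= _]expn1; apply: pow_cb; rewrite /cg; lia. Qed.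

Lemma cNB : cN * cN <= cB.
Proof.
rewrite /cB /cb -expnM mulnn; apply: pow_cN; rewrite /cg; lia.
Qed.

Lemma mul_cB x : x <= cb -> x * cB <= cM.
Proof.
move=> h; rewrite cME /cB; apply: leq_trans (_ : cb * cb ^ 6 <= _); first by rewrite leq_mul2r h orbT.
by rewrite -expnS; apply: leq_pexp2l => //; rewrite expn_gt0; apply/orP; left; exact: ltnW cN2.
Qed.

Lemma ccap : (capd ck E).+2 <= cb.
Proof.
apply: leq_trans (_ : cN ^ (2 * E + 7) <= _); last by apply: pow_cb; rewrite /cg /cX; lia.
apply: leq_trans (_ : (2 * E + 3) * cN ^ 4 <= _).
  have := ck_le; have : 0 < cN ^ 4 by rewrite expn_gt0; apply/orP; left; exact: ltnW cN2.
  rewrite /capd; move: (cN ^ 4) => z z0 kz.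
  have : (2 * E).+1 * ck <= (2 * E).+1 * z by rewrite leq_mul2l kz orbT.
  by rewrite (_ : 2 * E + 3 = (2 * E).+1 + 2) ?mulnDl; lia.
rewrite (_ : 2 * E + 7 = (2 * E + 3) + 4); last by lia.
by rewrite expnD leq_mul2r le_cN orbT.
Qed.

Lemma cIb : cI < cb.
Proof.
have h1 : cX * cL <= cN ^ cX * cN by apply: leq_mul (le_cN _) (ltnW (ltn_expl _ _)).
rewrite -expnSr in h1.
have h2 : cN ^ cX.+1 < cN ^ cX.+2 by rewrite ltn_exp2l ?cN2.
have h3 : cN ^ cX.+2 < cb by rewrite ltn_exp2l ?cN2 // /cg; lia.
by rewrite /cI; lia.
Qed.

Lemma cIB : 2 ^ cI <= cB.
Proof.
apply: leq_trans (_ : cN ^ cX.+1 <= _).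
  by rewrite /cN -expnM leq_exp2l // /cI; have : 0 < cL by []; nia.
by rewrite /cB /cb -expnM; apply: pow_cN; rewrite /cg; lia.
Qed.

Lemma cFI : trunc_log 2 (n * cfm) < cI.
Proof.
rewrite ltnS; apply: leq_trans (leq_trunc_log 2 cfm_le) _.
by rewrite /cN -expnM trunc_expnK // mulnC.
Qed.

Lemma cestb : E.+1 * (2 * E).+1 * (n * cfm) < cb.
Proof.
apply: leq_ltn_trans (_ : cN ^ (E.+1 + (2 * E).+1 + cX) < _).
  by rewrite 2!expnD; apply: leq_mul cfm_le; apply: leq_mul; exact: le_cN.
by rewrite ltn_exp2l ?cN2 // /cg; lia.
Qed.

Lemma cfb : 0 < n -> cfm < cb.
Proof.
move=> n0; apply: leq_ltn_trans cestb; rewrite mulnA.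
by apply: leq_pmull; rewrite muln_gt0 n0.
Qed.

Lemma cD D : D < n -> 4 * D + 4 <= cb.
Proof.
move=> h; apply: leq_trans (_ : cN ^ 3 <= _); last by apply: pow_cb; rewrite /cg; lia.
have := cnN; have := cN2; move: cN => x; rewrite !expnS expn0 => *; nia.
Qed.

(** The scales contribute a logarithm times [ck]; broadcasting all pairs of samples costs 25 L^2
    q0^2, where q0^2 <= k. Hence two logarithms suffice. *)
Lemma cround D : 0 < D ->
  round_total ck cqs cI D cL E (4 * D) <= (200 + cX.+1 * (4 * E + 20)) * (cL * cL * (ck + D)).
Proof.
move=> D0; rewrite /round_total /capd.
have L0 : 0 < cL by []; have q0 := cq0_gt0.
set U := cL * cL * (ck + D).
have LU x y : x <= cL -> y <= ck + D -> x * y <= U.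
  by move=> h1 h2; apply: leq_mul => //; apply: leq_trans h1 _; rewrite leq_pmulr.
have k0 := ck_gt0.
have hD : D <= U by rewrite -[X in X <= _]mul1n; apply: LU => //; lia.
have h1 : 1 <= U by apply: leq_trans hD.
have hL : cL <= U by rewrite -[X in X <= _]muln1; apply: LU => //; lia.
have hk : ck <= U by rewrite -[X in X <= _]mul1n; apply: LU => //; lia.
have qk : cq0 * cq0 <= ck by rewrite /ck mulnn leq_pexp2l.
have qk1 : cq0 <= ck by rewrite /ck -[X in X <= _]expn1 leq_pexp2l.
have hLk : cL * ck <= U by apply: LU => //; lia.
have hqs : cqs <= 5 * U.
  rewrite /cqs mulnC -mulnA leq_mul2l /=; apply: LU => //; lia.
have hLq : cL * cqs <= 5 * U.
  rewrite /cqs (_ : cL * _ = 5 * (cL * cL * cq0)); last by lia.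
  by rewrite leq_mul2l /= leq_mul //; lia.
have hqq : cqs * cqs <= 25 * U.
  rewrite /cqs (_ : _ * _ = 25 * (cL * cL * (cq0 * cq0))); last by lia.
  by rewrite leq_mul2l /= leq_mul //; lia.
have hI x : cL * x <= (2 * E + 10) * U -> cI * x <= cX.+1 * ((2 * E + 10) * U).
  move=> h; apply: leq_trans (_ : cX.+1 * (cL * x) <= _); last by rewrite leq_mul2l h orbT.
  by rewrite mulnA leq_mul2r /cI mulSn; apply/orP; right; lia.
have i1 : cI * ((2 * E).+1 * ck + ck).+1 <= cX.+1 * ((2 * E + 10) * U).
  apply: hI.
  rewrite (_ : cL * _ = (2 * E + 2) * (cL * ck) + cL); last by lia.
  have : (2 * E + 2) * (cL * ck) <= (2 * E + 2) * U by rewrite leq_mul2l hLk orbT.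
  by lia.
have i2 : cI * ((2 * E).+1 * ck + cqs).+1 <= cX.+1 * ((2 * E + 10) * U).
  apply: hI.
  rewrite (_ : cL * _ = (2 * E + 1) * (cL * ck) + cL * cqs + cL); last by lia.
  have : (2 * E + 1) * (cL * ck) <= (2 * E + 1) * U by rewrite leq_mul2l hLk orbT.
  by lia.
have i3 : cqs.+2 * cqs <= 35 * U by rewrite !mulSn; lia.
rewrite mulnDl (_ : cX.+1 * (4 * E + 20) * U = cX.+1 * ((2 * E + 10) * U) + cX.+1 * ((2 * E + 10) * U)); last by lia.
move: (cX.+1 * _) (cI * _) (cI * _) (cqs.+2 * _) (cqs * _) i1 i2 i3 hqq => *; lia.
Qed.

End Constants.

Lemma leq_INR x y : x <= y -> Rle (INR x) (INR y).
Proof. by move=> /leP; exact: le_INR. Qed.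

Lemma INR_expn x y : INR (x ^ y) = pow (INR x) y.
Proof.
elim: y => [|y ih]; first by rewrite expn0.
by rewrite expnS -multE mult_INR ih.
Qed.

(** * Comparison with the real-valued round bound *)

Section RealBound.
Local Open Scope R_scope.

(** Powers of n and D are at least 1, so the first two terms of the minimum dominate n^(3/4) + D.
    The factor 2 is for the third term n, using D < n. *)
Lemma round_bound_lower (n D : nat) : (0 < D)%N -> (D < n)%N ->
  Rpower (INR n) (3 / 4) + INR D <= 2 * round_bound n D.
Proof.
move=> D0 Dn; have D1 : 1 <= INR D by apply: (leq_INR D0).
have Dn' : INR D <= INR n by apply: leq_INR; exact: ltnW.
have n1 : 1 <= INR n by lra.
have pw x y z : 1 <= x -> y <= z -> Rpower x y <= Rpower x z by move=> ? ?; apply: Rle_Rpower.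
have p0 x : 1 <= x -> Rpower x 0 = 1 by move=> ?; apply: Rpower_O; lra.
have p1 x : 1 <= x -> Rpower x 1 = x by move=> ?; apply: Rpower_1; lra.
have h1 : 1 <= Rpower (INR D) (1 / 4) by rewrite -{1}(p0 (INR D)) //; apply: pw => //; lra.
have h2 : 1 <= Rpower (INR n) (1 / 4) by rewrite -{1}(p0 (INR n)) //; apply: pw => //; lra.
have h3 : 1 <= Rpower (INR n) (3 / 4) by rewrite -{1}(p0 (INR n)) //; apply: pw => //; lra.
have h4 : Rpower (INR n) (3 / 4) <= INR n by rewrite -{2}(p1 (INR n)) //; apply: pw => //; lra.
have h5 : 0 < Rpower (INR n) (65 / 100) by apply: exp_pos.
have h6 : 0 < Rpower (INR D) (2 / 5) by apply: exp_pos.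
have h7 : 0 < Rpower (INR n) (65 / 100) * Rpower (INR D) (2 / 5) by apply: Rmult_lt_0_compat.
have h8 : INR D <= Rpower (INR n) (1 / 4) * INR D.
  by rewrite -{1}[INR D]Rmult_1_l; apply: Rmult_le_compat_r; lra.
have h9 : Rpower (INR n) (3 / 4) <= Rpower (INR n) (3 / 4) * Rpower (INR D) (1 / 4).
  by rewrite -{1}[Rpower (INR n) _]Rmult_1_r; apply: Rmult_le_compat_l; lra.
rewrite /round_bound /Rmin; repeat destruct (Rle_dec _ _); lra.
Qed.

Lemma ck_real n : (2 < n)%N -> INR (ck n) <= 8 * Rpower (INR n) (3 / 4).
Proof.
move=> n2; have n0 : 1 <= INR n by apply: (@leq_INR 1); lia.
set x := Rpower (INR n) (1 / 4).
have x0 : 0 < x by apply: exp_pos.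
have xk k : x ^ k = Rpower (INR n) (INR k * (1 / 4)).
  by rewrite -Rpower_pow // /x Rpower_mult Rmult_comm.
have x4 : x ^ 4 = INR n.
  rewrite xk (_ : INR 4 * (1 / 4) = 1) ?Rpower_1; [by []|lra|simpl; lra].
have x3 : x ^ 3 = Rpower (INR n) (3 / 4).
  by rewrite xk; congr Rpower; simpl; lra.
(* q0^4 <= 2^(L + 3), which is 16 times the largest power of two not above n. *)
have q4 : INR (cq0 n) ^ 4 <= (2 * x) ^ 4.
  rewrite Rpow_mult_distr x4 -INR_expn.
  have : (cq0 n ^ 4 <= 16 * n)%N.
    have [_ h] := cq0_pow n; apply: leq_trans h _.
    rewrite /cL addSn -addnS addnC expnD -[(2 ^ 4)%N]/16%N leq_mul2l trunc_logP //.
    exact: ltnW (ltnW n2).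
  by move=> /leq_INR; rewrite -multE mult_INR (_ : INR 16 = 2 ^ 4); [|simpl; lra].
have q1 : INR (cq0 n) <= 2 * x.
  case: (Rle_lt_dec (INR (cq0 n)) (2 * x)) => // h.
  have h0 : 0 <= 2 * x by lra.
  have h2 : (2 * x) ^ 2 < INR (cq0 n) ^ 2 by rewrite /= !Rmult_1_r; nra.
  have h3 : 0 <= (2 * x) ^ 2 by apply: pow_le.
  have : (2 * x) ^ 4 < INR (cq0 n) ^ 4.
    rewrite (_ : 4%N = (2 * 2)%coq_nat) // !pow_mult.
    move: h2 h3; move: ((2 * x) ^ 2) (INR (cq0 n) ^ 2) => y z h2 h3.
    by rewrite /= !Rmult_1_r; nra.
  by lra.
rewrite /ck INR_expn -x3 (_ : 8 * x ^ 3 = (2 * x) ^ 3); last by ring.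
by apply: pow_incr; split=> //; exact: pos_INR.
Qed.

Lemma cL_real n : (2 < n)%N -> INR (cL n) <= 4 * ln (INR n) /\ 0 < ln (INR n).
Proof.
move=> n2; set l := trunc_log 2 n.
have l1 : (1 <= l)%N.
  by rewrite /l; apply: trunc_log_max => //; exact: ltnW.
have hl : (2 ^ l <= n)%N by apply: trunc_logP => //; exact: ltnW (ltnW n2).
have hr : INR l * ln 2 <= ln (INR n).
  have h := leq_INR hl; have e2 : INR 2 = 2 by [].
  rewrite INR_expn e2 in h.
  have hp : Rpower 2 (INR l) = 2 ^ l by apply: Rpower_pow; lra.
  rewrite -hp in h; rewrite -[X in X <= _]ln_exp.
  case: h => [h|<-]; last by right.
  by left; apply: ln_increasing => //; exact: exp_pos.
have l2 := ln_lt_2.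
have l1' : 1 <= INR l by apply: (leq_INR l1).
rewrite /cL -/l S_INR; split; nra.
Qed.

Lemma round_real (E a n D : nat) : (2 < n)%N -> (0 < D)%N -> (D < n)%N ->
  INR (round_total (ck n) (cqs n) (cI E a n) D (cL n) E (4 * D)) <=
  (INR (200 + (cX E a).+1 * (4 * E + 20)) * 256) * ln (INR n) ^ 2 * round_bound n D.
Proof.
move=> n2 D0 Dn; apply: Rle_trans (leq_INR (@cround E a n D D0)) _.
move: (200 + _)%N => c; have C0 := pos_INR c.
rewrite -!multE -plusE !mult_INR plus_INR.
set ln2 := ln (INR n) ^ 2; set rb := round_bound n D.
have -> : INR c * 256 * ln2 * rb = INR c * (256 * ln2 * rb) by ring.
apply: Rmult_le_compat_l => //; rewrite {}/ln2 {}/rb.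
have [hL l0] := cL_real n2; have hk := ck_real n2; have hb := round_bound_lower D0 Dn.
have p0 : 0 < Rpower (INR n) (3 / 4) by apply: exp_pos.
have L0 := pos_INR (cL n).
have h1 : INR (cL n) * INR (cL n) <= 16 * ln (INR n) ^ 2.
  have h := Rmult_le_compat _ _ _ _ L0 L0 hL hL.
  by rewrite (_ : 16 * ln (INR n) ^ 2 = 4 * ln (INR n) * (4 * ln (INR n))); [|ring].
have dD := pos_INR D; have dk := pos_INR (ck n).
have h2 : INR (ck n) + INR D <= 16 * round_bound n D by lra.
have h3 : 0 <= INR (ck n) + INR D by lra.
apply: Rle_trans (Rmult_le_compat _ _ _ _ (Rmult_le_pos _ _ L0 L0) h3 h1 h2) _.
by right; ring.
Qed.

Lemma ratio_real (E g g' : nat) eps : (0 < E)%N -> 4 <= INR E * eps ->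
  (E * g <= (2 * E + 4) * g')%N -> INR g <= (2 + eps) * INR g'.
Proof.
move=> E0 h4 /leq_INR; rewrite -!multE -plusE !mult_INR plus_INR mult_INR.
rewrite (_ : INR 2 = 2) // (_ : INR 4 = 4); last by simpl; lra.
have e1 : 1 <= INR E by apply: (leq_INR E0).
have g0 := pos_INR g'; move=> h; apply: (Rmult_le_reg_l (INR E)); first by lra.
apply: Rle_trans h _; rewrite -Rmult_assoc; apply: Rmult_le_compat_r => //; lra.
Qed.

End RealBound.

(** * The algorithm for fixed [E] and [a], and its correctness *)

Definition wof (nb : seq (nat * nat)) (u : nat) : nat := (head (0, 0) [seq x <- nb | x.1 == u]).2.

Lemma wof_nbrs n (e : rel 'I_n) w v u : e v u -> wof (nbrs e w v) u = w v u.
Proof.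
move=> evu; rewrite /wof.
have : (nat_of_ord u, w v u) \in [seq x <- nbrs e w v | x.1 == u :> nat].
  rewrite mem_filter eqxx /=; apply/mapP; exists u => //.
  by rewrite mem_filter evu mem_enum.
case h : [seq x <- _ | _] => [//|[a c] s] _ /=.
have : (a, c) \in [seq x <- nbrs e w v | x.1 == u :> nat] by rewrite h inE eqxx.
by rewrite mem_filter => /andP [/= /eqP -> /mapP [u' _ [/val_inj <- ->]]].
Qed.

Definition mwc_prog (E a n id : nat) (nb : seq (nat * nat)) (rnd : seq bool) : prog nat :=
  let m := cqs n * cL n in
  whole (cB E a n) (cM E a n) (cb E a n) (cN n) (ck n) (cqs n) (cI E a n) E n id (unzip1 nb)
    (fun u => cN1 E n * wof nb u + 1) (cN1 E n)
    (blocks (cL n) (cqs n) (take m rnd)) (blocks (cL n) (cqs n) (drop m rnd)) (cL n).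

Definition mwc_algo (E a : nat) : congest_algo :=
  algo (9 * cg E a) (cB E a) (fun n => cqs n * cL n + cqs n * cL n) (mwc_prog E a).

Lemma three_vertices n (e : rel 'I_n) : (exists c : seq 'I_n, is_cycle e c) -> 2 < n.
Proof.
move=> [c /and3P [sc uc _]]; apply: leq_trans sc _.
by rewrite -(card_uniqP uc) -[n in _ <= n]card_ord max_card.
Qed.

Lemma diam_bounds n (e : rel 'I_n) D : 2 < n -> hop_diameter e D -> 0 < D /\ D < n.
Proof.
move=> n2 [h1 [u [v h2]]]; split.
  case: D h1 h2 => [|//] h1 _; have n0 : 0 < n by lia. have n1 : 1 < n by lia.
  have [q [_ hl]] := h1 (Ordinal n0) (Ordinal n1); rewrite leqn0 => /nilP q0; subst q.
  by move/(congr1 val): hl.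
have [p [p1 p2 p3]] := h1 u v; case/shortenP: p1 p2 => q q1 q2 _ h3.
apply: leq_ltn_trans (h2 q q1 h3) _.
by have := card_uniqP q2; have := max_card (mem (u :: q)); rewrite card_ord /= => + h; rewrite h.
Qed.

Section Correct.
Variables (E a n : nat) (e : rel 'I_n) (w : 'I_n -> 'I_n -> nat) (W D : nat) (eps : R).
Hypotheses (E0 : 0 < E) (Eeps : Rle 4 (Rmult (INR E) eps)).
Hypotheses (sg : simple_graph e) (symw : sym_weights e w) (wb : weights_bounded e w W).
Hypotheses (Wn : W <= n ^ a) (hD : hop_diameter e D) (hc : exists c : seq 'I_n, is_cycle e c).

(* Since n (2E + 4) < [cN1], division by [cN1] recovers the [w]-weight of a cycle
   and the increments only affect the approximation ratio below 1/[cN1]. *)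
Let f (u v : 'I_n) := if e u v then cN1 E n * w u v + 1 else 1.
Let wfl (v : 'I_n) (u : nat) := cN1 E n * wof (nbrs e w v) u + 1.
Let Tb := round_total (ck n) (cqs n) (cI E a n) D (cL n) E (4 * D).

Lemma path_len_f u p : path e u p -> path_len f u p = cN1 E n * path_len w u p + size p.
Proof.
elim: p u => [|v p ih] u /=; first by rewrite muln0.
by move=> /andP [euv /ih h]; rewrite !path_len_cons h /f euv; lia.
Qed.

Lemma cycle_weight_f c : is_cycle e c -> cycle_weight f c = cN1 E n * cycle_weight w c + size c.
Proof. by case: c => // x p /and3P [_ _ h]; rewrite !cycle_weight_cons path_len_f // size_rcons. Qed.

Lemma size_cycle c : is_cycle e c -> size c <= n.
Proof. by move=> /and3P [_ u _]; rewrite -(card_uniqP u) -[n in _ <= n]card_ord max_card. Qed.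

(** Success in terms of the two halves of the string of node 0, whatever the other nodes hold; [c0]
    is a lightest cycle for [f]. *)
Let outcome (t1 t2 : seq bool) := exists T c c0, [/\ is_cycle e c, is_cycle e c0,
   forall c', is_cycle e c' -> cycle_weight f c0 <= cycle_weight f c',
   E * (E * cycle_weight f c) <= E.+1 * (2 * E).+1 * cycle_weight f c0 &
   T <= Tb /\ forall sm1 sm2 : 'I_n -> seq nat,
     (forall v : 'I_n, v = 0 :> nat -> sm1 v = blocks (cL n) (cqs n) t1 /\ sm2 v = blocks (cL n) (cqs n) t2) ->
     runs (cB E a n) (cM E a n) e (fun v : 'I_n => whole (cB E a n) (cM E a n) (cb E a n) (cN n) (ck n)
       (cqs n) (cI E a n) E n v (unzip1 (nbrs e w v)) (wfl v) (cN1 E n) (sm1 v) (sm2 v) (cL n)) T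
       (fun _ => cycle_weight f c %/ cN1 E n)].

Lemma outcome_count :
  #|[set t : (cqs n * cL n + cqs n * cL n).-tuple bool |
     ~~ pbool (outcome (take (cqs n * cL n) t) (drop (cqs n * cL n) t))]| <=
  2 ^ (cqs n * cL n) * ((n * n + 2 * n) * (2 ^ cL n - ck n) ^ cqs n).
Proof.
have n2 := three_vertices hc; have [D0 Dn] := diam_bounds n2 hD.
have [esym eirr] := sg; have nN := cnN n.
have n0 : 0 < n by lia.
have [c1 hc1] := hc.
have [|x hx _] := @least_ex (fun x => exists c, is_cycle e c /\ cycle_weight f c = x) (cycle_weight f c1).
  by exists c1.
have [[c0 [hc0 ex]] mn] := least_some hx; subst x.
have {}mn c' : is_cycle e c' -> cycle_weight f c0 <= cycle_weight f c'.
  by move=> h; apply: mn; exists c'.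
have f0 u v : 0 < f u v by rewrite /f; case: ifP => // _; rewrite addn1.
have fsym : wsym e f by move=> u v euv; rewrite /f -(esym u v) euv (symw euv).
have hw u v : e u v -> wfl v u = f v u.
  by move=> euv; rewrite /wfl /f esym euv wof_nbrs // esym.
have hnb v u : u \in unzip1 (nbrs e w v) <-> exists2 u0 : 'I_n, u = u0 & e u0 v.
  rewrite /unzip1 /nbrs -map_comp; split=> [/mapP [u0]|[u0 -> h]].
    by rewrite mem_filter => /andP [h _] ->; exists u0; rewrite // esym.
  by apply/mapP; exists u0; rewrite // mem_filter esym h mem_enum.
have ffm u v : f u v <= cfm E a n.
  rewrite /f /cfm; case: ifP => h; last by rewrite addn1.
  by rewrite leq_add2r leq_mul2l (leq_trans (wb h) Wn) orbT.
have hopD u v : exists q, [/\ path e u q, last u q = v & size q <= D].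
  by have [h _] := hD; exact: h.
pose v0 := Ordinal n0.
have Dfuel : D <= 2 ^ cL n by apply: ltnW; apply: ltn_trans Dn nN.
have MD := mul_cB (cD E a Dn).
have := @whole_runs (cB E a n) (cM E a n) (cb E a n) (cN n) (ck n) (cqs n) (cI E a n) n D (cL n) (cN1 E n) e v0
  esym eirr erefl f f0 fsym E (cfm E a n) wfl hw (fun v => unzip1 (nbrs e w v)) hnb E0 (ck_gt0 n) (ltnW nN)
  (cN2 n) (cNB E a n) erefl (mul_cB (ccap E a n)) MD (cIB E a n) ffm (cFI E a n) (cestb E a n) (cIb E a n)
  (cNb E a n) (cfb E a n0) D0 Dfuel hopD c0 hc0.
set F1 := hit_sets1 _ _ _ _ _ => main.
apply: (@two_samples n (cL n) (ltnW nN) (cqs n) (ck n) (fun t1 t2 => pbool (outcome t1 t2)) F1).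
- exact: size_hit_sets1.
- by move=> A; rewrite mem_filter => /andP [].
move=> t1 h1; have [||par hpar] := main (blocks (cL n) (cqs n) t1) _ _ h1.
- by rewrite size_blocks.
- exact: blocks_lt.
exists (hit_sets2 (ck n) par); split; first exact: size_hit_sets2.
  by move=> A; rewrite mem_filter => /andP [].
move=> t2 h2; apply/pboolP.
have [|T [c [g1 g2 g3 g4]]] := hpar (blocks (cL n) (cqs n) t2) _ h2; first by rewrite size_blocks.
exists T, c, c0; split=> //; split=> // sm1 sm2 hsm.
have [e1 e2] := hsm v0 erefl; apply: (g4 _ _ e1 e2); exact: blocks_lt.
Qed.

Lemma outcome_approx c c0 : is_cycle e c -> is_cycle e c0 ->
   (forall c', is_cycle e c' -> cycle_weight f c0 <= cycle_weight f c') ->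
   E * (E * cycle_weight f c) <= E.+1 * (2 * E).+1 * cycle_weight f c0 ->
   mwc_approx eps e w (cycle_weight f c %/ cN1 E n).
Proof.
move=> h1 h2 mn hE.
have n2 := three_vertices hc; have nN := cnN n.
have N1n : (2 * E + 4) * n < cN1 E n by rewrite /cN1 ltn_mul2l nN andbT; lia.
have nN1 : n < cN1 E n by apply: leq_ltn_trans N1n; rewrite leq_pmull //; lia.
have N10 : 0 < cN1 E n by lia.
have -> : cycle_weight f c %/ cN1 E n = cycle_weight w c.
  rewrite cycle_weight_f // mulnC divnMDl // divn_small ?addn0 //.
  by apply: leq_ltn_trans nN1; exact: size_cycle.
split=> [|c' h3]; first by exists c.
have key : E * cycle_weight w c <= (2 * E + 4) * cycle_weight w c'.
  have l1 := mn c' h3; rewrite [in X in _ <= X]cycle_weight_f // in l1.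
  have l2 := size_cycle h3; rewrite cycle_weight_f // in hE.
  move: (cycle_weight f c0) (cycle_weight w c) (cycle_weight w c') (size c) (size c') (cN1 E n) N10 N1n l1 l2 hE
    => G g g' s s' N1 N10 N1n l1 l2 hE.
  (* (E + 1)(2 E + 1) <= E (2 E + 4) because E >= 1. *)
  have s1 : E * (E * (N1 * g)) <= E * ((2 * E + 4) * (N1 * g' + n)).
    apply: leq_trans (_ : E * (E * (N1 * g + s)) <= _); first by rewrite !leq_mul2l leq_addr !orbT.
    apply: leq_trans hE _; apply: leq_trans (_ : E.+1 * (2 * E).+1 * (N1 * g' + n) <= _).
      by rewrite leq_mul2l; apply/orP; right; lia.
    by rewrite mulnA leq_mul2r; apply/orP; right; nia.
  rewrite leq_pmul2l // in s1.
  (* The excess (2 E + 4) n due to the increments is below [N1], so it disappears from an inequality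
     between multiples of [N1]. *)
  have s2 : N1 * (E * g) < N1 * ((2 * E + 4) * g' + 1).
    rewrite mulnCA mulnDr muln1 (mulnCA N1); apply: leq_ltn_trans s1 _.
    by rewrite mulnDr ltn_add2l.
  by rewrite ltn_mul2l in s2; move/andP: s2 => [_]; rewrite addn1 ltnS.
exact: ratio_real E0 Eeps key.
Qed.

Lemma good_run (r : 'I_n -> seq bool) t1 t2 : outcome t1 t2 ->
  (forall v : 'I_n, v = 0 :> nat -> take (cqs n * cL n) (r v) = t1 /\ drop (cqs n * cL n) (r v) = t2) ->
  forall v, exists t g, [/\ t <= Tb, output_at (mwc_algo E a) e w r t v = Some g,
    (forall s, s < t -> output_at (mwc_algo E a) e w r s v = None) & mwc_approx eps e w g].
Proof.
move=> [T [c [c0 [h1 h2 h3 h4 [h5 h6]]]]] hr v; exists T, (cycle_weight f c %/ cN1 E n).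
have b0 : 0 < 9 * cg E a by rewrite /cg; lia.
have [|o1 o2] := @algo_output (9 * cg E a) (cB E a) (fun n => cqs n * cL n + cqs n * cL n) (mwc_prog E a) b0
  n e w r T (fun _ => cycle_weight f c %/ cN1 E n) _ v.
  apply: (h6 (fun v => blocks (cL n) (cqs n) (take (cqs n * cL n) (r v)))
             (fun v => blocks (cL n) (cqs n) (drop (cqs n * cL n) (r v)))) => u hu.
  by have [-> ->] := hr u hu.
by split=> //; exact: outcome_approx h1 h2 h3 h4.
Qed.

Lemma mwc_algo_whp : whp_succeeds (mwc_algo E a) eps Tb e w.
Proof.
have n2 := three_vertices hc; have n0 : 0 < n by lia.
pose m := cqs n * cL n; pose TT := (m + m).-tuple bool; pose v0 := Ordinal n0.
pose X := [set t : TT | ~~ pbool (outcome (take m t) (drop m t))].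
have cT : #|{: TT}| = 2 ^ m * 2 ^ m by rewrite card_tuple card_bool expnD.
have hX : n * #|X| <= #|{: TT}|.
  rewrite cT; apply: leq_trans (_ : n * (2 ^ m * ((n * n + 2 * n) * (2 ^ cL n - ck n) ^ cqs n)) <= _).
    by rewrite leq_mul2l outcome_count orbT.
  rewrite mulnCA leq_mul2l; apply/orP; right; apply: sample_bound => //.
  - exact: cq0_gt0.
  - exact: ltnW (cnN n).
  - exact: ck_q0.
have := ffun_fraction v0 X; set Y := [set r | _] => hY.
rewrite /whp_succeeds; set gd := (X in _ <= n * X); set Om := (X in _ * X <= _).
have hYO : n * #|Y| <= Om.
  have T0 : 0 < #|{: TT}| by rewrite cT muln_gt0 expn_gt0.
  rewrite -(leq_pmul2r T0) -mulnA; apply: leq_trans (_ : n * (#|X| * Om) <= _).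
    by rewrite leq_mul2l; apply/orP; right; exact: hY.
  by rewrite mulnA mulnC leq_mul2l hX orbT.
have hG : Om <= gd + #|Y|.
  rewrite /gd -[Om]cardsT; apply: leq_trans (leq_card_setU _ _); apply: subset_leq_card.
  apply/subsetP => r _; rewrite !inE; case: (pboolP (outcome _ _)) => ho; last by rewrite orbT.
  rewrite orbF; apply/pboolP => v; apply: (good_run ho) => u hu.
  by have -> : u = v0 by apply: val_inj.
have hn : n * Om <= n * gd + Om.
  by apply: leq_trans (_ : n * (gd + #|Y|) <= _); [rewrite leq_mul2l hG orbT|rewrite mulnDr leq_add2l].
by rewrite mulnBl mul1n leq_subLR addnC.
Qed.

End Correct.

Theorem theorem6 :
  forall (eps : R), Rlt 0 eps ->
  forall a : nat,  (* W = poly(n): W <= n^a *)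
  exists (A : congest_algo) (C : R) (k : nat),
    forall (n : nat) (e : rel 'I_n) (w : 'I_n -> 'I_n -> nat) (W D : nat),
      simple_graph e -> sym_weights e w -> weights_bounded e w W ->
      W <= n ^ a -> hop_diameter e D ->
      (exists c : seq 'I_n, is_cycle e c) ->
      exists T : nat,
        Rle (INR T) (Rmult (Rmult C (pow (ln (INR n)) k)) (round_bound n D)) /\
        whp_succeeds A eps T e w.
Proof.
move=> eps eps0 a.
have e4 : Rlt 0 (Rdiv eps 4) by lra.
(* The ratio achieved is 2 + 4 / E, so 1 / E < eps / 4 is enough. *)
have [E [hE /ltP E0]] := archimed_cor1 _ e4.
have Er : Rle 1 (INR E) by apply: (leq_INR E0).
have Eeps : Rle 4 (Rmult (INR E) eps).
  have := Rmult_lt_compat_l (INR E) _ _ _ hE; rewrite Rinv_r; last by lra.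
  by move=> h; have := h ltac:(lra); lra.
exists (mwc_algo E a), (Rmult (INR (200 + (cX E a).+1 * (4 * E + 20))) 256), 2.
move=> n e w W D sg symw wb Wn hD hc.
exists (round_total (ck n) (cqs n) (cI E a n) D (cL n) E (4 * D)); split.
  have n2 := three_vertices hc; have [D0 Dn] := diam_bounds n2 hD.
  exact: round_real.
exact: (mwc_algo_whp E0 Eeps sg symw wb Wn hD hc).
Qed.
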